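(* (GG) Let $I$ be a Gamma--Gamma random variable with shape parameters $\alpha\ge\beta>0$ and let $\tau=\alpha/\beta\ge1$. For all sufficiently large $\alpha,\beta$, the skewness of $\ln I$ satisfies $\gamma_{1,\log,\mathrm{GG}}<0$. Moreover, for each fixed $\tau\ge 1$, the unique real $\lambda$ that eliminates the leading-order skewness of the Box--Cox transformed variable $T_\lambda(I)$, i.e. for which $\sqrt{\beta}\,\gamma_{1,\mathrm{GG}}(\lambda)\to 0$ as $\beta\to\infty$ with $\alpha=\tau\beta$, is $$\lambda_{\mathrm{GG}}^{\star}=\frac{\tau^2+1}{3(\tau+1)^2},\qquad \frac16\le\lambda_{\mathrm{GG}}^{\star}<\frac13 .$$ (LR) Let $I$ be a Lognormal--Rician random variable with parameters $r>0$ and $\sigma_z^2>0$, and let $V_0=\sigma_z^2+\frac{2}{1+r}$ and $\rho=\frac{1}{(1+r)V_0}=\frac{1}{2+(1+r)\sigma_z^2}\in(0,1/2)$. For all sufficiently large $r$ and sufficiently small $\sigma_z^2$, the skewness of $\ln I$ satisfies $\gamma_{1,\log,\mathrm{LR}}<0$. Moreover, for each fixed $\rho\in(0,1/2)$ (equivalently, fixed value of $(1+r)\sigma_z^2>0$), the unique real $\lambda$ (among those for which the skewness of $T_\lambda(I)$ is defined) that eliminates the leading-order skewness of $T_\lambda(I)$, i.e. for which $\gamma_{1,\mathrm{LR}}(\lambda)/\sqrt{V_0}\to0$ as $V_0\to0$ with $\rho$ fixed, is $$\lambda_{\mathrm{LR}}^{\star}=\frac{2}{\left[2+(1+r)\sigma_z^2\right]^2},\qquad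 0<\lambda_{\mathrm{LR}}^{\star}<\frac12 .$$
   Context: The skewness of a random variable $W$ with finite third absolute moment and positive variance is $\mathbb{E}[(W-\mathbb{E}W)^3]/\operatorname{Var}(W)^{3/2}$. The (one-parameter) Box--Cox transformation of a positive variable is $T_\lambda(x)=(x^\lambda-1)/\lambda$ for $\lambda\ne0$ and $T_0(x)=\ln x$. Here $\gamma_{1,\mathrm{GG}}(\lambda)$ and $\gamma_{1,\mathrm{LR}}(\lambda)$ denote the skewness of $T_\lambda(I)$ when $I$ is Gamma--Gamma, respectively Lognormal--Rician, and $\gamma_{1,\log,\mathrm{GG}},\gamma_{1,\log,\mathrm{LR}}$ denote the skewness of $\ln I$ (the case $\lambda=0$). The Gamma--Gamma distribution with shape parameters $\alpha,\beta>0$ has density $$\frac{2(\alpha\beta)^{(\alpha+\beta)/2}}{\Gamma(\alpha)\Gamma(\beta)}\,x^{\frac{\alpha+\beta}{2}-1}K_{\alpha-\beta}\!\left(2\sqrt{\alpha\beta x}\right)$$ on $(0,\infty)$, with $K_\nu$ the modified Bessel function of the second kind; equivalently, it is the law of a product of two independent Gamma variables with mean $1$ and shapes $\alpha$ and $\beta$. Its moments are $\mathbb{E}[I^q]=\frac{\Gamma(\alpha+q)\Gamma(\beta+q)}{\Gamma(\alpha)\Gamma(\beta)}(\alpha\beta)^{-q}$. The Lognormal--Rician distribution with parameters $r,\sigma_z^2>0$ has density $$\frac{(1+r)e^{-r}}{\sqrt{2\pi}\,\sigma_z}\int_0^\infty \frac{dz}{z^2}\,I_0\!\left(2\left[\frac{(1+r)r}{z}x\right]^{1/2}\right)\exp\!\left(-\frac{1+r}{z}x-\frac{1}{2\sigma_z^2}\left(\ln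 z+\tfrac12\sigma_z^2\right)^2\right)$$ on $(0,\infty)$, with $I_0$ the zero-order modified Bessel function of the first kind. Equivalently, it is the law of a product $ZR$ of independent variables, where $\ln Z$ is Gaussian with mean $-\sigma_z^2/2$ and variance $\sigma_z^2$, and $R$ has density $(1+r)e^{-r-(1+r)x}I_0\big(2\sqrt{r(1+r)x}\big)$ on $(0,\infty)$. *)

(* Defs.v *)
From HB Require Import structures.
From mathcomp Require Export all_boot all_order all_algebra.
From mathcomp Require Export all_classical all_reals all_analysis.
Export Order.TTheory GRing.Theory Num.Theory.
Export numFieldNormedType.Exports.

Set Implicit Arguments.
Unset Strict Implicit.
Unset Printing Implicit Defensive.

Local Open Scope classical_set_scope.
Local Open Scope ring_scope.

Section skewness.
Context {d : measure_display} {T : measurableType d} {R : realType}.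
Implicit Types (P : probability T R) (W : T -> R).

Definition has_skewness P W : Prop :=
  ('E_P[(fun w => `|W w| ^+ 3)%R] < +oo /\ 0 < 'V_P[W])%E.

(* Meaningful only under [has_skewness P W], because of the uses of [fine]. *)
Definition skewness P W : R :=
  fine 'E_P[(fun w => (W w - fine 'E_P[W]) ^+ 3)%R] / fine 'V_P[W] `^ (3 / 2).

End skewness.

(* For [x > 0] only: [x `^ l] and [ln x] are total and take conventional values
   when [x <= 0]. *)
Definition boxcox {R : realType} (l x : R) : R :=
  if l == 0 then ln x else (x `^ l - 1) / l.

(* [X] is almost surely positive, and its law has density [f] on (0, +oo); the
   values of [f] outside (0, +oo) are irrelevant.  Taking [A = setT] shows that
   [f] has integral 1 on (0, +oo). *)
Definition has_density_pos {d : measure_display} {T : measurableType d}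
    {R : realType} (P : probability T R) (X : {RV P >-> R}) (f : R -> R) : Prop :=
  forall A : set R, measurable A ->
    distribution P X A =
    (\int[lebesgue_measure]_(x in (A `&` `]0%R, +oo[)%classic) (f x)%:E)%E.
Arguments has_density_pos {d T R} P X f.

Section special_functions.
Context {R : realType}.
Implicit Types a nu x : R.

(* Euler's integral, for [0 < a]. *)
Definition Gamma a : R :=
  \int[lebesgue_measure]_(t in `]0, +oo[) (t `^ (a - 1) * expR (- t)).

(* I_0(x) = \sum_k (x/2)^(2k) / (k!)^2 *)
Definition bessel_I0 x : R :=
  limn (series (fun k : nat => (x / 2) ^+ (2 * k) / (k`!%:R) ^+ 2)).

(* For [0 < x] and every real order [nu],
   K_nu(x) = 1/2 (x/2)^nu \int_0^oo exp(-t - x^2/(4t)) t^(-nu-1) dt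
   (NIST Digital Library of Mathematical Functions, 10.32.10). *)
Definition bessel_K nu x : R :=
  2^-1 * (x / 2) `^ nu *
  \int[lebesgue_measure]_(t in `]0, +oo[)
    (expR (- t - x ^+ 2 / (4 * t)) * t `^ (- nu - 1)).

End special_functions.

Section distributions.
Context {R : realType}.
Implicit Types a b r x : R.

Definition gamma_gamma_pdf a b x : R :=
  2 * (a * b) `^ ((a + b) / 2) / (Gamma a * Gamma b) *
  x `^ ((a + b) / 2 - 1) * bessel_K (a - b) (2 * Num.sqrt (a * b * x)).

(* The parameter [s2] is the variance of the Gaussian factor in log scale. *)
Definition lognormal_rician_pdf r (s2 : R) x : R :=
  (1 + r) * expR (- r) / (Num.sqrt (2 * pi) * Num.sqrt s2) *
  \int[lebesgue_measure]_(z in `]0, +oo[)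
    ((z ^+ 2)^-1 *
     bessel_I0 (2 * Num.sqrt ((1 + r) * r / z * x)) *
     expR (- ((1 + r) / z * x) - (2 * s2)^-1 * (ln z + s2 / 2) ^+ 2)).

Definition lr_V0 r (s2 : R) : R := s2 + 2 / (1 + r).
Definition lr_rho r (s2 : R) : R := ((1 + r) * lr_V0 r s2)^-1.

End distributions.

Definition is_gamma_gamma {d : measure_display} {T : measurableType d}
    {R : realType} (P : probability T R) (X : {RV P >-> R}) (a b : R) : Prop :=
  has_density_pos P X (gamma_gamma_pdf a b).
Arguments is_gamma_gamma {d T R} P X a b.

Definition is_lognormal_rician {d : measure_display} {T : measurableType d}
    {R : realType} (P : probability T R) (X : {RV P >-> R}) (r s2 : R) : Prop :=
  has_density_pos P X (lognormal_rician_pdf r s2).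
Arguments is_lognormal_rician {d T R} P X r s2.

(* Main.v *)
(* Both laws are laws of a product Y of two independent positive variables of
   mean 1, which is read off the density by Tonelli and a change of scale; hence
   E Y = 1 and the moments of Y are explicit.  With h = Y - 1 and c = l - 1,
   T_l(Y) = h + c h^2 / 2 + O(|h|^3), so that
     Var T_l(Y) = E h^2 + O(e^3),
     E (T_l(Y) - E T_l(Y))^3 = E h^3 + 3/2 c (E h^4 - (E h^2)^2) + O(e^5)
   as soon as E h^(2n) = O(e^(2n)) for all n and some E Y^-q with q > -3 l stays
   bounded.  Inserting the moments gives the leading coefficient of the skewness,
   an affine function of l, whose zero is the announced parameter.
   In the Lognormal-Rician case E Y^-1 is infinite (the Rician factor has a
   positive density at 0), so that T_l(Y) has no skewness when l <= -1/3.
   The Lognormal-Rician log-skewness must be controlled uniformly in the ratio of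
   the two variances: there ln Y is the sum of a Gaussian, whose third central
   moment vanishes, and of the logarithm of the Rician factor, to which the
   expansion with l = 0 applies. *)
From HB Require Import structures.
Require Import Defs.
From mathcomp Require Import measurable_realfun simple_functions measurable_fun_approximation zify ring lra.

Set Implicit Arguments.
Unset Strict Implicit.
Unset Printing Implicit Defensive.

Local Open Scope classical_set_scope.
Local Open Scope ring_scope.

Local Notation leb := lebesgue_measure.
Local Notation meas T f := (measurable_fun [set: T] f).
Local Notation intg P f := (P.-integrable [set: _] (EFin \o f)).

(** * Laws of products *)

Section scaling.
Local Open Scope ereal_scope.
Context {R : realType}.

(** The hypotheses give only a density on an unknown probability space. All computations take place
    in one model, a product law on two real coordinates, and are carried over by equality of laws.
    The density has to be recognised only up to a constant factor, since proportional probability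
    densities define the same law; hence no normalising constant, and not even the Gamma function
    inside it, has to be computed. The obstacle in the expansion is uniformity: no constant may
    depend on the parameters. For the Gamma and Rician factors, generating functions taken at plus
    and minus the inverse standard deviation bound all even moments at once. The lognormal factor
    has no such generating function; it is bounded through powers Z^t with t of order 1/sigma_z,
    whose means stay bounded as sigma_z tends to 0. Growth at infinity and the singularity of T_l at
    0 occur together in the remainder. A Young-type inequality separates them, so that even moments
    and one negative moment suffice. The order of that moment exceeds -3l, and not merely -l,
    because third powers are integrated. *)

Lemma ge0_integral_scale (c : R) (f : R -> \bar R) : (0 < c)%R ->
  meas R f -> (forall x, 0 <= f x) ->
  \int[leb]_x f (c * x)%R = (c^-1)%:E * \int[leb]_x f x.
Proof.
move=> c0 mf f0.
have mc : measurable_fun setT (fun x : R => c * x)%R by exact: measurable_funM.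
have c0' : (0 <= c)%R by exact: ltW.
(* Lebesgue measure is c times its image under x -> c x: the two agree on half-open intervals, which
   determines the measure. *)
have mE (A : set R) : measurable A ->
    leb A = mscale (NngNum c0') (pushforward leb (fun x : measurableTypeR R => c * x : measurableTypeR R)%R) A.
  move=> mA; apply: lebesgue_measure_unique => // _ [[a b]] _ <-.
  rewrite /= /mscale /= /pushforward.
  rewrite (_ : (fun x : R => (c * x)%R) @^-1` `]a, b] = `](c^-1 * a)%R, (c^-1 * b)%R]%classic); last first.
    apply/seteqP; split => x /=; rewrite !in_itv/= ltr_pdivrMl// ler_pdivlMl//.
  rewrite !lebesgue_measure_itv/= !lte_fin ltr_pM2l ?invr_gt0//.
  case: ifPn => _; last by rewrite mule0.
  by rewrite -!EFinB -EFinM -mulrBr mulrA divff ?gt_eqF// mul1r.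
rewrite [in RHS](eq_measure_integral (mscale (NngNum c0') (pushforward leb (fun x : measurableTypeR R => c * x : measurableTypeR R)%R))); last first.
  by move=> A mA _; exact: mE.
rewrite ge0_integral_mscale//= ge0_integral_pushforward//.
by rewrite muleA -EFinM mulVf ?gt_eqF// mul1e.
Qed.

Lemma lebesgue_tonelli (f : R * R -> \bar R) :
  meas (R * R) f -> (forall p, 0 <= f p) ->
  \int[leb]_x (\int[leb]_z f (x, z)) = \int[leb]_z (\int[leb]_x f (x, z)).
Proof.
by move=> mf f0; exact: (@fubini_tonelli _ _ _ _ R (@lebesgue_measure R) (@lebesgue_measure R) f mf f0).
Qed.

Lemma measurable_lebesgue_section (f : R * R -> \bar R) :
  meas (R * R) f -> (forall p, 0 <= f p) ->
  meas R (fun x => \int[leb]_z f (x, z)).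
Proof.
by move=> mf f0; exact: (@measurable_fun_fubini_tonelli_F _ _ _ _ R (@lebesgue_measure R) f mf f0).
Qed.

End scaling.

Section density_probability.
Local Open Scope ereal_scope.
Context {R : realType}.
Variables (f : R -> R) (mf : meas R f)
  (f0 : forall x, (0 <= f x)%R) (f1 : \int[leb]_x (f x)%:E = 1).

(** The proofs about [f] are arguments so that the measure and probability structures can be
    attached to this very term and inferred from it later. *)
Definition density_prob of meas R f &
  (forall x, (0 <= f x)%R) & \int[leb]_x (f x)%:E = 1 :=
  fun A : set R => \int[leb]_(x in A) (f x)%:E.

Local Notation dp := (density_prob mf f0 f1).

Let dp0 : dp set0 = 0. Proof. by rewrite /density_prob integral_set0. Qed.

Let dp_ge0 A : 0 <= dp A.
Proof. by apply: integral_ge0 => x _; rewrite lee_fin. Qed.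

Let fint : intg leb f.
Proof.
apply/integrableP; split; first exact/measurable_EFinP.
by under eq_integral do rewrite /= ger0_norm//; rewrite f1 ltry.
Qed.

Let dp_sigma_additive : semi_sigma_additive dp.
Proof.
move=> /= A mA tA mUA.
rewrite /density_prob/= integral_bigcup//=; last first.
  exact: (integrableS _ _ (subsetT _) fint).
apply: is_cvg_ereal_nneg_natsum_cond => n _ _.
by apply: integral_ge0 => /= x ?; rewrite lee_fin.
Qed.

HB.instance Definition _ := isMeasure.Build _ _ _ dp dp0 dp_ge0 dp_sigma_additive.

HB.instance Definition _ := @Measure_isProbability.Build _ _ R dp f1.

Import HBNNSimple.

(** On indicators this is the definition of the measure; simple functions increasing to [g] and
    monotone convergence on both sides do the rest. *)
Lemma ge0_integral_density (g : R -> \bar R) : meas R g ->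
  (forall x, 0 <= g x) -> \int[dp]_x g x = \int[leb]_x (g x * (f x)%:E).
Proof.
move=> mg g0.
pose h := nnsfun_approx measurableT mg.
have mh n : meas R (h n) by exact: measurable_funPT.
have nh m n x : (m <= n)%N -> (h m x <= h n x)%R.
  by move=> mn; exact/lefP/nd_nnsfun_approx.
have ch x : (h n x)%:E @[n --> \oo] --> g x.
  by apply: cvg_nnsfun_approx => // y _; exact: g0.
transitivity (limn (fun n => \int[dp]_x (h n x)%:E)).
  rewrite -monotone_convergence//.
  - apply: eq_integral => x _; exact/esym/cvg_lim/ch.
  - by move=> n; exact/measurable_EFinP.
  - by move=> n x _; rewrite lee_fin.
  - by move=> x _ m n mn; rewrite lee_fin; exact: nh.
transitivity (limn (fun n => \int[leb]_x ((h n x)%:E * (f x)%:E))); last first.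
  rewrite -monotone_convergence//.
  - apply: eq_integral => x _; apply/cvg_lim => //.
    by apply: cvgeMr => //; exact: ch.
  - move=> n; apply: emeasurable_funM; apply/measurable_EFinP; [exact: mh|exact: mf].
  - by move=> n x _; rewrite mule_ge0// lee_fin.
  - move=> x _ m n mn; apply: lee_pmul => //; rewrite lee_fin //; exact: nh.
congr (limn _); apply/funext => n.
have mI r : meas R (\1_(h n @^-1` [set r]) : R -> R).
  exact: measurable_indic.
have mrI r : meas R (fun x => r * \1_(h n @^-1` [set r]) x : R)%R.
  exact: measurable_funM.
rewrite (eq_integral (fun x => \sum_(k \in range (h n)) (k * \1_(h n @^-1` [set k]) x)%:E)); last first.
  by move=> x _; rewrite fimfunE -fsumEFin.
rewrite ge0_integral_fsum//; last 2 first.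
- by move=> r; exact/measurable_EFinP/measurable_funM.
- by move=> r x _; rewrite nnfun_muleindic_ge0.
transitivity (\int[leb]_x (\sum_(k \in range (h n)) ((k * \1_(h n @^-1` [set k]) x)%:E * (f x)%:E))); last first.
  apply: eq_integral => x _; rewrite (fimfunE (h n) x) -fsumEFin// ge0_mule_fsuml// => r.
  exact: nnfun_muleindic_ge0.
rewrite ge0_integral_fsum//; last 2 first.
- move=> r; apply: emeasurable_funM; apply/measurable_EFinP; [exact: mrI|exact: mf].
- by move=> r x _; rewrite mule_ge0 ?nnfun_muleindic_ge0// lee_fin.
apply: eq_fsbigr => r _.
rewrite integralZl_indic_nnsfun// integral_indic// setIT.
under [RHS]eq_integral do rewrite EFinM -muleA.
have [r0|r0] := ltP r 0%R.
  rewrite preimage_nnfun0// measure0 mule0 integral0_eq// => x _.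
  by rewrite indicE in_set0 mul0e mule0.
rewrite ge0_integralZl_EFin//; last 2 first.
- by move=> x _; rewrite mule_ge0// lee_fin.
- by apply: emeasurable_funM; apply/measurable_EFinP; [exact: mI|exact: mf].
congr (_ * _); rewrite /= /density_prob [LHS]integral_mkcond.
apply: eq_integral => x _; rewrite restrict_EFin/= patchE indicE.
by case: ifP => //= _; rewrite ?mul1e ?mul0e.
Qed.

End density_probability.

Section product_law.
Context {R : realType}.

(** Inversion is discontinuous at 0, so it is written through exp(-ln) on each half line; the
    remaining point uses 0^-1 = 0. *)
Lemma measurable_invr : meas R (fun x : R => x^-1).
Proof.
have -> : (fun x : R => x^-1) = (fun x : R =>
    if (0 < x) then expR (- ln x) else if (x < 0) then - expR (- ln (- x)) else 0).
  apply/funext => x; case: ltgtP => x0.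
  - by rewrite -lnV// lnK// posrE invr_gt0.
  - by rewrite -lnV ?posrE ?oppr_gt0// lnK ?posrE ?invr_gt0 ?oppr_gt0// invrN opprK.
  - by rewrite -x0 invr0.
apply: measurable_fun_ifT => //.
- exact: measurable_fun_ltr.
- by apply: (measurableT_comp (@measurable_expR R)); apply: measurableT_comp => //; exact: measurable_ln.
- apply: measurable_fun_ifT => //; first exact: measurable_fun_ltr.
  apply: measurableT_comp => //; apply: (measurableT_comp (@measurable_expR R)); apply: measurableT_comp => //.
  by apply: measurableT_comp => //; exact: measurable_ln.
Qed.

(** Makes a variable positive everywhere instead of almost everywhere. The densities used vanish on
    (-oo, 0], so the default 1 does not change any law. *)
Definition posn (x : R) : R := if 0 < x then x else 1.

Lemma posn_gt0 x : 0 < posn x. Proof. by rewrite /posn; case: ifP. Qed.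

Lemma posnE x : 0 < x -> posn x = x. Proof. by rewrite /posn => ->. Qed.

Lemma measurable_posn : meas R posn.
Proof. by apply: measurable_fun_ifT => //; exact: measurable_fun_ltr. Qed.

Definition prod_posn (p : R * R) : R := posn p.1 * posn p.2.

Lemma measurable_prod_posn : meas (R * R) prod_posn.
Proof.
by apply: measurable_funM; apply: (measurableT_comp measurable_posn).
Qed.

HB.instance Definition _ := isMeasurableFun.Build _ _ _ _ posn measurable_posn.
HB.instance Definition _ := isMeasurableFun.Build _ _ _ _ prod_posn measurable_prod_posn.

Context (k g : R -> R).
Hypotheses (mk : meas R k) (k0 : forall x, 0 <= k x)
  (k1 : (\int[leb]_x (k x)%:E = 1)%E) (kN : forall x, x <= 0 -> k x = 0).
Hypotheses (mg : meas R g) (g0 : forall x, 0 <= g x)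
  (g1 : (\int[leb]_x (g x)%:E = 1)%E) (gN : forall x, x <= 0 -> g x = 0).

Let muk : probability _ R := density_prob mk k0 k1.
Let mug : probability _ R := density_prob mg g0 g1.

(** Integrand of the multiplicative convolution at p = (x, z): integrated over z, it is the density
    at x of a product of independent variables with densities [k] and [g]. *)
Let H (p : R * R) : \bar R := (k p.2 * g (p.1 / p.2) / p.2)%:E.

Let H0 p : (0 <= H p)%E.
Proof.
rewrite lee_fin /=; have [p20|p20] := leP p.2 0; first by rewrite kN// !mul0r.
by rewrite mulr_ge0 ?invr_ge0 ?(ltW p20)// mulr_ge0.
Qed.

Let mH : meas (R * R) H.
Proof.
have m2 : meas (R * R) (fun p => p.2^-1 : R).
  exact: (measurableT_comp measurable_invr).
apply/measurable_EFinP; apply: measurable_funM => //.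
apply: measurable_funM; first exact: (measurableT_comp mk).
by apply: (measurableT_comp mg); exact: measurable_funM.
Qed.

(** Tonelli moves the integral over x inside, where x = z y turns g(x/z)/z dx into g(y) dy. *)
Let measH (A : set R) : measurable A ->
  (\int[leb]_x (\int[leb]_z ((\1_A x)%:E * H (x, z))) =
  (muk \x mug) (prod_posn @^-1` A))%E.
Proof.
move=> mA.
transitivity (\int[leb]_z (\int[leb]_x ((\1_A x)%:E * H (x, z))))%E.
  apply: (@lebesgue_tonelli _ (fun p : R * R => (\1_A p.1)%:E * H p)%E).
  - apply: emeasurable_funM => //; apply/measurable_EFinP.
    by apply: (measurableT_comp (measurable_indic mA)).
  - by move=> p; rewrite mule_ge0// lee_fin.
transitivity (\int[muk \x mug]_p (\1_(prod_posn @^-1` A) p)%:E)%E; last first.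
  rewrite integral_indic ?setIT//.
  by rewrite -[X in measurable X]setTI; exact: measurable_prod_posn.
rewrite fubini_tonelli1//=; last first.
  apply/measurable_EFinP; apply: measurable_indic.
  by rewrite -[X in measurable X]setTI; exact: measurable_prod_posn.
rewrite ge0_integral_density; last 2 first.
- apply: (measurable_fun_fubini_tonelli_F (fun p => (\1_(prod_posn @^-1` A) p)%:E)).
  + apply/measurable_EFinP; apply: measurable_indic.
    by rewrite -[X in measurable X]setTI; exact: measurable_prod_posn.
  + by move=> p; rewrite lee_fin.
- by move=> x; apply: integral_ge0 => y _; rewrite lee_fin.
apply: eq_integral => z _.
have [z0|z0] := leP z 0.
  rewrite kN// mule0 integral0_eq// => x _.
  by rewrite /H /= kN// !mul0r mule0.
have mAz : meas R (fun x : R => (\1_A (z * x))%:E : \bar R).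
  by apply/measurable_EFinP; apply: (measurableT_comp (measurable_indic mA)); exact: measurable_funM.
transitivity ((z^-1 * k z)%:E * \int[leb]_x ((\1_A x)%:E * (g (x / z))%:E))%E.
  rewrite -ge0_integralZl_EFin//.
  - apply: eq_integral => x _; rewrite /H/= -!EFinM; congr (_%:E); ring.
  - by move=> x _; rewrite mule_ge0// lee_fin.
  - apply: emeasurable_funM; apply/measurable_EFinP => //.
    by apply: (measurableT_comp mg); exact: measurable_funM.
  - by rewrite mulr_ge0 ?invr_ge0 ?(ltW z0).
rewrite mulrC EFinM -muleA.
rewrite -(@ge0_integral_scale _ z (fun x => ((\1_A x)%:E * (g (x / z))%:E)%E))//; last 2 first.
- apply: emeasurable_funM; apply/measurable_EFinP => //.
  by apply: (measurableT_comp mg); exact: measurable_funM.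
- by move=> x; rewrite mule_ge0// lee_fin.
rewrite muleC; congr (_ * _)%E.
transitivity (\int[mug]_y (\1_A (z * posn y))%:E)%E; last first.
  apply: eq_integral => y _; congr (_%:E).
  by rewrite !indicE; congr (nat_of_bool _)%:R; apply/idP/idP;
    rewrite !inE /= /prod_posn/= (posnE z0).
rewrite ge0_integral_density; last 2 first.
- by apply/measurable_EFinP; apply: (measurableT_comp (measurable_indic mA)); apply: measurable_funM => //; exact: measurable_posn.
- by move=> y; rewrite lee_fin.
apply: eq_integral => y _.
rewrite [z * y]mulrC mulfK ?gt_eqF//.
have [y0|y0] := leP y 0; first by rewrite gN// !mule0.
by rewrite posnE// mulrC.
Qed.

(** The law of [X] is [C] times the law of the product, and total mass 1 on both sides forces C = 1.
    A density therefore has to match the convolution only up to a constant factor. *)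
Lemma law_product d (T : measurableType d) (P : probability T R)
    (X : {RV P >-> R}) (C : R) (f : R -> R) :
  0 <= C ->
  (forall x, 0 < x -> f x = C * fine (\int[leb]_z (k z * g (x / z) / z)%:E)%E) ->
  has_density_pos P X f ->
  forall A, measurable A -> P (X @^-1` A) = (muk \x mug)%E (prod_posn @^-1` A).
Proof.
move=> C0 fE dX.
pose J x := (\int[leb]_z H (x, z))%E.
have J0 x : (0 <= J x)%E by exact: integral_ge0.
have mJ : meas R J.
  exact: measurable_lebesgue_section.
have intJ : (\int[leb]_x J x = 1)%E.
  have := measH measurableT.
  rewrite preimage_setT [X in _ = X -> _](@probability_setT _ _ _ (muk \x mug)%E) => <-.
  by apply: eq_integral => x _; apply: eq_integral => z _; rewrite indicT/= mul1e.
have JN x : x <= 0 -> J x = 0%E.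
  move=> x0; apply: integral0_eq => z _; rewrite /H/=.
  have [z0|z0] := leP z 0; first by rewrite kN// !mul0r.
  by rewrite gN ?mulr0 ?mul0r// pmulr_lle0// invr_gt0.
(* [fine] would send an infinite value to 0, but the convolution has integral 1 and so is finite
   almost everywhere. *)
have Jfin : {ae leb, forall x, [set: R] x -> J x \is a fin_num}.
  apply: integrable_ae => //; apply/integrableP; split => //.
  by under eq_integral do rewrite gee0_abs//; rewrite intJ ltry.
have mfJ : meas R (fine \o J).
  exact: (measurableT_comp (fine_measurable measurableT) mJ).
have PA A : measurable A -> P (X @^-1` A) = (C%:E * (muk \x mug) (prod_posn @^-1` A))%E.
  move=> mA; rewrite -[LHS]/(distribution P X A) dX// -measH//.
  rewrite -ge0_integralZl_EFin//; last 2 first.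
  - by move=> x _; apply: integral_ge0 => z _; rewrite mule_ge0// lee_fin.
  - apply: (@measurable_lebesgue_section _ (fun p : R * R => (\1_A p.1)%:E * H p)%E).
    + apply: emeasurable_funM => //; apply/measurable_EFinP.
      by apply: (measurableT_comp (measurable_indic mA)).
    + by move=> p; rewrite mule_ge0// lee_fin.
  rewrite [LHS]integral_mkcond/=.
  have mCJ : meas R (fun x : R => C * (\1_A x * fine (J x))).
    by apply: measurable_funM => //; apply: measurable_funM.
  transitivity (\int[leb]_x (C * (\1_A x * fine (J x)))%:E)%E.
    congr (integral _ _ _); apply/funext => x; rewrite patchE in_setI.
    have [x0|x0] := leP x 0.
      by rewrite (JN _ x0)/= !mulr0 [X in _ && X]memNset ?andbF//= in_itv/= andbT ltNge x0.
    have xp : x \in `]0, +oo[%classic by rewrite inE/= in_itv/= x0.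
    rewrite xp andbT indicE.
    by case: ifP => _; rewrite ?mul1r ?mul0r ?mulr0// fE.
  apply: ge0_ae_eq_integral => //.
  - exact/measurable_EFinP.
  - apply: measurable_funeM.
    apply: (@measurable_lebesgue_section _ (fun p : R * R => (\1_A p.1)%:E * H p)%E).
    + apply: emeasurable_funM => //; apply/measurable_EFinP.
      by apply: (measurableT_comp (measurable_indic mA)).
    + by move=> p; rewrite mule_ge0// lee_fin.
  - by move=> x _; rewrite lee_fin !mulr_ge0// fine_ge0.
  - by move=> x _; rewrite mule_ge0 ?lee_fin//; apply: integral_ge0 => z _; rewrite mule_ge0// lee_fin.
  - apply: (@filterS _ (almost_everywhere leb) _ _ _ _ Jfin) => x /(_ I) Jx _.
    rewrite ge0_integralZl_EFin//; last by apply: (measurableT_comp mH).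
    by rewrite !EFinM fineK.
have C1 : C = 1.
  have := PA _ measurableT; rewrite !preimage_setT probability_setT.
  by rewrite [X in (_ * X)%E](@probability_setT _ _ _ (muk \x mug)%E) mule1 => -[].
by move=> A mA; rewrite PA// C1 mul1e.
Qed.

End product_law.

(** * Skewness as an integral *)

Section transport.
Context {R : realType} d (T : measurableType d) (P : probability T R)
  d' (T' : measurableType d') (Q : probability T' R).
Variables (X : {RV P >-> R}) (Y : {RV Q >-> R}).
Hypothesis XY : forall A : set R, measurable A -> P (X @^-1` A) = Q (Y @^-1` A).

(** Positive and negative parts are transported separately, so no integrability is required. This is
    what makes the transport of [has_skewness] an equivalence. *)
Lemma expectation_law (g : R -> R) : meas R g ->
  ('E_P[fun w => g (X w)] = 'E_Q[fun w => g (Y w)])%E.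
Proof.
move=> mg; rewrite !unlock.
have ge0 (h : R -> \bar R) : meas R h -> (forall y, (0 <= h y)%E) ->
    (\int[P]_w h (X w) = \int[Q]_w h (Y w))%E.
  move=> mh h0.
  rewrite -(@ge0_integral_distribution _ _ _ _ _ P X h)// -(@ge0_integral_distribution _ _ _ _ _ Q Y h)//.
  by apply: eq_measure_integral => A mA _; exact: XY.
have mEg : meas R (EFin \o g) by exact/measurable_EFinP.
rewrite integralE [RHS]integralE; congr (_ - _)%E.
  have := ge0 (EFin \o g)^\+%E (measurable_funepos mEg) (fun=> funepos_ge0 _ _).
  by rewrite !funepos.unlock.
have := ge0 (EFin \o g)^\-%E (measurable_funeneg mEg) (fun=> funeneg_ge0 _ _).
by rewrite !funeneg.unlock.
Qed.

Variables (g : R -> R) (mg : meas R g).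

Let VE : ('V_P[fun w => g (X w)] = 'V_Q[fun w => g (Y w)])%E.
Proof.
rewrite /variance covariance.unlock /=.
rewrite expectation_law//.
apply: (@expectation_law (fun x => (g x - fine 'E_Q[fun w => g (Y w)]) *
  (g x - fine 'E_Q[fun w => g (Y w)]))).
by apply: measurable_funM; apply: measurable_funB.
Qed.

Lemma has_skewness_law : has_skewness P (fun w => g (X w)) <->
  has_skewness Q (fun w => g (Y w)).
Proof.
rewrite /has_skewness VE (@expectation_law (fun x => `|g x| ^+ 3))//.
by apply: measurable_funX; exact: measurableT_comp.
Qed.

Lemma skewness_law : skewness P (fun w => g (X w)) =
  skewness Q (fun w => g (Y w)).
Proof.
rewrite /skewness VE (@expectation_law g)//.
rewrite (@expectation_law (fun x => (g x - fine 'E_Q[fun w => g (Y w)]) ^+ 3))//.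
by apply: measurable_funX; apply: measurable_funB.
Qed.

End transport.

Section real_expectation.
Context {R : realType} d (T : measurableType d) (P : probability T R).
Implicit Types f g h : T -> R.

Lemma integrable_dominated f g : meas T f -> intg P g ->
  (forall w, `|f w| <= g w) -> intg P f.
Proof.
move=> mf ig fg; apply: (le_integrable measurableT _ _ ig).
  exact/measurable_EFinP.
by move=> w _ /=; rewrite lee_fin (le_trans (fg w))// ler_norm.
Qed.

Lemma integrable_ge0_bound f (B : R) : meas T f ->
  (forall w, 0 <= f w) -> (\int[P]_w (f w)%:E <= B%:E)%E -> intg P f.
Proof.
move=> mf f0 fB; apply/integrableP; split; first exact/measurable_EFinP.
under eq_integral do rewrite /= ger0_norm//.
by rewrite (le_lt_trans fB)// ltry.
Qed.

Lemma Rintegral_le_bound f (B : R) : intg P f ->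
  (\int[P]_w (f w)%:E <= B%:E)%E -> \int[P]_w f w <= B.
Proof.
by move=> fi fB; rewrite -lee_fin /Rintegral fineK//; exact: integrable_fin_num.
Qed.

Lemma EFin_Rintegral f : intg P f -> (\int[P]_w (f w)%:E)%E = (\int[P]_w f w)%:E.
Proof. by move=> fi; rewrite /Rintegral fineK//; exact: integrable_fin_num. Qed.

Lemma Rintegral_cst1 (r : R) : \int[P]_w r = r.
Proof. by rewrite Rintegral_cst// [X in fine X]probability_setT mulr1. Qed.

Lemma int_cst (r : R) : intg P (fun=> r).
Proof. exact: finite_measure_integrable_cst. Qed.

Lemma intD f g : intg P f -> intg P g -> intg P (fun w => f w + g w).
Proof. by move=> fi gi; exact: (integrableD measurableT fi gi). Qed.

Lemma intZ (r : R) f : intg P f -> intg P (fun w => r * f w).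
Proof. by move=> fi; exact: (integrableZl measurableT r fi). Qed.

Lemma intB f g : intg P f -> intg P g -> intg P (fun w => f w - g w).
Proof. by move=> fi gi; exact: (integrableB measurableT fi gi). Qed.

Lemma int_measurable f : intg P f -> meas T f.
Proof. by move/integrableP => [/measurable_EFinP]. Qed.

(** The form in which the errors of the delta method are estimated: a pointwise bound by a multiple
    of an envelope [h] of mean at most [B]. *)
Lemma dist_Rintegral f g h (K B : R) : intg P f -> intg P g -> intg P h -> 0 <= K ->
  (forall w, `|f w - g w| <= K * h w) -> \int[P]_w h w <= B ->
  `|\int[P]_w f w - \int[P]_w g w| <= K * B.
Proof.
move=> fi gi hi K0 fgh hB.
rewrite -RintegralB//; apply: (le_trans (le_normr_Rintegral _ _)) => //.
  exact: intB.
apply: (@le_trans _ _ (\int[P]_w (K * h w))); last first.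
  by rewrite RintegralZl// ler_wpM2l.
apply: le_Rintegral => //; last exact: intZ.
exact: (integrable_norm (intB fi gi)).
Qed.

Lemma skewnessE (W : T -> R) : skewness P W = \int[P]_w (W w - \int[P]_w W w) ^+ 3 /
    (\int[P]_w (W w - \int[P]_w W w) ^+ 2) `^ (3 / 2).
Proof.
rewrite /skewness /variance expectation.unlock covariance.unlock expectation.unlock.
by congr (_ / powR _ _).
Qed.

Lemma has_skewness_int (W : T -> R) : meas T W ->
  intg P (fun w => `|W w| ^+ 3) -> 0 < \int[P]_w (W w - \int[P]_w W w) ^+ 2 ->
  has_skewness P W.
Proof.
move=> mW iW V0; split.
  rewrite expectation.unlock; have /integrable_fin_num := iW.
  by rewrite fin_numE => /(_ measurableT)/andP[_]; rewrite ltey.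
rewrite /variance covariance.unlock expectation.unlock; move: V0; rewrite /Rintegral.
under eq_integral do rewrite expr2.
by case: (integral _ _ _) => [r||] /=; rewrite ?lte_fin ?ltxx ?ltry.
Qed.

End real_expectation.

(** * The delta method for the Box-Cox transformation *)

Section boxcox_taylor.
Context {R : realType}.
Implicit Types x l p : R.

(** One step of a Taylor estimate at 1: each use trades a derivative for a factor |x - 1|. The
    condition x >= 1/2 keeps the segment to 1 away from the singularity at 0, and monotonicity of
    [phi] replaces the intermediate point by x. *)
Lemma mvt_bound_at1 (D dD phi : R -> R) x : 2^-1 <= x -> D 1 = 0 ->
  (forall t : R, 0 < t -> is_derive t 1 D (dD t)) ->
  (forall t : R, 2^-1 <= t -> `|dD t| <= phi `|t - 1|) ->
  (forall s t : R, 0 <= s -> s <= t -> phi s <= phi t) ->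
  `|D x| <= `|x - 1| * phi `|x - 1|.
Proof.
move=> x2 D1 dDD dDphi phimono.
have cD t : 0 < t -> {for t, continuous D}.
  by move=> t0; apply: differentiable_continuous; apply/derivable1_diffP; have [] := dDD _ t0.
have cDab a b : 0 < a -> {within `[a, b], continuous D}.
  move=> a0; apply: continuous_in_subspaceT => t /set_mem /=; rewrite in_itv/= => /andP[at' _].
  by apply: cD; exact: lt_le_trans at'.
have x0 : 0 < x by apply: lt_le_trans x2; rewrite invr_gt0.
have [x1|x1|->] := ltgtP x 1; last by rewrite D1 normr0 subrr normr0 mul0r.
- have dab t : t \in `]x, 1[ -> is_derive t 1 D (dD t).
    by rewrite in_itv/= => /andP[xt _]; apply: dDD; exact: lt_trans xt.
  have [c] := MVT x1 dab (cDab _ _ x0).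
  rewrite in_itv/= => /andP[xc c1]; rewrite D1 sub0r => /(congr1 Num.norm).
  rewrite normrN normrM => ->; rewrite mulrC distrC ler_wpM2l//.
  apply: (le_trans (dDphi _ (le_trans x2 (ltW xc)))).
  by apply: phimono => //; rewrite (ltr0_norm (x := c - 1)) ?subr_lt0// (ltr0_norm (x := x - 1)) ?subr_lt0//; lra.
- have dab t : t \in `]1, x[ -> is_derive t 1 D (dD t).
    by rewrite in_itv/= => /andP[xt _]; apply: dDD; exact: lt_trans xt.
  have [c] := MVT x1 dab (cDab _ _ ltr01).
  rewrite in_itv/= => /andP[xc c1]; rewrite D1 subr0 => ->.
  rewrite normrM mulrC ler_wpM2l//.
  apply: (le_trans (dDphi _ _)); first by rewrite (le_trans _ (ltW xc))// invf_le1// ler1n.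
  by apply: phimono => //; rewrite (gtr0_norm (x := c - 1)) ?subr_gt0// (gtr0_norm (x := x - 1)) ?subr_gt0//; lra.
Qed.

Lemma boxcox1 l : boxcox l 1 = 0.
Proof. by rewrite /boxcox; case: ifP => _; rewrite ?ln1// powR1 subrr mul0r. Qed.

(** One formula for all l: on the level of derivatives the logarithm is a regular member of the
    family, and the Taylor estimate on the right needs no case distinction. *)
Lemma is_derive_boxcox l x : 0 < x -> is_derive x 1 (boxcox l) (x `^ (l - 1)).
Proof.
move=> x0; have [->|l0] := eqVneq l 0.
  have -> : boxcox 0 = @ln R by apply/funext => y; rewrite /boxcox eqxx.
  by rewrite sub0r powR_inv1 ?ltW//; exact: is_derive1_ln.
have -> : boxcox l = (fun y => l^-1 * (y `^ l - 1)).
  by apply/funext => y; rewrite /boxcox (negbTE l0) mulrC.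
have dl := is_derive1_powR l x0.
apply: is_derive_eq.
by rewrite subr0 /GRing.scale /= mulrA mulVf// mul1r.
Qed.

(** A nonnegative exponent is rounded up to an integer; a negative one gives a function that is
    largest at 1/2. *)
Lemma powR_bounded_half (e : R) : exists K : R, exists m : nat, 0 <= K /\
  forall x, 2^-1 <= x -> x `^ e <= K * (1 + `|x - 1|) ^+ m.
Proof.
exists (1 + 2^-1 `^ e), (Num.truncn `|e|).+1; split; first by rewrite addr_ge0 ?powR_ge0.
move=> x x2; have x0 : 0 < x by apply: lt_le_trans x2; rewrite invr_gt0.
have b1 : 1 <= 1 + `|x - 1| by rewrite lerDl.
have B1 : 1 <= (1 + `|x - 1|) ^+ (Num.truncn `|e|).+1 by rewrite exprn_ege1.
have [e0|e0] := leP 0 e.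
  apply: (@le_trans _ _ ((1 + `|x - 1|) ^+ (Num.truncn `|e|).+1)); last first.
    by rewrite ler_peMl ?lerDl ?powR_ge0// (le_trans ler01).
  rewrite -powR_mulrn ?(le_trans ler01 b1)//.
  apply: (@le_trans _ _ ((1 + `|x - 1|) `^ e)).
    apply: ge0_ler_powR => //; rewrite ?nnegrE; [exact: ltW|exact: le_trans b1|].
    by rewrite -lerBlDl ler_norm.
  by apply: ler_powR => //; apply: (le_trans (ler_norm _)); apply: ltW; exact: truncnS_gt.
apply: (@le_trans _ _ (2^-1 `^ e)).
  have [f f0 ->] : exists2 f, 0 <= f & e = - f by exists (- e); rewrite ?opprK// oppr_ge0 ltW.
  rewrite !powRN lef_pV2 ?posrE ?powR_gt0 ?invr_gt0//.
  by apply: ge0_ler_powR => //; rewrite ?nnegrE ?invr_ge0//; exact: ltW.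
by rewrite -[leLHS]mulr1 ler_pM ?powR_ge0// lerDr.
Qed.

(** With c = l - 1 the third derivative is c (c - 1) x^(c - 2), of polynomial growth;
    [mvt_bound_at1] is applied three times on the way back to the function. *)
Lemma boxcox_taylor_right l : exists (K : R) (m : nat), 0 <= K /\
  forall x, 2^-1 <= x ->
  `|boxcox l x - (x - 1) - (l - 1) / 2 * (x - 1) ^+ 2| <=
    K * (`|x - 1| ^+ 3 * (1 + `|x - 1|) ^+ m).
Proof.
have [K [m [K0 Km]]] := powR_bounded_half (l - 1 - 1 - 1).
pose c := l - 1; exists (`|c * (c - 1)| * K), m; split; first by rewrite mulr_ge0.
(* For j < 3, [phi j] bounds the derivative of order 3 - j of the remainder. *)
pose phi j s : R := s ^+ j * (`|c * (c - 1)| * (K * (1 + s) ^+ m)).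
have phimono j s t : 0 <= s -> s <= t -> phi j s <= phi j t.
  move=> s0 st; rewrite /phi ler_pM// ?mulr_ge0 ?exprn_ge0 ?addr_ge0//.
    by rewrite lerXn2r// nnegrE (le_trans s0).
  by rewrite !ler_wpM2l// lerXn2r ?nnegrE ?addr_ge0 ?lerD2l// (le_trans s0).
move=> x x2; have x0 (t : R) : 2^-1 <= t -> 0 < t by apply: lt_le_trans; rewrite invr_gt0.
have d3 t : 2^-1 <= t -> `|c * ((c - 1) * t `^ (c - 1 - 1))| <= phi 0%N `|t - 1|.
  move=> t2; rewrite /phi expr0 mul1r mulrA normrM ler_wpM2l//.
  by rewrite ger0_norm ?powR_ge0// Km.
have d2 t : 2^-1 <= t -> `|c * t `^ (c - 1) - c| <= phi 1%N `|t - 1|.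
  move=> t2; have := @mvt_bound_at1 (fun y => c * y `^ (c - 1) - c) _ (phi 0%N) t t2 _ _ d3 (phimono 0%N).
  rewrite /phi expr0 mul1r expr1; apply; first by rewrite powR1 mulr1 subrr.
  move=> s s0; have ds := is_derive1_powR (c - 1) s0.
  by apply: is_derive_eq; rewrite subr0.
have d1 t : 2^-1 <= t -> `|t `^ c - 1 - c * (t - 1)| <= phi 2%N `|t - 1|.
  move=> t2; have := @mvt_bound_at1 (fun y => y `^ c - 1 - c * (y - 1)) _ (phi 1%N) t t2 _ _ d2 (phimono 1%N).
  rewrite /phi expr1 mulrA -expr2; apply; first by rewrite powR1 !subrr mulr0 subr0.
  move=> s s0; have ds := is_derive1_powR c s0.
  by apply: is_derive_eq; rewrite !subr0 /GRing.scale/= mulr1.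
have := @mvt_bound_at1 (fun y => boxcox l y - (y - 1) - c / 2 * (y - 1) ^+ 2) _ (phi 2%N) x x2 _ _ d1 (phimono 2%N).
rewrite /phi.
rewrite (_ : `|x - 1| * _ = `|c * (c - 1)| * K * (`|x - 1| ^+ 3 * (1 + `|x - 1|) ^+ m)); last by ring.
apply; first by rewrite boxcox1 !subrr expr0n/= mulr0 subr0.
move=> s s0; have ds := is_derive_boxcox l s0.
apply: is_derive_eq.
by rewrite !subr0 /GRing.scale/= -/c; field.
Qed.

(** Near 0 the transformation grows like x^l for l < 0, stays bounded for l > 0, and is logarithmic
    for l = 0, where p > 0 is what dominates the logarithm. *)
Lemma boxcox_left l p : 0 < p -> - l <= p -> exists2 K : R, 0 <= K &
  forall x, 0 < x <= 1 -> `|boxcox l x| <= K * x `^ (- p).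
Proof.
move=> p0 lp.
have y1 x : 0 < x <= 1 -> 1 <= x `^ (- p).
  by move=> x01; rewrite -(powRr0 x); apply: ger_powR => //; rewrite oppr_le0 ltW.
have [l0|l0|->] := ltgtP l 0.
- exists (- l)^-1; first by rewrite invr_ge0 oppr_ge0 ltW.
  move=> x x01; have xl : 1 <= x `^ l by rewrite -(powRr0 x); apply: ger_powR => //; exact: ltW.
  rewrite /boxcox lt_eqF// normrM normfV (ltr0_norm l0) mulrC ler_wpM2l//.
    by rewrite invr_ge0 oppr_ge0 ltW.
  rewrite ger0_norm ?subr_ge0//.
  have xlp : x `^ l <= x `^ (- p) by apply: ger_powR => //; rewrite lerNl.
  lra.
- exists l^-1; first by rewrite invr_ge0 ltW.
  move=> x x01; have xl : x `^ l <= 1 by rewrite -(powRr0 x); apply: ger_powR => //; exact: ltW.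
  rewrite /boxcox gt_eqF// normrM normfV (gtr0_norm l0) mulrC ler_wpM2l//.
    by rewrite invr_ge0 ltW.
  rewrite ler0_norm ?subr_le0//.
  have := y1 _ x01; have := powR_ge0 x l; lra.
- exists p^-1; first by rewrite invr_ge0 ltW.
  move=> x x01; have /andP[x0 x1] := x01.
  rewrite /boxcox eqxx ler0_norm ?ln_le0// ler_pdivlMl//.
  have := ln_powR x (- p); rewrite mulNr mulrN => <-.
  by apply/ltW/ln_sublinear/powR_gt0.
Qed.

Lemma boxcox_taylor l p : 0 < p -> - l <= p -> exists (K : R) (m : nat), 0 <= K /\
  forall x, 0 < x ->
  `|boxcox l x - (x - 1) - (l - 1) / 2 * (x - 1) ^+ 2| <=
    K * (`|x - 1| ^+ 3 * (1 + `|x - 1|) ^+ m * (1 + x `^ (- p))).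
Proof.
move=> p0 lp.
have [K1 [m [K10 H1]]] := boxcox_taylor_right l.
have [K2 K20 H2] := boxcox_left p0 lp.
pose L := K2 + 1 + `|(l - 1) / 2|.
have L0 : 0 <= L by rewrite !addr_ge0.
exists (K1 + 8 * L), m; split; first by rewrite addr_ge0// mulr_ge0.
move=> x x0; have [x2|x2] := leP 2^-1 x.
  apply: (le_trans (H1 _ x2)).
  apply: ler_pM => //; first by rewrite lerDl mulr_ge0.
  by rewrite ler_peMr ?mulr_ge0 ?exprn_ge0 ?addr_ge0// lerDl powR_ge0.
have x01 : 0 < x <= 1 by rewrite x0/= (le_trans (ltW x2))// invf_le1// ler1n.
have h1 : `|x - 1| <= 1 by rewrite ler_norml; move: x01 => /andP[]; lra.
have h2 : 2^-1 <= `|x - 1|.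
  by rewrite distrC; apply: le_trans (ler_norm _); lra.
have y1 : 1 <= x `^ (- p).
  by rewrite -(powRr0 x); apply: ger_powR => //; rewrite oppr_le0 ltW.
apply: (@le_trans _ _ (L * x `^ (- p))).
  apply: (le_trans (ler_normB _ _)); apply: (le_trans (lerD (ler_normB _ _) (lexx _))).
  rewrite (_ : L * _ = K2 * x `^ (- p) + x `^ (- p) + `|(l - 1) / 2| * x `^ (- p)); last by rewrite /L; ring.
  apply: lerD; last first.
    rewrite normrM; apply: ler_pM => //; rewrite normrX.
    by apply: le_trans y1; rewrite exprn_ile1.
  by apply: lerD; [exact: H2|exact: le_trans y1].
have a8 : 1 <= 8 * `|x - 1| ^+ 3.
  by have := @lerXn2r _ 3 2^-1 `|x - 1|; rewrite !nnegrE => /(_ _ _ h2); lra.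
have b1 : 1 <= (1 + `|x - 1|) ^+ m by rewrite exprn_ege1// lerDl.
have -> : (K1 + 8 * L) * (`|x - 1| ^+ 3 * (1 + `|x - 1|) ^+ m * (1 + x `^ (- p))) =
  K1 * (`|x - 1| ^+ 3 * (1 + `|x - 1|) ^+ m * (1 + x `^ (- p))) +
  L * (1 + x `^ (- p)) * ((8 * `|x - 1| ^+ 3) * (1 + `|x - 1|) ^+ m) by ring.
apply: ler_wpDl; first by rewrite !mulr_ge0 ?exprn_ge0 ?addr_ge0 ?powR_ge0.
rewrite -[leLHS]mulr1 ler_pM// ?mulr_ge0 ?powR_ge0//.
  by rewrite ler_wpM2l// lerDr.
by rewrite -[leLHS]mulr1 ler_pM.
Qed.

End boxcox_taylor.

Ltac nonneg := repeat first
  [done | exact: powR_ge0 | apply: addr_ge0 | apply: mulr_ge0 | apply: exprn_ge0 | rewrite invr_ge0].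

(** * Pointwise envelopes for the remainder *)

Section envelope.
Context {R : realType}.

(** Separates a mixed product into pure powers. Either S^M <= x^-(q - 3p), and the product is at
    most x^-q; or x^-(3p) is at most (S^M)^(3p/(q - 3p)), and the product is at most S to the power
    M q/(q - 3p). *)
Lemma powR_young (S x p q : R) (M N : nat) : 1 <= S -> 0 < x -> 0 < p ->
  3 * p < q -> M%:R * q / (q - 3 * p) <= N%:R ->
  S ^+ M * x `^ (- (3 * p)) <= x `^ (- q) + S ^+ N.
Proof.
move=> S1 x0 p0 pq MN.
have S0 : 0 < S by exact: lt_le_trans S1.
have d0 : 0 < q - 3 * p by rewrite subr_gt0.
have xp : x `^ (- (3 * p)) = (x `^ (- (q - 3 * p))) `^ (3 * p / (q - 3 * p)).
  by rewrite -powRrM mulNr mulrCA divff ?gt_eqF// mulr1.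
have e0 : 0 <= 3 * p / (q - 3 * p) by rewrite divr_ge0 ?mulr_ge0 ?ltW.
have [SM|SM] := leP (S ^+ M) (x `^ (- (q - 3 * p))).
  apply: (@le_trans _ _ (x `^ (- q))); last by rewrite lerDl exprn_ge0// ltW.
  apply: (@le_trans _ _ (x `^ (- (q - 3 * p)) * x `^ (- (3 * p)))).
    by rewrite ler_wpM2r ?powR_ge0.
  rewrite -powRD ?(gt_eqF x0) ?implybT// (_ : - (q - 3 * p) + - (3 * p) = - q)//; ring.
apply: (@le_trans _ _ (S ^+ N)); last by rewrite lerDr powR_ge0.
apply: (@le_trans _ _ (S ^+ M * (S ^+ M) `^ (3 * p / (q - 3 * p)))).
  rewrite ler_wpM2l ?exprn_ge0 ?(ltW S0)// xp.
  by apply: ge0_ler_powR => //; rewrite ?nnegrE ?powR_ge0 ?exprn_ge0 ?(ltW S0)// ltW.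
rewrite -!powR_mulrn ?(ltW S0)// -powRrM -powRD ?(gt_eqF S0) ?implybT//.
apply: ler_powR => //; apply: le_trans MN.
rewrite [leLHS](_ : _ = M%:R * q / (q - 3 * p))//; field.
by rewrite gt_eqF.
Qed.

(** The exponent of S is made even because only even moments are controlled. From (1 + y)^3 <= 8 (1
    + y^3) at y = x^(-p) come 8 S^M and, after the separation, 8 S^N + 8 x^(-q), whence the 16. *)
Lemma envelope_bound (p q : R) (M : nat) : 0 < p -> 3 * p < q ->
  exists n : nat, forall S x : R, 1 <= S -> 0 < x ->
  S ^+ M * (1 + x `^ (- p)) ^+ 3 <= 16 * S ^+ (2 * n) + 8 * x `^ (- q).
Proof.
move=> p0 pq; pose r := M%:R * q / (q - 3 * p).
have d0 : 0 < q - 3 * p by rewrite subr_gt0.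
pose N := (Num.truncn r).+1; exists (M + N)%N => S x S1 x0.
have rN : r <= N%:R by apply/ltW/truncnS_gt.
have Y := @powR_young S x p q M N S1 x0 p0 pq rN.
have y0 := powR_ge0 x (- p).
have y3 : x `^ (- (3 * p)) = (x `^ (- p)) ^+ 3.
  by rewrite -powR_mulrn// -powRrM; congr (_ `^ _); ring.
have cube : (1 + x `^ (- p)) ^+ 3 <= 8 * (1 + x `^ (- (3 * p))).
  rewrite y3; set y := x `^ _ in y0 *.
  have y30 : 0 <= y ^+ 3 by exact: exprn_ge0.
  have sq : 0 <= (y - 1) ^+ 2 * (y + 1) by apply: mulr_ge0; [exact: sqr_ge0|exact: addr_ge0].
  rewrite -subr_ge0 (_ : _ - _ = 3 * ((y - 1) ^+ 2 * (y + 1)) + 4 * (1 + y ^+ 3)); last by ring.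
  lra.
apply: (@le_trans _ _ (S ^+ M * (8 * (1 + x `^ (- (3 * p)))))).
  by rewrite ler_wpM2l// exprn_ge0// (le_trans ler01).
have SM : S ^+ M <= S ^+ (2 * (M + N)) by rewrite ler_weXn2l//; lia.
have SN : S ^+ N <= S ^+ (2 * (M + N)) by rewrite ler_weXn2l//; lia.
lra.
Qed.

(** In the application a = h, b is the centred quadratic term and rho the Taylor remainder, of
    orders e, e^2 and e^3, all measured by one envelope G. What the cube leaves beyond a^3 + 3 a^2
    b, namely a^2 rho, a (b + rho)^2 and (b + rho)^3, is at most of order e^5. *)
Lemma cube_expansion (a b rho e G B K : R) : 0 < e <= 1 -> 1 <= G -> 0 <= B -> 0 <= K ->
  `|a| <= e * G -> `|b| <= B * (e ^+ 2 * G) -> `|rho| <= K * (e ^+ 3 * G) ->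
  let L := B + K in
  [/\ `|(a + b + rho) ^+ 3 - (a ^+ 3 + 3 * (a ^+ 2 * b))| <=
        (3 * K + 3 * L ^+ 2 + L ^+ 3) * e ^+ 5 * G ^+ 3,
      `|(a + b + rho) ^+ 2 - a ^+ 2| <= (2 * L + L ^+ 2) * e ^+ 3 * G ^+ 3,
      `|(a + b + rho) - (a + b)| <= K * e ^+ 3 * G ^+ 3 &
      `|a + b + rho| <= (1 + L) * G].
Proof.
move=> /andP[e0 e1] G1 B0 K0 ha hb hr L.
have G0 : 0 <= G by exact: le_trans G1.
have L0 : 0 <= L by rewrite addr_ge0.
have e0' := ltW e0.
have hbr : `|b + rho| <= L * (e ^+ 2 * G).
  apply: (le_trans (ler_normD _ _)); rewrite mulrDl; apply: lerD => //.
  apply: (le_trans hr); rewrite ler_wpM2l// ler_wpM2r//.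
  by rewrite exprS ler_piMl// exprn_ge0.
have GX : G ^+ 2 <= G ^+ 3 by rewrite ler_weXn2l.
have GX1 : G <= G ^+ 3 by rewrite -[leLHS]expr1 ler_weXn2l.
have a2 : `|a ^+ 2| <= e ^+ 2 * G ^+ 2.
  by rewrite normrX -exprMn lerXn2r ?nnegrE ?mulr_ge0.
have br2 : `|(b + rho) ^+ 2| <= L ^+ 2 * (e ^+ 4 * G ^+ 2).
  rewrite normrX (_ : L ^+ 2 * _ = (L * (e ^+ 2 * G)) ^+ 2); last by ring.
  by rewrite lerXn2r ?nnegrE ?mulr_ge0 ?exprn_ge0.
have br3 : `|(b + rho) ^+ 3| <= L ^+ 3 * (e ^+ 5 * G ^+ 3).
  rewrite normrX; apply: (@le_trans _ _ ((L * (e ^+ 2 * G)) ^+ 3)).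
    by rewrite lerXn2r ?nnegrE ?mulr_ge0 ?exprn_ge0.
  rewrite (_ : _ ^+ 3 = e * (L ^+ 3 * (e ^+ 5 * G ^+ 3))); last by ring.
  by rewrite ler_piMl// !mulr_ge0 ?exprn_ge0.
split.
- rewrite (_ : _ - _ = 3 * (a ^+ 2 * rho) + 3 * (a * (b + rho) ^+ 2) + (b + rho) ^+ 3); last by ring.
  rewrite (_ : _ * G ^+ 3 = 3 * ((e ^+ 2 * G ^+ 2) * (K * (e ^+ 3 * G))) +
    3 * ((e * G) * (L ^+ 2 * (e ^+ 4 * G ^+ 2))) + L ^+ 3 * (e ^+ 5 * G ^+ 3)); last by ring.
  apply: (le_trans (ler_normD _ _)); apply: lerD => //.
  apply: (le_trans (ler_normD _ _)); rewrite !normrM (ger0_norm (ler0n _ _)).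
  by apply: lerD; rewrite ler_wpM2l// ler_pM// -?normrM.
- rewrite (_ : _ - _ = 2 * (a * (b + rho)) + (b + rho) ^+ 2); last by ring.
  apply: (@le_trans _ _ ((2 * L + L ^+ 2) * e ^+ 3 * G ^+ 2)); last first.
    by rewrite ler_wpM2l// mulr_ge0 ?exprn_ge0// addr_ge0 ?exprn_ge0// mulr_ge0.
  rewrite (_ : _ * G ^+ 2 = 2 * ((e * G) * (L * (e ^+ 2 * G))) + L ^+ 2 * (e ^+ 3 * G ^+ 2)); last by ring.
  apply: (le_trans (ler_normD _ _)); apply: lerD.
    by rewrite normrM (ger0_norm (ler0n _ _)) ler_wpM2l// normrM ler_pM.
  apply: (le_trans br2); rewrite ler_wpM2l ?exprn_ge0// ler_wpM2r ?exprn_ge0//.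
  by rewrite exprS ler_piMl// exprn_ge0.
- rewrite (_ : _ - _ = rho); last by ring.
  by apply: (le_trans hr); rewrite -mulrA ler_wpM2l// ler_wpM2l// exprn_ge0.
- rewrite -addrA; apply: (le_trans (ler_normD _ _)); rewrite mulrDl mul1r.
  apply: lerD; first by apply: (le_trans ha); rewrite ler_piMl.
  apply: (le_trans hbr); rewrite ler_wpM2l// ler_piMl// exprn_ile1//.
Qed.

Lemma measurable_boxcox (l : R) : meas R (boxcox l).
Proof.
have [->|l0] := eqVneq l 0.
  have -> : boxcox 0 = @ln R by apply/funext => y; rewrite /boxcox eqxx.
  exact: measurable_ln.
have -> : boxcox l = (fun y => (y `^ l - 1) * l^-1).
  by apply/funext => y; rewrite /boxcox (negbTE l0).
apply: measurable_funM => //; apply: measurable_funB => //; exact: measurable_powR.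
Qed.

End envelope.

(** * Uniform expansion of the second and third central moments *)

Section delta_method.
Context {R : realType}.

(** [K] depends on l, q and the moment bounds alone, not on the law or on e. Up to the constant (l -
    1)/2 E h^2, W equals h + b + rho with E h = E b = 0; its mean is therefore O(e^3), and
    recentring costs O(e^6) in the variance and O(e^5) in the third moment. The term 3 E(h^2 b)
    produces 3/2 (l - 1) (E h^4 - (E h^2)^2). *)
Lemma boxcox_delta (l q : R) (C : nat -> R) (C0 : R) : 0 < q -> - (3 * l) < q ->
  exists2 K : R, 0 <= K &
  forall d (T : measurableType d) (P : probability T R) (X : T -> R) (e : R),
  meas T X -> (forall w, 0 < X w) -> 0 < e <= 1 ->
  (forall n, (\int[P]_w ((X w - 1) ^+ (2 * n))%:E <= (C n * e ^+ (2 * n))%:E)%E) ->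
  (\int[P]_w (X w `^ (- q))%:E <= C0%:E)%E ->
  \int[P]_w (X w - 1) = 0 ->
  let W w := boxcox l (X w) in
  let m k := \int[P]_w (X w - 1) ^+ k in
  [/\ intg P (fun w => `|W w| ^+ 3),
    (forall k, (k <= 3)%N -> intg P (fun w => W w ^+ k)),
    `|\int[P]_w (W w - \int[P]_w W w) ^+ 2 - m 2%N| <= K * e ^+ 3 &
    `|\int[P]_w (W w - \int[P]_w W w) ^+ 3 -
      (m 3%N + 3 / 2 * (l - 1) * (m 4%N - m 2%N ^+ 2))| <= K * e ^+ 5].
Proof.
move=> q0 lq.
(* Three demands: p >= -l and p > 0 for the Taylor bound, 3 p < q for the envelope. The value q/6
   takes over when -l is not positive enough. *)
pose p := Num.max (- l) (q / 6).
have p0 : 0 < p by rewrite lt_max divr_gt0 ?orbT.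
have lp : - l <= p by rewrite le_max lexx.
have pq : 3 * p < q by rewrite mulrC -ltr_pdivlMr// gt_max; apply/andP; split; lra.
have [K1 [m0 [K10 Htay]]] := boxcox_taylor p0 lp.
have [n Henv] := @envelope_bound R p q (3 * (m0 + 3)) p0 pq.
pose c := l - 1.
(* No sign is assumed of the bounds [C] and [C0]; their positive parts are used. *)
pose CC k := Num.max 0 (C k).
have CC0 k : 0 <= CC k by rewrite le_max lexx.
pose B := `|c / 2| * (1 + CC 1%N).
have B0 : 0 <= B by rewrite mulr_ge0// addr_ge0.
pose L := B + K1; have L0 : 0 <= L by rewrite addr_ge0.
pose EG := 16 * 2 ^+ (2 * n) * (1 + CC n) + 8 * Num.max 0 C0.
have EG0 : 0 <= EG by rewrite addr_ge0// !mulr_ge0 ?exprn_ge0 ?addr_ge0// le_max lexx.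
pose M1 := K1 * EG; pose M2 := (2 * L + L ^+ 2) * EG.
pose M3 := (3 * K1 + 3 * L ^+ 2 + L ^+ 3) * EG.
have M10 : 0 <= M1 by rewrite mulr_ge0.
have M20 : 0 <= M2 by rewrite mulr_ge0// addr_ge0 ?exprn_ge0// mulr_ge0.
have M30 : 0 <= M3 by rewrite mulr_ge0// !addr_ge0 ?mulr_ge0 ?exprn_ge0.
exists (M2 + M1 ^+ 2 + (M3 + 3 * M1 * (CC 1%N + M2) + 2 * M1 ^+ 3)).
  by nonneg.
move=> d T P X e mX X0 e01 HC HC0 EX W m.
have /andP[e0 e1] := e01.
have e0' := ltW e0.
pose h w := X w - 1.
have mh : meas T h by exact: measurable_funB.
have HCC k : (\int[P]_w (h w ^+ (2 * k))%:E <= (CC k * e ^+ (2 * k))%:E)%E.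
  apply: (le_trans (HC k)); rewrite lee_fin ler_wpM2r ?exprn_ge0//.
  by rewrite le_max lexx orbT.
have even_int k : intg P (fun w => h w ^+ (2 * k)).
  apply: (integrable_ge0_bound _ _ (HCC k)); first exact: measurable_funX.
  by move=> w; rewrite exprM exprn_ge0// sqr_ge0.
(* |y| <= 1 + y^2 reduces any power to an even one. *)
have hk_int k : intg P (fun w => h w ^+ k).
  apply: (@integrable_dominated _ _ _ _ _ (fun w => 1 + h w ^+ (2 * k))).
  - exact: measurable_funX.
  - by apply: intD => //; exact: int_cst.
  - move=> w; rewrite [(2 * k)%N]mulnC exprM; set y := h w ^+ k.
    have := sqr_ge0 (`|y| - 1); rewrite sqrrB1 real_normK ?num_real//.
    by have := sqr_ge0 y; lra.
have m2e : 0 <= m 2%N <= CC 1%N * e ^+ 2.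
  apply/andP; split; first by apply: Rintegral_ge0 => w _; exact: sqr_ge0.
  exact: (Rintegral_le_bound (hk_int 2%N) (HCC 1%N)).
(* The rescaled deviation h/e is of order 1, so the moments of [S] are bounded uniformly in e; [G]
   combines its growth with the singularity at 0. *)
pose S w := 1 + `|h w| / e.
pose Y w := 1 + X w `^ (- p).
pose G w := S w ^+ (m0 + 3) * Y w.
have S1 w : 1 <= S w by rewrite lerDl divr_ge0.
have Y1 w : 1 <= Y w by rewrite lerDl powR_ge0.
have G1 w : 1 <= G w by rewrite -[leLHS]mulr1 ler_pM// exprn_ege1.
have mpow r : meas T (fun w => X w `^ r).
  exact: (measurableT_comp (measurable_powR r)).
have mG : meas T G.
  apply: measurable_funM; last exact: measurable_funD.
  apply: measurable_funX; apply: measurable_funD => //; apply: measurable_funM => //.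
  exact: measurableT_comp.
have G3 w : G w ^+ 3 <= 16 * 2 ^+ (2 * n) * (1 + (e^-1) ^+ (2 * n) * h w ^+ (2 * n)) + 8 * X w `^ (- q).
  rewrite exprMn -exprM mulnC; apply: (le_trans (Henv _ _ (S1 w) (X0 w))).
  rewrite lerD2r -mulrA ler_wpM2l//.
  have hn : `|h w / e| ^+ (2 * n) = e^-1 ^+ (2 * n) * h w ^+ (2 * n).
    by rewrite -exprMn !exprM real_normK ?num_real// mulrC.
  rewrite -hn normrM normfV (gtr0_norm e0) /S; set s := `|h w| / e.
  have s0 : 0 <= s by rewrite divr_ge0.
  have [s1|s1] := leP s 1.
    apply: (@le_trans _ _ (2 ^+ (2 * n))).
      by apply: lerXn2r; rewrite ?nnegrE; [nonneg|nonneg|lra].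
    by rewrite ler_peMr ?exprn_ge0// lerDl exprn_ge0.
  apply: (@le_trans _ _ ((2 * s) ^+ (2 * n))).
    by apply: lerXn2r; rewrite ?nnegrE; [nonneg|nonneg|lra].
  by rewrite exprMn ler_wpM2l ?exprn_ge0// lerDr.
have Xq_int : intg P (fun w => X w `^ (- q)).
  by apply: (integrable_ge0_bound _ _ HC0) => // w; exact: powR_ge0.
have env_int : intg P (fun w =>
    16 * 2 ^+ (2 * n) * (1 + (e^-1) ^+ (2 * n) * h w ^+ (2 * n)) + 8 * X w `^ (- q)).
  apply: intD; apply: intZ => //.
  by apply: intD; [exact: int_cst|apply: intZ].
have G3_int : intg P (fun w => G w ^+ 3).
  apply: (integrable_dominated _ env_int); first exact: measurable_funX.
  by move=> w; rewrite ger0_norm// exprn_ge0// (le_trans ler01).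
have EG3 : \int[P]_w G w ^+ 3 <= EG.
  apply: (le_trans (le_Rintegral measurableT G3_int env_int (fun w _ => G3 w))).
  have i1 : intg P (fun w => e^-1 ^+ (2 * n) * h w ^+ (2 * n)) by exact: intZ.
  have i2 : intg P (fun w => 1 + e^-1 ^+ (2 * n) * h w ^+ (2 * n)).
    by apply: intD => //; exact: int_cst.
  rewrite RintegralD//; [|exact: intZ|exact: intZ].
  rewrite RintegralZl// RintegralZl// RintegralD//; last exact: int_cst.
  rewrite RintegralZl// Rintegral_cst1 /EG; apply: lerD.
    rewrite ler_wpM2l ?mulr_ge0 ?exprn_ge0// lerD2l.
    rewrite exprVn ler_pdivrMl ?exprn_gt0// mulrC.
    exact: Rintegral_le_bound.
  rewrite ler_wpM2l//; apply: (@le_trans _ _ C0); last by rewrite le_max lexx orbT.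
  exact: Rintegral_le_bound.
pose b w := c / 2 * (h w ^+ 2 - m 2%N).
pose rho w := W w - h w - c / 2 * h w ^+ 2.
have ha w : `|h w| <= e * G w.
  have -> : `|h w| = e * (`|h w| / e) by rewrite mulrCA divff ?mulr1 ?gt_eqF.
  rewrite ler_wpM2l//; apply: (@le_trans _ _ (S w)); first by rewrite lerDr.
  apply: (@le_trans _ _ (S w ^+ (m0 + 3))).
    by rewrite -[leLHS]expr1 ler_weXn2l// addnC.
  by rewrite ler_peMr// exprn_ge0// (le_trans ler01).
have S2G w : S w ^+ 2 <= G w.
  apply: (@le_trans _ _ (S w ^+ (m0 + 3))); first by rewrite ler_weXn2l// addnC.
  by rewrite ler_peMr// exprn_ge0// (le_trans ler01).
have heS w : `|h w| <= e * S w.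
  by rewrite mulrDr mulr1 mulrCA divff ?gt_eqF// mulr1 lerDr.
have hb w : `|b w| <= B * (e ^+ 2 * G w).
  rewrite /b normrM -mulrA ler_wpM2l//.
  apply: (le_trans (ler_normB _ _)); rewrite mulrDl mul1r.
  have /andP[m20 m21] := m2e.
  apply: lerD.
    rewrite normrX; apply: (@le_trans _ _ ((e * S w) ^+ 2)).
      by rewrite lerXn2r ?nnegrE// mulr_ge0// (le_trans ler01).
    by rewrite exprMn ler_wpM2l ?exprn_ge0.
  rewrite ger0_norm//; apply: (le_trans m21); rewrite ler_wpM2l//.
  by rewrite ler_peMr// exprn_ge0.
have hr w : `|rho w| <= K1 * (e ^+ 3 * G w).
  apply: (le_trans (Htay _ (X0 w))); rewrite ler_wpM2l// -/(h w).
  rewrite (_ : e ^+ 3 * G w = (e * S w) ^+ 3 * S w ^+ m0 * Y w); last by rewrite /G exprMn exprD; ring.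
  rewrite ler_wpM2r ?(le_trans ler01 (Y1 w))//.
  apply: ler_pM; [nonneg|nonneg| |].
    by rewrite lerXn2r ?nnegrE// mulr_ge0// (le_trans ler01).
  apply: lerXn2r; rewrite ?nnegrE; [nonneg|exact: le_trans (S1 w)|].
  by rewrite lerD2l ler_pdivlMr// ler_piMr.
have dec w : W w - c / 2 * m 2%N = h w + b w + rho w by rewrite /b /rho; ring.
have mW : meas T W by exact: (measurableT_comp (measurable_boxcox l)).
pose D w := W w - c / 2 * m 2%N.
have mD : meas T D by exact: measurable_funB.
have CE w := cube_expansion e01 (G1 w) B0 K10 (ha w) (hb w) (hr w).
have DG w : `|D w| <= (1 + L) * G w by rewrite /D dec; have [] := CE w.
have GW w : `|W w| <= (1 + L + B + CC 1%N) * G w.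
  have -> : W w = D w + c / 2 * m 2%N by rewrite /D subrK.
  apply: (le_trans (ler_normD _ _)).
  rewrite (_ : _ * G w = (1 + L) * G w + (B + CC 1%N) * G w); last by ring.
  apply: lerD => //.
  have /andP[m20 m21] := m2e.
  have m2C : m 2%N <= CC 1%N.
    by apply: (le_trans m21); rewrite ler_piMr// exprn_ile1.
  rewrite normrM (ger0_norm m20); apply: (@le_trans _ _ (B * G w)); last first.
    by rewrite ler_wpM2r ?(le_trans ler01 (G1 w))// lerDl.
  rewrite /B -mulrA ler_wpM2l// -[leLHS]mulr1 ler_pM//.
  by apply: (le_trans m2C); rewrite lerDr.
have powG w k : (k <= 3)%N -> G w ^+ k <= G w ^+ 3 by move=> k3; rewrite ler_weXn2l.
have pow_int (f : T -> R) (A : R) k : (k <= 3)%N -> meas T f -> 0 <= A ->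
    (forall w, `|f w| <= A * G w) -> intg P (fun w => f w ^+ k).
  move=> k3 mf A0 fA.
  apply: (@integrable_dominated _ _ _ _ _ (fun w => A ^+ k * G w ^+ 3)).
  - exact: measurable_funX.
  - exact: intZ.
  - move=> w; rewrite normrX; apply: (@le_trans _ _ ((A * G w) ^+ k)).
      by rewrite lerXn2r ?nnegrE// mulr_ge0// (le_trans ler01).
    by rewrite exprMn ler_wpM2l ?exprn_ge0// powG.
have A1 : 0 <= 1 + L + B + CC 1%N by rewrite !addr_ge0.
have A2 : 0 <= 1 + L by rewrite addr_ge0.
have W_int k : (k <= 3)%N -> intg P (fun w => W w ^+ k).
  by move=> k3; exact: (pow_int _ _ _ k3 mW A1 GW).
have D_int k : (k <= 3)%N -> intg P (fun w => D w ^+ k).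
  by move=> k3; exact: (pow_int _ _ _ k3 mD A2 DG).
have W3_int : intg P (fun w => `|W w| ^+ 3).
  apply: (pow_int (fun w => `|W w|) _ _ (leqnn _) _ A1).
    exact: measurableT_comp.
  by move=> w; rewrite normr_id.
have h_int : intg P h by exact: (hk_int 1%N).
have hm_int : intg P (fun w => h w ^+ 2 - m 2%N).
  by apply: intB; [exact: hk_int|exact: int_cst].
have b_int : intg P b by exact: intZ.
have Eb : \int[P]_w b w = 0.
  rewrite /b RintegralZl// RintegralB//; last exact: int_cst.
  by rewrite Rintegral_cst1 subrr mulr0.
pose eta := \int[P]_w D w.
have eta_le : `|eta| <= M1 * e ^+ 3.
  have -> : eta = \int[P]_w D w - \int[P]_w (h w + b w).
    by rewrite RintegralD// Eb EX addr0 subr0.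
  rewrite [leRHS](_ : _ = K1 * e ^+ 3 * EG); last by rewrite /M1; ring.
  apply: (dist_Rintegral _ _ G3_int _ _ EG3).
  - exact: (D_int 1%N).
  - exact: intD.
  - by rewrite mulr_ge0 ?exprn_ge0.
  - by move=> w; rewrite /D dec; have [] := CE w.
have D2_le : `|\int[P]_w D w ^+ 2 - m 2%N| <= M2 * e ^+ 3.
  rewrite [leRHS](_ : _ = (2 * L + L ^+ 2) * e ^+ 3 * EG); last by rewrite /M2; ring.
  apply: (dist_Rintegral _ _ G3_int _ _ EG3).
  - exact: (D_int 2%N).
  - exact: hk_int.
  - by rewrite mulr_ge0 ?exprn_ge0// addr_ge0 ?exprn_ge0// mulr_ge0.
  - by move=> w; rewrite /D dec; have [] := CE w.
pose J := m 3%N + 3 / 2 * (l - 1) * (m 4%N - m 2%N ^+ 2).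
have h2b w : 3 * (h w ^+ 2 * b w) = 3 / 2 * c * h w ^+ 4 - 3 / 2 * c * m 2%N * h w ^+ 2.
  by rewrite /b; field.
have D3_le : `|\int[P]_w D w ^+ 3 - J| <= M3 * e ^+ 5.
  have i4 : intg P (fun w => 3 / 2 * c * h w ^+ 4) by apply: intZ; exact: hk_int.
  have i2 : intg P (fun w => 3 / 2 * c * m 2%N * h w ^+ 2) by apply: intZ; exact: hk_int.
  have i42 : intg P (fun w => 3 / 2 * c * h w ^+ 4 - 3 / 2 * c * m 2%N * h w ^+ 2) by exact: intB.
  have -> : J = \int[P]_w (h w ^+ 3 + (3 / 2 * c * h w ^+ 4 - 3 / 2 * c * m 2%N * h w ^+ 2)).
    rewrite RintegralD//.
    rewrite RintegralB// !RintegralZl//.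
    rewrite -/(m 3%N) -/(m 4%N) -/(m 2%N) /J -/c; ring.
  rewrite [leRHS](_ : _ = (3 * K1 + 3 * L ^+ 2 + L ^+ 3) * e ^+ 5 * EG); last by rewrite /M3; ring.
  apply: (dist_Rintegral _ _ G3_int _ _ EG3).
  - exact: (D_int 3%N).
  - by apply: intD => //; exact: hk_int.
  - by rewrite mulr_ge0 ?exprn_ge0// !addr_ge0 ?mulr_ge0 ?exprn_ge0.
  - by move=> w; rewrite /D dec -h2b; have [] := CE w.
have WD w : W w - \int[P]_w W w = D w - eta.
  rewrite /eta /D RintegralB//; [|exact: (W_int 1%N isT)|exact: int_cst].
  by rewrite Rintegral_cst1; ring.
have D1i := D_int 1%N isT; have D2i := D_int 2%N isT; have D3i := D_int 3%N isT.
have V2 : \int[P]_w (W w - \int[P]_w W w) ^+ 2 = \int[P]_w D w ^+ 2 - eta ^+ 2.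
  under eq_Rintegral do rewrite WD.
  rewrite (_ : (fun w => (D w - eta) ^+ 2) = (fun w => D w ^+ 2 + (- (2 * eta) * D w ^+ 1 + eta ^+ 2))); last first.
    by apply/funext => w; ring.
  have i1 : intg P (fun w => - (2 * eta) * D w ^+ 1) by exact: intZ.
  rewrite RintegralD//; last by apply: intD => //; exact: int_cst.
  rewrite RintegralD//; last exact: int_cst.
  rewrite RintegralZl// Rintegral_cst1.
  have -> : \int[P]_w D w ^+ 1 = eta by [].
  ring.
have V3 : \int[P]_w (W w - \int[P]_w W w) ^+ 3 = \int[P]_w D w ^+ 3 - 3 * eta * \int[P]_w D w ^+ 2 + 2 * eta ^+ 3.
  under eq_Rintegral do rewrite WD.
  rewrite (_ : (fun w => (D w - eta) ^+ 3) = (fun w => D w ^+ 3 + (- (3 * eta) * D w ^+ 2 + (3 * eta ^+ 2 * D w ^+ 1 - eta ^+ 3)))); last first.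
    by apply/funext => w; ring.
  have i1 : intg P (fun w => 3 * eta ^+ 2 * D w ^+ 1) by exact: intZ.
  have i2 : intg P (fun w => - (3 * eta) * D w ^+ 2) by exact: intZ.
  have i3 : intg P (fun w => 3 * eta ^+ 2 * D w ^+ 1 - eta ^+ 3).
    by apply: intB => //; exact: int_cst.
  rewrite RintegralD//; last exact: intD.
  rewrite RintegralD// RintegralB//; last exact: int_cst.
  rewrite Rintegral_cst1 RintegralZl// RintegralZl//.
  have -> : \int[P]_w D w ^+ 1 = eta by [].
  ring.
have e6 k j : (k <= j)%N -> e ^+ j <= e ^+ k by move=> kj; rewrite ler_wiXn2l.
have eta2 : eta ^+ 2 <= M1 ^+ 2 * e ^+ 3.
  rewrite -real_normK ?num_real//; apply: (@le_trans _ _ ((M1 * e ^+ 3) ^+ 2)).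
    by rewrite lerXn2r ?nnegrE// mulr_ge0 ?exprn_ge0.
  by rewrite exprMn -exprM ler_wpM2l ?exprn_ge0// e6.
have eta3 : `|eta ^+ 3| <= M1 ^+ 3 * e ^+ 5.
  rewrite normrX; apply: (@le_trans _ _ ((M1 * e ^+ 3) ^+ 3)).
    by rewrite lerXn2r ?nnegrE// mulr_ge0 ?exprn_ge0.
  by rewrite exprMn -exprM ler_wpM2l ?exprn_ge0// e6.
have D2b : `|\int[P]_w D w ^+ 2| <= (CC 1%N + M2) * e ^+ 2.
  rewrite -(subrK (m 2%N) (\int[P]_w D w ^+ 2)); apply: (le_trans (ler_normD _ _)).
  rewrite addrC mulrDl; apply: lerD.
    by have /andP[m20 m21] := m2e; rewrite ger0_norm.
  by apply: (le_trans D2_le); rewrite ler_wpM2l// e6.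
have M40 : 0 <= M3 + 3 * M1 * (CC 1%N + M2) + 2 * M1 ^+ 3.
  by nonneg.
split => //.
- rewrite V2 (_ : _ - _ - _ = (\int[P]_w D w ^+ 2 - m 2%N) - eta ^+ 2); last by ring.
  apply: (@le_trans _ _ ((M2 + M1 ^+ 2) * e ^+ 3)); last first.
    by rewrite ler_wpM2r ?exprn_ge0// lerDl.
  apply: (le_trans (ler_normB _ _)); rewrite mulrDl; apply: lerD => //.
  by rewrite ger0_norm ?sqr_ge0.
- rewrite V3 -/J (_ : _ - J = (\int[P]_w D w ^+ 3 - J) - 3 * (eta * \int[P]_w D w ^+ 2) + 2 * eta ^+ 3); last by ring.
  apply: (@le_trans _ _ ((M3 + 3 * M1 * (CC 1%N + M2) + 2 * M1 ^+ 3) * e ^+ 5)); last first.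
    by rewrite ler_wpM2r ?exprn_ge0// lerDr addr_ge0 ?exprn_ge0.
  rewrite (_ : (M3 + _ + _) * _ = M3 * e ^+ 5 + 3 * ((M1 * e ^+ 3) * ((CC 1%N + M2) * e ^+ 2)) + 2 * (M1 ^+ 3 * e ^+ 5)); last by ring.
  apply: (le_trans (ler_normD _ _)); apply: lerD; last first.
    by rewrite normrM (ger0_norm (ler0n _ _)) ler_wpM2l.
  apply: (le_trans (ler_normB _ _)); apply: lerD => //.
  rewrite normrM (ger0_norm (ler0n _ _)) ler_wpM2l// normrM.
  exact: ler_pM.
Qed.

End delta_method.

(** * The gamma factors *)

Section gamma_integral.
Context {R : realType}.
Implicit Types a s x : R.

Definition gamma_ker a s x : R := if 0 < x then x `^ (a - 1) * expR (- (s * x)) else 0.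

Lemma gamma_ker_ge0 a s x : 0 <= gamma_ker a s x.
Proof. by rewrite /gamma_ker; case: ifP => // _; rewrite mulr_ge0 ?powR_ge0 ?expR_ge0. Qed.

Lemma measurable_expRM s : meas R (fun x => expR (- (s * x))).
Proof.
by apply: (measurableT_comp (@measurable_expR R)); apply: measurableT_comp => //; exact: measurable_funM.
Qed.

Lemma measurable_cutpos (f : R -> R) : meas R f ->
  meas R (fun x => if 0 < x then f x else 0).
Proof. by move=> mf; apply: measurable_fun_ifT => //; exact: measurable_fun_ltr. Qed.

Lemma measurable_gamma_ker a s : meas R (gamma_ker a s).
Proof.
apply: measurable_cutpos; apply: measurable_funM; last exact: measurable_expRM.
exact: measurable_powR.
Qed.

(** Kept in the extended reals: scaling and the functional equation then hold before finiteness is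
    known, and finiteness is deduced from them. *)
Definition gint a s : \bar R := (\int[leb]_x (gamma_ker a s x)%:E)%E.

Lemma gint_ge0 a s : (0 <= gint a s)%E.
Proof. by apply: integral_ge0 => x _; rewrite lee_fin gamma_ker_ge0. Qed.

Lemma gint_scale a s : 0 < s -> gint a s = ((s `^ (- a))%:E * gint a 1)%E.
Proof.
move=> s0.
have -> : gint a s = ((s `^ (1 - a))%:E * \int[leb]_x (gamma_ker a 1 (s * x))%:E)%E.
  rewrite -ge0_integralZl_EFin ?powR_ge0//.
  - apply: eq_integral => x _; rewrite -EFinM; congr (_%:E).
    rewrite /gamma_ker pmulr_rgt0//; case: ifPn => x0; last by rewrite mulr0.
    rewrite mul1r powRM ?ltW// !mulrA -powRD ?(gt_eqF s0) ?implybT//.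
    by rewrite (_ : 1 - a + (a - 1) = 0) ?powRr0 ?mul1r//; ring.
  - by move=> x _; rewrite lee_fin gamma_ker_ge0.
  - apply/measurable_EFinP; apply: (measurableT_comp (measurable_gamma_ker _ _)).
    exact: measurable_funM.
rewrite (@ge0_integral_scale _ s (fun x => (gamma_ker a 1 x)%:E))//; last 2 first.
- by apply/measurable_EFinP; exact: measurable_gamma_ker.
- by move=> x; rewrite lee_fin gamma_ker_ge0.
rewrite muleA -EFinM -powR_inv1 ?ltW// -powRD ?(gt_eqF s0) ?implybT//.
by rewrite (_ : 1 - a - 1 = - a)//; ring.
Qed.

Lemma cvg_powRN_y a : 0 < a -> (s `^ (- a)) @[s --> +oo] --> (0 : R).
Proof.
move=> a0; apply/cvgrPdist_lt => /= e e0; near=> s.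
have s0 : 0 < s by near: s; exact: nbhs_pinfty_gt.
rewrite sub0r normrN ger0_norm ?powR_ge0// powRN -[ltRHS]invrK ltf_pV2 ?posrE ?invr_gt0 ?powR_gt0//.
have -> : e^-1 = (e^-1 `^ a^-1) `^ a by rewrite -powRrM mulVf ?gt_eqF// powRr1// invr_ge0 ltW.
apply: gt0_ltr_powR => //; rewrite ?nnegrE ?powR_ge0 ?(ltW s0)//.
Unshelve. all: by end_near. Qed.

Lemma integral_powR_1y a : 0 < a ->
  (\int[leb]_(s in `[1%R, +oo[) (s `^ (- a - 1))%:E = (a^-1)%:E)%E.
Proof.
move=> a0.
have D x : 0 < x -> is_derive x 1 (fun s : R => - a^-1 * s `^ (- a)) (x `^ (- a - 1)).
  move=> x0; have dl := is_derive1_powR (- a) x0.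
  apply: is_derive_eq.
  by rewrite /GRing.scale/= mulrA mulrNN mulVf ?gt_eqF// mul1r.
have C x : 0 < x -> {for x, continuous (fun s : R => s `^ (- a - 1))}.
  move=> x0; have dl := is_derive1_powR (- a - 1) x0.
  by apply: differentiable_continuous; apply/derivable1_diffP; have [] := dl.
rewrite (@ge0_continuous_FTC2y _ (fun s => s `^ (- a - 1)) (fun s => - a^-1 * s `^ (- a)) 1 0).
- by rewrite powR1 mulr1 sub0e -EFinN opprK.
- by move=> x _; exact: powR_ge0.
- apply: continuous_in_subspaceT => x /set_mem /=; rewrite in_itv/= andbT => x1.
  by apply: C; exact: lt_le_trans x1.
- rewrite -[X in _ --> X](mulr0 (- a^-1)); apply: cvgM; first exact: cvg_cst.
  exact: cvg_powRN_y.
- by move=> x x1; have [] // := D x; exact: lt_trans x1.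
- have d1 := D 1 ltr01; apply: cvg_at_right_filter.
  have : {for (1 : R), continuous (fun s : R => - a^-1 * s `^ (- a))}.
    by apply: differentiable_continuous; apply/derivable1_diffP; have [] := d1.
  exact.
- move=> x; rewrite in_itv/= andbT => x1; rewrite derive1E.
  by apply: derive_val; apply: D; exact: lt_trans x1.
Qed.

Lemma integral_expRM_1y x : 0 < x ->
  (\int[leb]_(s in `[1%R, +oo[) (expR (- (s * x)))%:E = (expR (- x) / x)%:E)%E.
Proof.
move=> x0.
have D s : is_derive s 1 (fun s : R => - x^-1 * expR (- (s * x))) (expR (- (s * x))).
  apply: is_derive_eq.
  by rewrite scaler0 add0r /GRing.scale/= mulr1; field; rewrite gt_eqF.
have C s : {for s, continuous (fun s : R => expR (- (s * x)))}.
  apply: continuous_comp; last exact: continuous_expR.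
  by apply: cvgN; apply: cvgMl; exact: cvg_id.
rewrite (@ge0_continuous_FTC2y _ (fun s => expR (- (s * x))) (fun s => - x^-1 * expR (- (s * x))) 1 0).
- by rewrite mul1r sub0e -EFinN mulNr opprK mulrC.
- by move=> s _; exact: expR_ge0.
- by apply: continuous_in_subspaceT => s _; exact: C.
- rewrite -[X in _ --> X](mulr0 (- x^-1)); apply: cvgM; first exact: cvg_cst.
  apply: (@cvg_comp _ _ _ (fun s => s * x) (fun y => expR (- y)) _ (pinfty_nbhs R)); last exact: cvgr_expR.
  by apply: gt0_cvgMly => //; exact: cvg_id.
- by move=> s _; have [] := D s.
- apply: cvg_at_right_filter.
  have : {for (1 : R), continuous (fun s : R => - x^-1 * expR (- (s * x)))}.
    by apply: differentiable_continuous; apply/derivable1_diffP; have [] := D 1.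
  exact.
- by move=> s _; rewrite derive1E; apply: derive_val; exact: D.
Qed.

Lemma integral_if (A : set R) (b : R -> bool) (f : R -> R) : (forall x, b x <-> A x) ->
  (\int[leb]_(x in A) (f x)%:E = \int[leb]_x (if b x then f x else 0)%:E)%E.
Proof.
move=> Ab; rewrite integral_mkcond; apply: eq_integral => x _; rewrite patchE.
have -> : (x \in A) = b x by apply/idP/idP; rewrite inE => /Ab.
by case: ifP.
Qed.

(** Tonelli replaces integration by parts. The function x^a e^(-s x) is integrated over x > 0 and s
    >= 1: the integral over s gives x^(a-1) e^(-x), while the integral over x gives s^(-a-1)
    Gamma(a+1), and then 1/a remains from s. *)
Lemma gint_rec a : 0 < a -> gint (a + 1) 1 = (a%:E * gint a 1)%E.
Proof.
move=> a0.
pose f (p : R * R) : \bar R := ((if p.1 \in `[1, +oo[ then 1 else 0) * gamma_ker (a + 1) p.1 p.2)%:E.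
have f0 p : (0 <= f p)%E.
  by rewrite lee_fin mulr_ge0 ?gamma_ker_ge0//; case: ifP.
have mf : meas (R * R) f.
  apply/measurable_EFinP; apply: measurable_funM.
    apply: (@measurableT_comp _ _ _ _ _ _ (fun x : R => if x \in `[1, +oo[ then 1 else 0 : R)) => //.
    apply: measurable_fun_ifT => //.
    rewrite (_ : (fun x : R => x \in `[1, +oo[) = (fun x => 1 <= x)); last by apply/funext => x; rewrite in_itv/= andbT.
    exact: measurable_fun_ler.
  rewrite /gamma_ker; apply: measurable_fun_ifT => //; first exact: measurable_fun_ltr.
  apply: measurable_funM; first by apply: (measurableT_comp (measurable_powR _)).
  by apply: (measurableT_comp (@measurable_expR R)); apply: measurableT_comp => //; exact: measurable_funM.
have b1 x : 1 <= x <-> `[1%R, +oo[%classic x by rewrite /= in_itv/= andbT.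
have m1 : meas R (fun x : R => 1 <= x) by exact: measurable_fun_ler.
have := lebesgue_tonelli mf f0.
have -> : (\int[leb]_x (\int[leb]_z f (x, z)) = (a^-1)%:E * gint (a + 1) 1)%E.
  rewrite -integral_powR_1y// (integral_if _ b1).
  rewrite -ge0_integralZr//; last 3 first.
  - apply/measurable_EFinP; apply: measurable_fun_ifT => //; exact: measurable_powR.
  - by move=> x _; rewrite lee_fin; case: ifP => // _; rewrite powR_ge0.
  - exact: gint_ge0.
  apply: eq_integral => s _; rewrite /f/= in_itv/= andbT; case: ifPn => s1.
    under eq_integral do rewrite mul1r.
    rewrite -/(gint (a + 1) s) gint_scale; last by move: s1; exact: lt_le_trans.
    by rewrite opprD.
  by rewrite mul0e integral0_eq// => z _; rewrite mul0r.
have -> : (\int[leb]_z (\int[leb]_x f (x, z)) = gint a 1)%E.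
  apply: eq_integral => y _; rewrite /f/= /gamma_ker.
  case: ifPn => y0; last by rewrite integral0_eq// => z _; rewrite mulr0.
  transitivity ((y `^ a)%:E * \int[leb]_(s in `[1%R, +oo[) (expR (- (s * y)))%:E)%E.
    rewrite (integral_if _ b1) -ge0_integralZl_EFin ?powR_ge0//; last 2 first.
    - by move=> x _; rewrite lee_fin; case: ifP => // _; exact: expR_ge0.
    - apply/measurable_EFinP; apply: measurable_fun_ifT => //.
      apply: (measurableT_comp (@measurable_expR R)); apply: measurableT_comp => //; exact: measurable_funM.
    apply: eq_integral => s _; rewrite in_itv/= andbT.
    by rewrite addrK; case: ifPn => _; [rewrite mul1r EFinM|rewrite mul0r mule0].
  rewrite integral_expRM_1y// -EFinM mul1r; congr (_%:E).
  by rewrite mulrCA mulrC -powR_inv1 ?ltW// -powRD ?(gt_eqF y0) ?implybT.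
by move=> <-; rewrite muleA -EFinM divff ?gt_eqF// mul1e.
Qed.

Lemma gint11 : gint 1 1 = 1%E.
Proof.
transitivity (\int[leb]_x (exponential_pdf (1 : R) x)%:E)%E; last exact: integral_exponential_pdf.
apply: ae_eq_integral => //.
- by apply/measurable_EFinP; exact: measurable_gamma_ker.
- by apply/measurable_EFinP; exact: measurable_exponential_pdf.
exists [set 0]; split => //; first exact: lebesgue_measure_set1.
move=> x /= /not_implyP[_]; apply: contra_notP => /eqP x0.
rewrite /gamma_ker; case: ifPn => x1.
  by rewrite exponential_pdfE ?ltW// subrr powRr0 !mul1r mulN1r.
by rewrite lt0_exponential_pdf// lt_neqAle x0 leNgt.
Qed.

Lemma gint_nat n : (gint n.+1%:R 1 < +oo)%E.
Proof.
elim: n => [|n IH]; first by rewrite gint11 ltry.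
rewrite -[n.+2]addn1 natrD gint_rec ?ltr0n//.
by rewrite lte_mul_pinfty.
Qed.

(** The bound x^a <= 1 + x^n with an integer n >= a gives finiteness at a + 1, and the functional
    equation brings it down to a. *)
Lemma gint_lty a : 0 < a -> (gint a 1 < +oo)%E.
Proof.
move=> a0.
have H : (gint (a + 1) 1 < +oo)%E.
  pose n := (Num.truncn a).+1.
  have an : a <= n%:R by apply/ltW/truncnS_gt.
  apply: (@le_lt_trans _ _ (\int[leb]_x ((gamma_ker 1 1 x)%:E + (gamma_ker n.+1%:R 1 x)%:E))%E).
    apply: ge0_le_integral => //.
    - by move=> x _; rewrite lee_fin gamma_ker_ge0.
    - by apply/measurable_EFinP; exact: measurable_gamma_ker.
    - by apply: emeasurable_funD; apply/measurable_EFinP; exact: measurable_gamma_ker.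
    - move=> x _; rewrite -EFinD lee_fin /gamma_ker; case: ifP => x0; last by rewrite addr0.
      rewrite -mulrDl ler_wpM2r ?expR_ge0// addrK subrr powRr0 -natr1 addrK.
      have [x1|x1] := leP x 1.
        apply: (@le_trans _ _ 1); last by rewrite lerDl powR_ge0.
        by rewrite -(powRr0 x); apply: ger_powR; rewrite ?x0// ltW.
      apply: (@le_trans _ _ (x `^ n%:R)); last by rewrite lerDr.
      by apply: ler_powR => //; exact: ltW.
  rewrite ge0_integralD//.
  - by rewrite -!/(gint _ _) gint11 lte_add_pinfty ?ltry// gint_nat.
  - by move=> x _; rewrite lee_fin gamma_ker_ge0.
  - by apply/measurable_EFinP; exact: measurable_gamma_ker.
  - by move=> x _; rewrite lee_fin gamma_ker_ge0.
  - by apply/measurable_EFinP; exact: measurable_gamma_ker.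
move: H; rewrite gint_rec//; have := gint_ge0 a 1.
by case: (gint a 1) => [r||] H H'; first [exact: ltry | move: H'; rewrite mulry gtr0_sg// mul1e ltxx | by []].
Qed.

(** A vanishing integral would place the interval [1, 2] inside a null set. *)
Lemma integral_pos_gt0 (f : R -> R) : meas R f ->
  (forall x, 0 <= f x) -> (forall x, 0 < x -> 0 < f x) -> (0 < \int[leb]_x (f x)%:E)%E.
Proof.
move=> mf f0 fp; rewrite lt0e integral_ge0 ?andbT; last by move=> x _; rewrite lee_fin.
apply/eqP => H.
have mEf : meas R (EFin \o f) by exact/measurable_EFinP.
have : (\int[leb]_x `|(EFin \o f) x| = 0)%E.
  by under eq_integral do rewrite /= ger0_norm//.
move=> Habs; have [N [mN N0 sN]] := (ae_eq_integral_abs leb measurableT mEf).1 Habs.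
have : (leb `[1%R, 2%R] <= leb N)%E.
  apply: le_measure; rewrite ?inE//.
  move=> x /=; rewrite in_itv/= => /andP[x1 _]; apply: sN => /=.
  move=> /(_ I) [] fx; have := fp x (lt_le_trans ltr01 x1).
  by rewrite fx ltxx.
rewrite N0 lebesgue_measure_itv/= lte_fin ltr1n/= -EFinB lee_fin; lra.
Qed.

Lemma gint_gt0 a s : (0 < gint a s)%E.
Proof.
apply: integral_pos_gt0; [exact: measurable_gamma_ker|exact: gamma_ker_ge0|].
by move=> x x0; rewrite /gamma_ker x0 mulr_gt0 ?powR_gt0 ?expR_gt0.
Qed.

(** Serves in place of [Gamma], which occurs in the density only inside a normalising constant and
    never has to be identified with it. *)
Definition Gam a : R := fine (gint a 1).

Lemma Gam_gt0 a : 0 < a -> 0 < Gam a.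
Proof. by move=> a0; rewrite /Gam fine_gt0// gint_gt0 gint_lty. Qed.

Lemma GamS a : 0 < a -> Gam (a + 1) = a * Gam a.
Proof.
by move=> a0; rewrite /Gam gint_rec// fineM// ge0_fin_numE ?gint_ge0// gint_lty.
Qed.

Lemma Gam_nat n : Gam n.+1%:R = n`!%:R.
Proof.
elim: n => [|n IH]; first by rewrite /Gam gint11.
by rewrite -[n.+2]addn1 natrD GamS ?ltr0n// IH factS natrM.
Qed.

Lemma gintE a s : 0 < a -> 0 < s -> gint a s = (s `^ (- a) * Gam a)%:E.
Proof.
move=> a0 s0; rewrite gint_scale// EFinM /Gam fineK//.
by rewrite ge0_fin_numE ?gint_ge0// gint_lty.
Qed.

End gamma_integral.

(** * Moment bounds from generating functions, and moments of products *)

Section moments.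
Context {R : realType} d (T : measurableType d) (P : probability T R).
Variables (X : T -> R) (mX : meas T X).

(** With s = (X - 1)/e, s^(2n) <= (2n)! e^|s| <= (2n)! (e^s + e^(-s)): two exponential moments bound
    every even moment at the scale e. *)
Lemma even_moment_mgf (e B : R) (n : nat) : 0 < e ->
  (\int[P]_w (expR ((X w - 1) / e))%:E <= B%:E)%E ->
  (\int[P]_w (expR (- ((X w - 1) / e)))%:E <= B%:E)%E ->
  (\int[P]_w ((X w - 1) ^+ (2 * n))%:E <= ((2 * n)`!%:R * (2 * B) * e ^+ (2 * n))%:E)%E.
Proof.
move=> e0 H1 H2.
have ms : meas T (fun w => (X w - 1) / e) by apply: measurable_funM => //; exact: measurable_funB.
have m1 : meas T (fun w => (expR ((X w - 1) / e))%:E).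
  by apply/measurable_EFinP; apply: (measurableT_comp (@measurable_expR R)).
have m2 : meas T (fun w => (expR (- ((X w - 1) / e)))%:E).
  by apply/measurable_EFinP; apply: (measurableT_comp (@measurable_expR R)); exact: measurableT_comp.
apply: (@le_trans _ _ (\int[P]_w (((2 * n)`!%:R * e ^+ (2 * n))%:E *
    ((expR ((X w - 1) / e))%:E + (expR (- ((X w - 1) / e)))%:E)))%E).
  apply: ge0_le_integral => //.
  - by move=> w _; rewrite lee_fin exprM exprn_ge0// sqr_ge0.
  - by apply/measurable_EFinP; apply: measurable_funX; exact: measurable_funB.
  - by apply: measurable_funeM; exact: emeasurable_funD.
  - move=> w _; rewrite -EFinD -EFinM lee_fin.
    set s := (X w - 1) / e.
    have -> : (X w - 1) ^+ (2 * n) = s ^+ (2 * n) * e ^+ (2 * n).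
      by rewrite -exprMn /s divfK// gt_eqF.
    rewrite [leRHS](_ : _ = (2 * n)`!%:R * (expR s + expR (- s)) * e ^+ (2 * n)); last by ring.
    rewrite ler_wpM2r ?exprn_ge0 ?(ltW e0)//.
    rewrite mulrC -ler_pdivrMr ?ltr0n ?fact_gt0//.
    have -> : s ^+ (2 * n) = `|s| ^+ (2 * n) by rewrite !exprM real_normK ?num_real.
    apply: (@le_trans _ _ (expR `|s|)).
      case: (2 * n)%N => [|k]; first by rewrite expr0 divr1 -[leLHS]expR0 ler_expR.
      by apply: le_trans (expR_ge1Dxn k (normr_ge0 s)); rewrite lerDr.
    by have [s0|s0] := leP 0 s; [rewrite (ger0_norm s0) lerDl|rewrite (ltr0_norm s0) lerDr]; exact: expR_ge0.
rewrite ge0_integralZl_EFin//; last 3 first.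
- by move=> w _; rewrite adde_ge0// lee_fin expR_ge0.
- exact: emeasurable_funD.
- by rewrite mulr_ge0 ?exprn_ge0// ltW.
rewrite ge0_integralD//.
rewrite [leRHS](_ : _ = ((2 * n)`!%:R * e ^+ (2 * n))%:E * (B%:E + B%:E))%E; last first.
  by rewrite -EFinD -EFinM; congr (_%:E); ring.
by rewrite lee_wpmul2l ?lee_fin ?mulr_ge0 ?exprn_ge0 ?(ltW e0)// leeD.
Qed.

Hypothesis X0 : forall w, 0 < X w.

(** Here 1/a is the order of the variance, and u a is plus or minus sqrt a, an inverse standard
    deviation. The slack in 1/a <= e^2 lets factors of different variances share one scale e. *)
Lemma even_moment_of_mgf (a B e : R) (n : nat) : 0 < a -> 0 <= B -> 0 < e -> a^-1 <= e ^+ 2 ->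
  (forall u, `|u| = (Num.sqrt a)^-1 -> (\int[P]_w (expR (u * a * (X w - 1)))%:E <= B%:E)%E) ->
  (\int[P]_w ((X w - 1) ^+ (2 * n))%:E <= ((2 * n)`!%:R * (2 * B) * e ^+ (2 * n))%:E)%E.
Proof.
move=> a0 B0 e0 ae H.
have sa : 0 < Num.sqrt a by rewrite sqrtr_gt0.
have us : (Num.sqrt a)^-1 * a = Num.sqrt a.
  by rewrite -[X in _ * X](sqr_sqrtr (ltW a0)) expr2 mulKf// gt_eqF.
apply: (@le_trans _ _ ((2 * n)`!%:R * (2 * B) * (Num.sqrt a)^-1 ^+ (2 * n))%:E); last first.
  rewrite lee_fin ler_wpM2l ?mulr_ge0// !exprM lerXn2r ?nnegrE ?exprn_ge0 ?invr_ge0 ?sqrtr_ge0 ?(ltW e0)//.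
  by rewrite exprVn sqr_sqrtr// ltW.
apply: even_moment_mgf; first by rewrite invr_gt0.
- have := H (Num.sqrt a)^-1; rewrite ger0_norm ?invr_ge0 ?sqrtr_ge0// us => /(_ erefl).
  by under eq_integral do rewrite mulrC -[X in _ * X]invrK.
- have := H (- (Num.sqrt a)^-1); rewrite normrN ger0_norm ?invr_ge0 ?sqrtr_ge0// mulNr us => /(_ erefl).
  by under eq_integral do rewrite mulNr mulrC -[X in _ * X]invrK.
Qed.

Lemma central_from_raw (M1 M2 M3 M4 : R) :
  (\int[P]_w (X w)%:E = M1%:E)%E -> (\int[P]_w (X w ^+ 2)%:E = M2%:E)%E ->
  (\int[P]_w (X w ^+ 3)%:E = M3%:E)%E -> (\int[P]_w (X w ^+ 4)%:E = M4%:E)%E ->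
  [/\ \int[P]_w (X w - 1) = M1 - 1,
      \int[P]_w (X w - 1) ^+ 2 = M2 - 2 * M1 + 1,
      \int[P]_w (X w - 1) ^+ 3 = M3 - 3 * M2 + 3 * M1 - 1 &
      \int[P]_w (X w - 1) ^+ 4 = M4 - 4 * M3 + 6 * M2 - 4 * M1 + 1].
Proof.
move=> H1 H2 H3 H4.
have I k (M : R) : (\int[P]_w (X w ^+ k)%:E = M%:E)%E -> intg P (fun w => X w ^+ k).
  move=> H; apply: (@integrable_ge0_bound _ _ _ _ _ M); first exact: measurable_funX.
    by move=> w; rewrite exprn_ge0// ltW.
  by rewrite H.
have i1 := I 1%N _ H1; have i2 := I _ _ H2; have i3 := I _ _ H3; have i4 := I _ _ H4.
have E1 : \int[P]_w X w ^+ 1 = M1 by rewrite /Rintegral (H1 : _ = _).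
have E2 : \int[P]_w X w ^+ 2 = M2 by rewrite /Rintegral H2.
have E3 : \int[P]_w X w ^+ 3 = M3 by rewrite /Rintegral H3.
have E4 : \int[P]_w X w ^+ 4 = M4 by rewrite /Rintegral H4.
pose lin (a0 a1 a2 a3 a4 : R) := fun w => a0 + a1 * X w ^+ 1 + a2 * X w ^+ 2 + a3 * X w ^+ 3 + a4 * X w ^+ 4.
have L a0 a1 a2 a3 a4 : \int[P]_w lin a0 a1 a2 a3 a4 w = a0 + a1 * M1 + a2 * M2 + a3 * M3 + a4 * M4.
  have j1 := intZ a1 i1; have j2 := intZ a2 i2; have j3 := intZ a3 i3; have j4 := intZ a4 i4.
  have k1 := intD (int_cst P a0) j1; have k2 := intD k1 j2; have k3 := intD k2 j3.
  rewrite /lin RintegralD// RintegralD// RintegralD// RintegralD//; last exact: int_cst.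
  by rewrite RintegralZl// RintegralZl// RintegralZl// RintegralZl// Rintegral_cst1 E1 E2 E3 E4.
split.
- rewrite (_ : (fun w => X w - 1) = lin (-1) 1 0 0 0) ?L; last by apply/funext => w; rewrite /lin; ring.
  ring.
- rewrite (_ : (fun w => (X w - 1) ^+ 2) = lin 1 (-2) 1 0 0) ?L; last by apply/funext => w; rewrite /lin; ring.
  ring.
- rewrite (_ : (fun w => (X w - 1) ^+ 3) = lin (-1) 3 (-3) 1 0) ?L; last by apply/funext => w; rewrite /lin; ring.
  ring.
- rewrite (_ : (fun w => (X w - 1) ^+ 4) = lin 1 (-4) 6 (-4) 1) ?L; last by apply/funext => w; rewrite /lin; ring.
  ring.
Qed.

End moments.

Section product_moments.
Context {R : realType} (mu nu : probability R R).

Lemma product_tonelli (f g : R -> R) :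
  meas R f -> meas R g ->
  (forall x, 0 <= f x) -> (forall x, 0 <= g x) ->
  (\int[(mu \x nu)%E]_p (f p.1 * g p.2)%:E = (\int[mu]_x (f x)%:E) * \int[nu]_y (g y)%:E)%E.
Proof.
move=> mf mg f0 g0.
rewrite fubini_tonelli1//=; last 2 first.
- by apply/measurable_EFinP; apply: measurable_funM; [exact: (measurableT_comp mf)|exact: (measurableT_comp mg)].
- by move=> p; rewrite lee_fin mulr_ge0.
rewrite -ge0_integralZr//; last 3 first.
- exact/measurable_EFinP.
- by move=> x _; rewrite lee_fin.
- by apply: integral_ge0 => y _; rewrite lee_fin.
apply: eq_integral => x _; rewrite -ge0_integralZl_EFin//.
- by move=> y _; rewrite lee_fin.
- exact/measurable_EFinP.
Qed.

Lemma product_integrable (f g : R -> R) : intg mu f -> intg nu g ->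
  intg (mu \x nu)%E (fun p => f p.1 * g p.2) /\
  \int[(mu \x nu)%E]_p (f p.1 * g p.2) = (\int[mu]_x f x) * \int[nu]_y g y.
Proof.
move=> fi gi; have mf := int_measurable fi; have mg := int_measurable gi.
have mfg : meas (R * R) (fun p => f p.1 * g p.2).
  by apply: measurable_funM; [exact: (measurableT_comp mf)|exact: (measurableT_comp mg)].
have ifg : intg (mu \x nu)%E (fun p => f p.1 * g p.2).
  apply/integrableP; split; first exact/measurable_EFinP.
  under eq_integral do rewrite /= normrM.
  rewrite (@product_tonelli (fun x => `|f x|) (fun y => `|g y|))//; last 2 first.
  - exact: measurableT_comp.
  - exact: measurableT_comp.
  by apply: lte_mul_pinfty; [exact: integral_ge0|exact: (integrable_fin_num _ (integrable_norm fi))|case/integrableP : gi].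
split=> //.
rewrite /Rintegral -(integral12_prod_meas1 ifg).
rewrite (_ : fubini_F _ _ = fun x => ((\int[nu]_y g y)%:E * (f x)%:E)%E); last first.
  apply/funext => x; rewrite /fubini_F/= /Rintegral fineK; last exact: integrable_fin_num.
  transitivity (\int[nu]_y ((f x)%:E * (g y)%:E))%E; first by apply: eq_integral => y _; rewrite -EFinM.
  by rewrite (integralZl measurableT gi)// muleC.
rewrite (integralZl measurableT fi)// fineM//; last exact: integrable_fin_num.
by rewrite mulrC.
Qed.

Variables (V W : R -> R) (mV : meas R V) (mW : meas R W).
Hypotheses (V0 : forall x, 0 < V x) (W0 : forall x, 0 < W x).

Lemma product_powR (q : R) :
  (\int[(mu \x nu)%E]_p ((V p.1 * W p.2) `^ q)%:E =
   (\int[mu]_x (V x `^ q)%:E) * \int[nu]_y (W y `^ q)%:E)%E.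
Proof.
rewrite -product_tonelli//.
- by apply: eq_integral => p _; rewrite powRM// ltW.
- exact: (measurableT_comp (measurable_powR q)).
- exact: (measurableT_comp (measurable_powR q)).
- by move=> x; exact: powR_ge0.
- by move=> x; exact: powR_ge0.
Qed.

Lemma product_expr (k : nat) :
  (\int[(mu \x nu)%E]_p ((V p.1 * W p.2) ^+ k)%:E =
   (\int[mu]_x (V x ^+ k)%:E) * \int[nu]_y (W y ^+ k)%:E)%E.
Proof.
rewrite -product_tonelli//.
- by apply: eq_integral => p _; rewrite exprMn.
- exact: measurable_funX.
- exact: measurable_funX.
- by move=> x; rewrite exprn_ge0// ltW.
- by move=> x; rewrite exprn_ge0// ltW.
Qed.

(** V W - 1 = (V - 1) + (W - 1) + (V - 1)(W - 1), and an even power of three summands is at most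
    3^(2n) times the sum of their powers. The surplus e^(2n) of the last summand is absorbed by e <=
    1. *)
Lemma product_even_moment (n : nat) (e C D : R) : 0 < e <= 1 -> 0 <= C -> 0 <= D ->
  (\int[mu]_x ((V x - 1) ^+ (2 * n))%:E <= (C * e ^+ (2 * n))%:E)%E ->
  (\int[nu]_x ((W x - 1) ^+ (2 * n))%:E <= (D * e ^+ (2 * n))%:E)%E ->
  (\int[(mu \x nu)%E]_p ((V p.1 * W p.2 - 1) ^+ (2 * n))%:E <=
    (3 ^+ (2 * n) * (C + D + C * D) * e ^+ (2 * n))%:E)%E.
Proof.
move=> /andP[e0 e1] C0 D0 HC HD.
pose f x := (V x - 1) ^+ (2 * n); pose g x := (W x - 1) ^+ (2 * n).
have f0 x : 0 <= f x by rewrite /f exprM exprn_ge0// sqr_ge0.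
have g0 x : 0 <= g x by rewrite /g exprM exprn_ge0// sqr_ge0.
have mf : meas R f by apply: measurable_funX; exact: measurable_funB.
have mg : meas R g by apply: measurable_funX; exact: measurable_funB.
have ev (z : R) : z ^+ (2 * n) = `|z| ^+ (2 * n) by rewrite !exprM real_normK ?num_real.
have bound (a b : R) : (a + b + a * b) ^+ (2 * n) <=
    3 ^+ (2 * n) * (a ^+ (2 * n) * 1 + 1 * b ^+ (2 * n) + a ^+ (2 * n) * b ^+ (2 * n)).
  rewrite -exprMn mulr1 mul1r (ev (a + b + a * b)) (ev a) (ev b) (ev (a * b)).
  pose M := Num.max (Num.max `|a| `|b|) `|a * b|.
  have aM : `|a| <= M by rewrite /M !le_max lexx.
  have bM : `|b| <= M by rewrite /M !le_max lexx !orbT.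
  have cM : `|a * b| <= M by rewrite /M !le_max lexx !orbT.
  apply: (@le_trans _ _ ((3 * M) ^+ (2 * n))).
    apply: lerXn2r; rewrite ?nnegrE//; first by rewrite mulr_ge0// (le_trans _ aM).
    apply: (le_trans (ler_normD _ _)); apply: (le_trans (lerD (ler_normD _ _) (lexx _))).
    lra.
  rewrite exprMn ler_wpM2l ?exprn_ge0// /M.
  have p0 (z : R) : 0 <= `|z| ^+ (2 * n) by rewrite exprn_ge0.
  have := p0 a; have := p0 b; have := p0 (a * b).
  by rewrite /Num.max; case: ifP => _; [|case: ifP => _]; lra.
have fi : intg mu f by exact: integrable_ge0_bound HC.
have gi : intg nu g by exact: integrable_ge0_bound HD.
have [i1 E1] := product_integrable fi (int_cst nu 1).
have [i2 E2] := product_integrable (int_cst mu 1) gi.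
have [i3 E3] := product_integrable fi gi.
have i12 := intD i1 i2; have i123 := intD i12 i3.
pose F p := 3 ^+ (2 * n) * (f p.1 * 1 + 1 * g p.2 + f p.1 * g p.2).
have iF : intg (mu \x nu)%E F by exact: intZ.
apply: (@le_trans _ _ (\int[(mu \x nu)%E]_p (F p)%:E)%E).
  apply: ge0_le_integral => //.
  - by move=> p _; rewrite lee_fin exprM exprn_ge0// sqr_ge0.
  - apply/measurable_EFinP; apply: measurable_funX; apply: measurable_funB => //.
    by apply: measurable_funM; [exact: (measurableT_comp mV)|exact: (measurableT_comp mW)].
  - by case/integrableP : iF.
  - move=> [x y] _ /=; rewrite lee_fin; apply: le_trans (bound _ _).
    by rewrite (_ : V x * W y - 1 = V x - 1 + (W y - 1) + (V x - 1) * (W y - 1)); [|ring].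
rewrite EFin_Rintegral// lee_fin RintegralZl// RintegralD// RintegralD// E1 E2 E3 !Rintegral_cst1 mulr1 mul1r.
have A1 := Rintegral_le_bound fi HC; have B1 := Rintegral_le_bound gi HD.
have e2n : 0 <= e ^+ (2 * n) by rewrite exprn_ge0// ltW.
have e2n1 : e ^+ (2 * n) <= 1 by rewrite exprn_ile1// ltW.
rewrite -[leRHS]mulrA ler_wpM2l ?exprn_ge0// !mulrDl !lerD//.
apply: (@le_trans _ _ (C * e ^+ (2 * n) * (D * e ^+ (2 * n)))).
  by apply: ler_pM => //; apply: Rintegral_ge0.
rewrite [leLHS](_ : _ = C * D * e ^+ (2 * n) * e ^+ (2 * n)); last by ring.
by rewrite ler_piMr// !mulr_ge0.
Qed.

End product_moments.

Section gamma_law.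
Context {R : realType} (a s : R) (a0 : 0 < a) (s0 : 0 < s).

Definition gamma_pdf x : R := s `^ a / Gam a * gamma_ker a s x.

Lemma gamma_pdf_ge0 x : 0 <= gamma_pdf x.
Proof. by rewrite mulr_ge0 ?gamma_ker_ge0// divr_ge0 ?powR_ge0// ltW// Gam_gt0. Qed.

Lemma measurable_gamma_pdf : meas R gamma_pdf.
Proof. by apply: measurable_funM => //; exact: measurable_gamma_ker. Qed.

Lemma gamma_pdf_le0 x : x <= 0 -> gamma_pdf x = 0.
Proof. by move=> x0; rewrite /gamma_pdf /gamma_ker ltNge x0 mulr0. Qed.

Let cst_ge0 : 0 <= s `^ a / Gam a.
Proof. by rewrite divr_ge0 ?powR_ge0// ltW// Gam_gt0. Qed.

Lemma integral_gamma_pdf : (\int[leb]_x (gamma_pdf x)%:E = 1)%E.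
Proof.
under eq_integral do rewrite EFinM.
rewrite ge0_integralZl_EFin//; last 2 first.
- by move=> x _; rewrite lee_fin gamma_ker_ge0.
- by apply/measurable_EFinP; exact: measurable_gamma_ker.
rewrite -/(gint a s) gintE// -EFinM powRN; congr (_%:E); field.
by rewrite !gt_eqF ?powR_gt0 ?Gam_gt0.
Qed.

(** Shape [a] and rate [s]. The rate is left free so that a plain product can have the Gamma-Gamma
    density; [unit_gamma] divides by the mean a/s. *)
Definition gamma_law := density_prob measurable_gamma_pdf gamma_pdf_ge0 integral_gamma_pdf.

Definition unit_gamma (x : R) : R := s / a * posn x.

Lemma unit_gamma_gt0 x : 0 < unit_gamma x.
Proof. by rewrite mulr_gt0 ?posn_gt0// divr_gt0. Qed.

Lemma measurable_unit_gamma : meas R unit_gamma.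
Proof. by apply: measurable_funM => //; exact: measurable_posn. Qed.

Lemma gamma_law_powR q : 0 < a + q ->
  (\int[gamma_law]_x (unit_gamma x `^ q)%:E = (a `^ (- q) * Gam (a + q) / Gam a)%:E)%E.
Proof.
move=> aq.
rewrite ge0_integral_density; last 2 first.
- by apply/measurable_EFinP; apply: (measurableT_comp (measurable_powR q)); exact: measurable_unit_gamma.
- by move=> x; rewrite lee_fin powR_ge0.
transitivity (\int[leb]_x (((s / a) `^ q * (s `^ a / Gam a))%:E * (gamma_ker (a + q) s x)%:E))%E.
  apply: eq_integral => x _; rewrite -!EFinM; congr (_%:E).
  rewrite /gamma_pdf /gamma_ker; case: ifPn => x0; last by rewrite !mulr0.
  rewrite /unit_gamma posnE// powRM ?(ltW x0) ?divr_ge0 ?(ltW s0) ?(ltW a0)//.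
  rewrite (_ : a + q - 1 = q + (a - 1)); last by ring.
  rewrite [x `^ (q + _)]powRD ?(gt_eqF x0) ?implybT//; ring.
rewrite ge0_integralZl_EFin//; last 3 first.
- by move=> x _; rewrite lee_fin gamma_ker_ge0.
- by apply/measurable_EFinP; exact: measurable_gamma_ker.
- by rewrite mulr_ge0// powR_ge0.
rewrite -/(gint (a + q) s) gintE// -EFinM; congr (_%:E).
rewrite powRM ?invr_ge0 ?(ltW s0) ?(ltW a0)// -[a^-1]powR_inv1 ?(ltW a0)// -powRrM mulN1r.
rewrite opprD [s `^ (_ + _)]powRD ?(gt_eqF s0) ?implybT// !powRN; field.
by rewrite !gt_eqF ?powR_gt0 ?Gam_gt0.
Qed.

Lemma gamma_law_expr k :
  (\int[gamma_law]_x (unit_gamma x ^+ k)%:E = (\prod_(i < k) (1 + i%:R / a))%:E)%E.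
Proof.
have -> : (\int[gamma_law]_x (unit_gamma x ^+ k)%:E = \int[gamma_law]_x (unit_gamma x `^ k%:R)%:E)%E.
  by apply: eq_integral => x _; rewrite powR_mulrn// ltW// unit_gamma_gt0.
rewrite gamma_law_powR ?ltr_wpDr ?ler0n//; congr (_%:E).
elim: k => [|k IH].
  by rewrite big_ord0 addr0 oppr0 powRr0 mul1r divff// gt_eqF// Gam_gt0.
rewrite big_ord_recr/= -IH -natr1 addrA GamS ?ltr_wpDr ?ler0n//.
rewrite opprD [a `^ (_ - 1)]powRD ?(gt_eqF a0) ?implybT// powR_inv1 ?(ltW a0)//.
by field; rewrite !gt_eqF ?Gam_gt0.
Qed.

Lemma gamma_law_mgf t : t < a ->
  (\int[gamma_law]_x (expR (t * unit_gamma x))%:E = ((1 - t / a) `^ (- a))%:E)%E.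
Proof.
move=> ta; have u0 : 0 < 1 - t / a by rewrite subr_gt0 ltr_pdivrMr// mul1r.
rewrite ge0_integral_density; last 2 first.
- apply/measurable_EFinP; apply: (measurableT_comp (@measurable_expR R)); apply: measurable_funM => //.
  exact: measurable_unit_gamma.
- by move=> x; rewrite lee_fin expR_ge0.
transitivity (\int[leb]_x ((s `^ a / Gam a)%:E * (gamma_ker a (s * (1 - t / a)) x)%:E))%E.
  apply: eq_integral => x _; rewrite -!EFinM; congr (_%:E).
  rewrite /gamma_pdf /gamma_ker; case: ifPn => x0; last by rewrite !mulr0.
  rewrite /unit_gamma posnE//.
  rewrite (_ : - (s * (1 - t / a) * x) = t * (s / a * x) + - (s * x)); last by field; rewrite gt_eqF.
  by rewrite expRD; ring.
rewrite ge0_integralZl_EFin//; last 2 first.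
- by move=> x _; rewrite lee_fin gamma_ker_ge0.
- by apply/measurable_EFinP; exact: measurable_gamma_ker.
rewrite -/(gint a _) gintE ?mulr_gt0// -EFinM; congr (_%:E).
rewrite powRM ?(ltW s0) ?(ltW u0)// [s `^ (- a)]powRN; field.
by rewrite !gt_eqF ?powR_gt0 ?Gam_gt0.
Qed.

(** Since |u| <= 1/2, (1 - u)(1 + u + 2 u^2) = 1 + u^2 (1 - 2u) >= 1, whence 1 - u >= exp(-u - 2
    u^2). The left side is then at most exp(2 u^2 a) = e^2. *)
Lemma gamma_mgf_bound (u : R) : `|u| = (Num.sqrt a)^-1 -> 4 <= a ->
  expR (- (u * a)) * (1 - u) `^ (- a) <= expR 2.
Proof.
move=> ua a4.
have sa : 0 < Num.sqrt a by rewrite sqrtr_gt0.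
have sa2 : 2 <= Num.sqrt a.
  by rewrite -(@ler_pXn2r _ 2)// ?nnegrE ?ler0n ?sqrtr_ge0// sqr_sqrtr ?(ltW a0)//; lra.
have u12 : `|u| <= 2^-1 by rewrite ua lef_pV2 ?posrE.
move: u12; rewrite ler_norml => /andP[u1 u2].
have ua2 : u ^+ 2 * a = 1.
  by rewrite -[u ^+ 2]real_normK ?num_real// ua exprVn sqr_sqrtr ?(ltW a0)// mulVf// gt_eqF.
have u0 : 0 < 1 - u by lra.
have w1 : 0 < 1 + (u + 2 * u ^+ 2) by have := sqr_ge0 u; nra.
have key : expR (- (u + 2 * u ^+ 2)) <= 1 - u.
  apply: (@le_trans _ _ (1 + (u + 2 * u ^+ 2))^-1).
    rewrite expRN lef_pV2 ?posrE ?expR_gt0//; exact: expR_ge1Dx.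
  rewrite -[leLHS]mul1r ler_pdivrMr//.
  have := sqr_ge0 u; rewrite (_ : (1 - u) * _ = 1 + u ^+ 2 * (1 - 2 * u)); last by ring.
  by move=> ?; rewrite lerDl mulr_ge0//; lra.
have pw : (1 - u) `^ (- a) <= expR ((u + 2 * u ^+ 2) * a).
  rewrite powRN -[leRHS]invrK -expRN lef_pV2 ?posrE ?powR_gt0 ?expR_gt0//.
  rewrite -mulNr expRM.
  by apply: ge0_ler_powR => //; rewrite ?nnegrE ?expR_ge0 ?(ltW u0) ?(ltW a0).
apply: (le_trans (ler_wpM2l (expR_ge0 _) pw)).
by rewrite -expRD ler_expR mulrDl -mulrA ua2; lra.
Qed.

Lemma gamma_even_moment n e : 4 <= a -> 0 < e -> a^-1 <= e ^+ 2 ->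
  (\int[gamma_law]_x ((unit_gamma x - 1) ^+ (2 * n))%:E <=
    ((2 * n)`!%:R * (2 * expR 2) * e ^+ (2 * n))%:E)%E.
Proof.
move=> a4 e0 ae.
have sa : 0 < Num.sqrt a by rewrite sqrtr_gt0.
have sa2 : 2 <= Num.sqrt a.
  by rewrite -(@ler_pXn2r _ 2)// ?nnegrE ?ler0n ?sqrtr_ge0// sqr_sqrtr ?(ltW a0)//; lra.
have mE t : meas R (fun x => (expR (t * unit_gamma x))%:E).
  apply/measurable_EFinP; apply: (measurableT_comp (@measurable_expR R)); apply: measurable_funM => //.
  exact: measurable_unit_gamma.
have H u : `|u| = (Num.sqrt a)^-1 ->
    (\int[gamma_law]_x (expR (u * a * (unit_gamma x - 1)))%:E <= (expR 2)%:E)%E.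
  move=> ua.
  rewrite (_ : integral _ _ _ = \int[gamma_law]_x ((expR (- (u * a)))%:E * (expR (u * a * unit_gamma x))%:E))%E; last first.
    by apply: eq_integral => x _; rewrite -EFinM -expRD; congr ((expR _)%:E); ring.
  rewrite ge0_integralZl_EFin ?expR_ge0//.
  rewrite gamma_law_mgf.
    by rewrite -EFinM lee_fin mulfK ?gt_eqF// gamma_mgf_bound.
  apply: (le_lt_trans (ler_norm _)); rewrite normrM ua gtr0_norm//.
  by rewrite ltr_pdivrMl// ltr_pMl//; lra.
have mU : meas R unit_gamma by exact: measurable_unit_gamma.
exact: (even_moment_of_mgf mU n a0 (expR_ge0 2) e0 ae H).
Qed.

(** Each factor of Gamma(a) = (a - 1)...(a - n) Gamma(a - n) is at least a/2. Integer orders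
    suffice, because a Gamma factor has negative moments of any given order once its shape is
    large. *)
Lemma gamma_negative_moment n : 2 * n%:R <= a -> 0 < a - n%:R ->
  (\int[gamma_law]_x (unit_gamma x `^ (- n%:R))%:E <= (2 ^+ n)%:E)%E.
Proof.
move=> na an; rewrite gamma_law_powR// lee_fin opprK powR_mulrn ?(ltW a0)//.
rewrite ler_pdivrMr ?Gam_gt0//.
have H m : (m <= n)%N -> (a / 2) ^+ m * Gam (a - m%:R) <= Gam a.
  elim: m => [_|m IH mn]; first by rewrite mul1r subr0.
  apply: le_trans (IH (ltnW mn)).
  have mn' : m.+1%:R <= n%:R :> R by rewrite ler_nat.
  have am : 0 < a - m.+1%:R by lra.
  rewrite (_ : a - m%:R = a - m.+1%:R + 1); last by rewrite -natr1; ring.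
  rewrite GamS// exprS -mulrA mulrCA ler_wpM2l ?exprn_ge0 ?divr_ge0 ?(ltW a0)//.
  by rewrite ler_wpM2r ?(ltW (Gam_gt0 _))//; lra.
have := H n (leqnn n); rewrite expr_div_n.
rewrite mulrAC ler_pdivrMr ?exprn_gt0// => /le_trans; apply.
by rewrite mulrC.
Qed.

End gamma_law.

(** * The Rician factor *)

Section series.
Context {R : realType}.
Local Open Scope ereal_scope.

Lemma nneseries_S (f : nat -> R) : (forall k, (0 <= f k)%R) ->
  \sum_(k <oo) (f k)%:E = (f 0%N)%:E + \sum_(k <oo) (f k.+1)%:E.
Proof.
move=> f0; rewrite (@nneseries_recl _ xpredT (EFin \o f))//; last by move=> k _; rewrite lee_fin.
congr (_ + _); rewrite -(@nneseries_addn _ (EFin \o f) 1%N)//.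
by apply: eq_eseriesr => k _; rewrite addn1.
Qed.

Lemma EFin_lim_series (f : nat -> R) : cvgn (series f) ->
  \sum_(k <oo) (f k)%:E = (limn (series f))%:E.
Proof.
move=> cf; rewrite -EFin_lim//; apply/congr_lim/funext => n /=.
by rewrite /series/= sumEFin.
Qed.

Lemma expR_series (x : R) : \sum_(k <oo) (x ^+ k / k`!%:R)%:E = (expR x)%:E.
Proof. by rewrite /expR -EFin_lim_series//; exact: is_cvg_series_exp_coeff. Qed.

Lemma bessel_I0_series (w : R) : (0 <= w)%R ->
  \sum_(k <oo) (w ^+ k / k`!%:R ^+ 2)%:E = (bessel_I0 (2 * Num.sqrt w))%:E.
Proof.
move=> w0; rewrite /bessel_I0.
have -> : (fun k : nat => (2 * Num.sqrt w / 2) ^+ (2 * k) / k`!%:R ^+ 2)%R =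
    (fun k : nat => w ^+ k / k`!%:R ^+ 2)%R.
  apply/funext => k; rewrite [(2 * Num.sqrt w)%R]mulrC mulfK// exprM sqr_sqrtr//.
apply: EFin_lim_series.
have f1 k : (1 <= k`!%:R :> R)%R by rewrite (ler_nat R 1) fact_gt0.
have f0 k : (0 < k`!%:R :> R)%R by exact: lt_le_trans (f1 k).
apply: (@series_le_cvg _ _ (exp_coeff w)) => [k|k|k|].
- by rewrite divr_ge0 ?exprn_ge0.
- by rewrite divr_ge0 ?exprn_ge0.
- rewrite ler_wpM2l ?exprn_ge0// lef_pV2 ?posrE ?exprn_gt0//.
  by rewrite -[leLHS]expr1 ler_weXn2l.
- exact: is_cvg_series_exp_coeff.
Qed.

(** The falling factorial x (x - 1)...(x - i + 1), whose mean under a Poisson law of parameter r is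
    r^i: this is [falling_series]. *)
Fixpoint falling (i : nat) (x : R) : R :=
  if i is i'.+1 then (x * falling i' (x - 1))%R else 1%R.

Lemma falling_ge0 i k : (0 <= falling i k%:R)%R.
Proof.
elim: i k => [//|i IH] [|k] /=; first by rewrite mul0r.
by rewrite mulr_ge0// -natr1 addrK.
Qed.

Lemma falling_series i (r : R) : (0 <= r)%R ->
  \sum_(k <oo) (r ^+ k / k`!%:R * falling i k%:R)%:E = (r ^+ i * expR r)%:E.
Proof.
move=> r0; elim: i => [|i IH].
  by rewrite expr0 mul1r -expR_series; apply: eq_eseriesr => k _ /=; rewrite mulr1.
have p0 j k : (0 <= r ^+ k / k`!%:R * falling j k%:R)%R.
  by rewrite mulr_ge0 ?falling_ge0// divr_ge0 ?exprn_ge0.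
have F0 : falling i.+1 0%:R = 0%R :> R by rewrite /falling mul0r.
rewrite (@nneseries_S (fun k => r ^+ k / k`!%:R * falling i.+1 k%:R)%R)// F0 mulr0 add0e exprS -mulrA EFinM -IH.
rewrite -nneseriesZl; last by move=> k _; rewrite lee_fin.
apply: eq_eseriesr => k _; rewrite -EFinM; congr (_%:E).
rewrite /= -natr1 addrK exprS factS natrM -natr1; field.
by rewrite natr1 !pnatr_eq0 -lt0n fact_gt0.
Qed.

End series.

Section rician.
Context {R : realType} (r : R) (r0 : 0 < r).
Let s : R := 1 + r.
Let s0 : 0 < s. Proof. by rewrite addr_gt0. Qed.
Let c : R := (1 + r) * r.
Let c0 : 0 < c. Proof. by rewrite mulr_gt0. Qed.
Let cE : c = s * r. Proof. by []. Qed.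
Let f0 k : (0 : R) < k`!%:R. Proof. by rewrite ltr0n fact_gt0. Qed.

Definition rician_ker (y : R) : R :=
  if 0 < y then bessel_I0 (2 * Num.sqrt ((1 + r) * r * y)) * expR (- ((1 + r) * y)) else 0.

(** The series of I_0 exhibits the Rician law as a Poisson mixture of Gamma laws of integer shape:
    after normalisation the component of shape k + 1 has weight e^(-r) r^k/k!. Moments are then
    computed term by term. *)
Lemma rician_kerE y : (rician_ker y)%:E =
  (\sum_(k <oo) (c ^+ k / k`!%:R ^+ 2 * gamma_ker k.+1%:R s y)%:E)%E.
Proof.
rewrite /rician_ker; case: ifPn => y0; last first.
  by rewrite eseries0// => k _ _; rewrite /gamma_ker (negbTE y0) mulr0.
have cy : 0 <= c * y by rewrite mulr_ge0 ?(ltW c0) ?(ltW y0).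
rewrite mulrC EFinM -bessel_I0_series// -nneseriesZl; last first.
  by move=> k _; rewrite lee_fin divr_ge0 ?exprn_ge0// ltW.
apply: eq_eseriesr => k _; rewrite -EFinM; congr (_%:E).
by rewrite /gamma_ker y0 -natr1 addrK powR_mulrn ?(ltW y0)// exprMn -/s; ring.
Qed.

Let ck_ge0 k : 0 <= c ^+ k / k`!%:R ^+ 2.
Proof. by rewrite divr_ge0 ?exprn_ge0 ?(ltW c0) ?(ltW (f0 k)). Qed.

Lemma rician_ker_ge0 y : 0 <= rician_ker y.
Proof.
rewrite -lee_fin rician_kerE; apply: nneseries_ge0 => k _ _.
by rewrite lee_fin mulr_ge0 ?gamma_ker_ge0.
Qed.

(** Only the term k = 0 is kept; it does not vanish at 0, which is the source of the infinite moment
    of order -1. *)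
Lemma rician_ker_gt0 y : 0 < y -> expR (- (s * y)) <= rician_ker y.
Proof.
move=> y0; rewrite -lee_fin rician_kerE nneseries_S; last first.
  by move=> k; rewrite mulr_ge0 ?gamma_ker_ge0.
rewrite expr0 expr1n divr1 mul1r /gamma_ker y0 subrr powRr0 mul1r.
rewrite leeDl// nneseries_ge0// => k _ _.
by rewrite lee_fin mulr_ge0// mulr_ge0 ?powR_ge0 ?expR_ge0.
Qed.

Lemma measurable_rician_ker : meas R rician_ker.
Proof.
apply/measurable_EFinP.
rewrite (_ : EFin \o rician_ker = fun y => (\sum_(k <oo) (c ^+ k / k`!%:R ^+ 2 * gamma_ker k.+1%:R s y)%:E)%E); last first.
  by apply/funext => y; rewrite /= rician_kerE.
apply: ge0_emeasurable_sum.
- by move=> k y _ _; rewrite lee_fin mulr_ge0 ?gamma_ker_ge0.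
- by move=> k _; apply/measurable_EFinP; apply: measurable_funM => //; exact: measurable_gamma_ker.
Qed.

Lemma integral_rician_ker (w : R -> R) (I : nat -> \bar R) :
  meas R w -> (forall y, 0 <= w y) ->
  (forall k, (\int[leb]_y (w y * gamma_ker k.+1%:R s y)%:E = I k)%E) ->
  (\int[leb]_y (w y * rician_ker y)%:E = \sum_(k <oo) (c ^+ k / k`!%:R ^+ 2)%:E * I k)%E.
Proof.
move=> mw w0 HI.
transitivity (\int[leb]_y (\sum_(k <oo) (c ^+ k / k`!%:R ^+ 2 * (w y * gamma_ker k.+1%:R s y))%:E))%E.
  apply: eq_integral => y _; rewrite EFinM rician_kerE -nneseriesZl; last first.
    by move=> k _; rewrite lee_fin mulr_ge0 ?gamma_ker_ge0.
  by apply: eq_eseriesr => k _; rewrite -EFinM; congr (_%:E); ring.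
have mk k : meas R (fun y => w y * gamma_ker k.+1%:R s y).
  by apply: measurable_funM => //; exact: measurable_gamma_ker.
rewrite integral_nneseries//; last 2 first.
- move=> k; apply/measurable_EFinP; exact: (measurable_funM (measurable_cst _) (mk k)).
- by move=> k y _; rewrite lee_fin mulr_ge0// mulr_ge0// gamma_ker_ge0.
apply: eq_eseriesr => k _; rewrite -HI -ge0_integralZl_EFin//.
- by move=> y _; rewrite lee_fin mulr_ge0 ?gamma_ker_ge0.
- apply/measurable_EFinP; exact: mk.
Qed.

Lemma rician_ker_mgf t : t < s ->
  (\int[leb]_y (expR (t * y) * rician_ker y)%:E = ((s - t)^-1 * expR (c / (s - t)))%:E)%E.
Proof.
move=> ts; have st : 0 < s - t by rewrite subr_gt0.
rewrite (@integral_rician_ker _ (fun k => ((s - t)^-1 ^+ k.+1 * k`!%:R)%:E)); last 3 first.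
- by apply: (measurableT_comp (@measurable_expR R)); exact: measurable_funM.
- by move=> y; exact: expR_ge0.
- move=> k; transitivity (gint k.+1%:R (s - t)).
    apply: eq_integral => y _; congr (_%:E); rewrite /gamma_ker; case: ifP => _; last by rewrite mulr0.
    by rewrite mulrCA -expRD; congr (_ * expR _); ring.
  by rewrite gintE ?ltr0n// Gam_nat powRN powR_mulrn ?(ltW st)// exprVn.
rewrite EFinM -expR_series -nneseriesZl; last first.
  by move=> k _; rewrite lee_fin divr_ge0 ?exprn_ge0 ?divr_ge0// ltW.
apply: eq_eseriesr => k _; rewrite -!EFinM; congr (_%:E).
set u := (s - t)^-1; rewrite [(c * u) ^+ k]exprMn [u ^+ _]exprS; field.
by rewrite gt_eqF.
Qed.

Lemma falling_combination (p0 p1 p2 p3 p4 : R) :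
  0 <= p0 -> 0 <= p1 -> 0 <= p2 -> 0 <= p3 -> 0 <= p4 ->
  (\sum_(k <oo) (r ^+ k / k`!%:R * (p0 * falling 0 k%:R + p1 * falling 1 k%:R +
    p2 * falling 2 k%:R + p3 * falling 3 k%:R + p4 * falling 4 k%:R))%:E =
  (expR r * (p0 + p1 * r + p2 * r ^+ 2 + p3 * r ^+ 3 + p4 * r ^+ 4))%:E)%E.
Proof.
move=> h0 h1 h2 h3 h4.
pose u i k : R := r ^+ k / k`!%:R * falling i k%:R.
have u0 i k : 0 <= u i k by rewrite mulr_ge0 ?falling_ge0// divr_ge0 ?exprn_ge0 ?(ltW r0).
have us p i : 0 <= p -> (\sum_(k <oo) (p * u i k)%:E = (p * (r ^+ i * expR r))%:E)%E.
  move=> p0'; under eq_eseriesr do rewrite EFinM.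
  rewrite nneseriesZl; last by move=> k _; rewrite lee_fin.
  by rewrite falling_series ?(ltW r0).
transitivity (\sum_(k <oo) ((p0 * u 0%N k)%:E + ((p1 * u 1%N k)%:E + ((p2 * u 2%N k)%:E + ((p3 * u 3%N k)%:E + (p4 * u 4%N k)%:E)))))%E.
  by apply: eq_eseriesr => k _; rewrite -!EFinD; congr (_%:E); rewrite /u; ring.
have pu p i k : 0 <= p -> (0 <= (p * u i k)%:E)%E by move=> ?; rewrite lee_fin mulr_ge0.
rewrite nneseriesD; [|by move=> k _ _; exact: pu|by move=> k _ _; rewrite !adde_ge0 ?pu].
rewrite nneseriesD; [|by move=> k _ _; exact: pu|by move=> k _ _; rewrite !adde_ge0 ?pu].
rewrite nneseriesD; [|by move=> k _ _; exact: pu|by move=> k _ _; rewrite !adde_ge0 ?pu].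
rewrite nneseriesD; [|by move=> k _ _; exact: pu|by move=> k _ _; rewrite ?pu].
rewrite !us// -!EFinD; congr (_%:E); ring.
Qed.

(** Expanding (k + j)!/k! in falling factorials leaves factorial moments of a Poisson law. The
    coefficients are those of j! L_j(-r), with L_j the Laguerre polynomial. *)
Lemma rician_ker_expr j (p0 p1 p2 p3 p4 : R) :
  0 <= p0 -> 0 <= p1 -> 0 <= p2 -> 0 <= p3 -> 0 <= p4 ->
  (forall k : nat, (k + j)`!%:R = k`!%:R * (p0 * falling 0 k%:R + p1 * falling 1 k%:R +
    p2 * falling 2 k%:R + p3 * falling 3 k%:R + p4 * falling 4 k%:R)) ->
  (\int[leb]_y (y ^+ j * rician_ker y)%:E =
  (s^-1 ^+ j.+1 * (expR r * (p0 + p1 * r + p2 * r ^+ 2 + p3 * r ^+ 3 + p4 * r ^+ 4)))%:E)%E.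
Proof.
move=> h0 h1 h2 h3 h4 fE.
transitivity (\int[leb]_y ((if 0 < y then y ^+ j else 0) * rician_ker y)%:E)%E.
  by apply: eq_integral => y _; congr (_%:E); rewrite /rician_ker; case: ifP => //; rewrite !mulr0.
rewrite (@integral_rician_ker _ (fun k => (s^-1 ^+ (k + j).+1 * (k + j)`!%:R)%:E)); last 3 first.
- by apply: measurable_cutpos; exact: measurable_funX.
- by move=> y; case: ifP => // y0; rewrite exprn_ge0// ltW.
- move=> k; transitivity (gint (k + j).+1%:R s).
    apply: eq_integral => y _; congr (_%:E); rewrite /gamma_ker; case: ifP => y0; last by rewrite mulr0.
    by rewrite -!natr1 !addrK !powR_mulrn ?(ltW y0)// mulrA -exprD addnC.
  by rewrite gintE ?ltr0n// Gam_nat powRN powR_mulrn ?(ltW s0)// exprVn.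
rewrite EFinM -falling_combination// -nneseriesZl; last first.
  move=> k _; rewrite lee_fin mulr_ge0 ?divr_ge0 ?exprn_ge0 ?(ltW r0)//.
  by rewrite !addr_ge0// mulr_ge0// falling_ge0.
apply: eq_eseriesr => k _; rewrite -!EFinM; congr (_%:E).
rewrite fE; set q := (_ + _ + _ + _ + _).
have -> : s^-1 ^+ (k + j).+1 = (s ^+ k)^-1 * s^-1 ^+ j.+1 by rewrite -addnS exprD exprVn.
rewrite cE exprMn; set S := s ^+ k; set S' := s^-1 ^+ j.+1; field.
by rewrite !gt_eqF ?exprn_gt0.
Qed.

Lemma rician_ker_total : (\int[leb]_y (rician_ker y)%:E = (s^-1 * expR r)%:E)%E.
Proof.
have := @rician_ker_expr 0 1 0 0 0 0.
under eq_integral do rewrite expr0 mul1r.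
move=> -> //; last by move=> k; rewrite addn0 /=; ring.
by congr (_%:E); rewrite expr1; ring.
Qed.

Definition rician_pdf (y : R) : R := s * expR (- r) * rician_ker y.

Lemma rician_pdf_ge0 y : 0 <= rician_pdf y.
Proof. by rewrite mulr_ge0 ?rician_ker_ge0// mulr_ge0 ?expR_ge0// ltW. Qed.

Lemma measurable_rician_pdf : meas R rician_pdf.
Proof. by apply: measurable_funM => //; exact: measurable_rician_ker. Qed.

Lemma rician_pdf_le0 y : y <= 0 -> rician_pdf y = 0.
Proof. by move=> y0; rewrite /rician_pdf /rician_ker ltNge y0 mulr0. Qed.

Let nrm_ge0 : 0 <= s * expR (- r). Proof. by rewrite mulr_ge0 ?expR_ge0// ltW. Qed.

Lemma integral_rician_pdf : (\int[leb]_x (rician_pdf x)%:E = 1)%E.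
Proof.
under eq_integral do rewrite EFinM.
rewrite ge0_integralZl_EFin//; last 2 first.
- by move=> x _; rewrite lee_fin rician_ker_ge0.
- by apply/measurable_EFinP; exact: measurable_rician_ker.
rewrite rician_ker_total -EFinM; congr (_%:E).
by rewrite expRN; field; rewrite !gt_eqF ?expR_gt0.
Qed.

Definition rician_law := density_prob measurable_rician_pdf rician_pdf_ge0 integral_rician_pdf.

Lemma integral_rician_law (w : R -> R) : meas R w -> (forall y, 0 < y -> 0 <= w y) ->
  (\int[rician_law]_y (w (posn y))%:E = (s * expR (- r))%:E * \int[leb]_y (w y * rician_ker y)%:E)%E.
Proof.
move=> mw w0.
have wp y : 0 <= w (posn y) by apply: w0; exact: posn_gt0.
have mwp : meas R (fun y => w (posn y)) by exact: (measurableT_comp mw measurable_posn).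
have wk y : w (posn y) * rician_ker y = w y * rician_ker y.
  by rewrite /rician_ker; case: ifPn => y0; rewrite ?mulr0// posnE.
rewrite ge0_integral_density//; last exact/measurable_EFinP.
rewrite -ge0_integralZl_EFin//.
- by apply: eq_integral => y _; rewrite -!EFinM -wk /rician_pdf; congr (_%:E); ring.
- by move=> y _; rewrite lee_fin -wk mulr_ge0// rician_ker_ge0.
- by apply/measurable_EFinP; apply: measurable_funM => //; exact: measurable_rician_ker.
Qed.

Lemma rician_law_expr :
  [/\ (\int[rician_law]_y (posn y)%:E = 1%:E)%E,
      (\int[rician_law]_y (posn y ^+ 2)%:E = ((r ^+ 2 + 4 * r + 2) / s ^+ 2)%:E)%E,
      (\int[rician_law]_y (posn y ^+ 3)%:E = ((r ^+ 3 + 9 * r ^+ 2 + 18 * r + 6) / s ^+ 3)%:E)%E &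
      (\int[rician_law]_y (posn y ^+ 4)%:E =
        ((r ^+ 4 + 16 * r ^+ 3 + 72 * r ^+ 2 + 96 * r + 24) / s ^+ 4)%:E)%E].
Proof.
have E j p0 p1 p2 p3 p4 (Hf : forall k : nat, (k + j)`!%:R = k`!%:R * (p0 * falling 0 k%:R + p1 * falling 1 k%:R +
    p2 * falling 2 k%:R + p3 * falling 3 k%:R + p4 * falling 4 k%:R)) :
    0 <= p0 -> 0 <= p1 -> 0 <= p2 -> 0 <= p3 -> 0 <= p4 ->
    (\int[rician_law]_y (posn y ^+ j)%:E = ((p0 + p1 * r + p2 * r ^+ 2 + p3 * r ^+ 3 + p4 * r ^+ 4) / s ^+ j)%:E)%E.
  move=> h0 h1 h2 h3 h4.
  rewrite (@integral_rician_law (fun y => y ^+ j)); last 2 first.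
  - exact: measurable_funX.
  - by move=> y y0; rewrite exprn_ge0// ltW.
  rewrite (rician_ker_expr h0 h1 h2 h3 h4 Hf) -EFinM; congr (_%:E).
  rewrite exprS exprVn expRN; field.
  by rewrite !gt_eqF ?exprn_gt0 ?expR_gt0.
split.
- rewrite (@E 1%N 1 1 0 0 0)//; last by move=> k; rewrite addn1 factS natrM -natr1 /=; ring.
  by congr (_%:E); rewrite expr1 /s; field; rewrite gt_eqF.
- rewrite (@E 2%N 2 4 1 0 0)//; last by move=> k; rewrite !addnS addn0 !factS !natrM -!natr1 /=; ring.
  by congr (_%:E); ring.
- rewrite (@E 3%N 6 18 9 1 0)//; last by move=> k; rewrite !addnS addn0 !factS !natrM -!natr1 /=; ring.
  by congr (_%:E); ring.
- rewrite (@E 4%N 24 96 72 16 1)//; last by move=> k; rewrite !addnS addn0 !factS !natrM -!natr1 /=; ring.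
  by congr (_%:E); ring.
Qed.

End rician.

Section rician_bounds.
Context {R : realType} (r : R) (r0 : 0 < r).
Let s : R := 1 + r.
Let s0 : 0 < s. Proof. by rewrite addr_gt0. Qed.

Lemma rician_law_mgf t : t < 1 + r ->
  (\int[rician_law r0]_y (expR (t * posn y))%:E =
    ((1 + r) * expR (- r) * ((1 + r - t)^-1 * expR ((1 + r) * r / (1 + r - t))))%:E)%E.
Proof.
move=> ts; rewrite (@integral_rician_law _ _ r0 (fun y => expR (t * y))); last 2 first.
- by apply: (measurableT_comp (@measurable_expR R)); exact: measurable_funM.
- by move=> y _; exact: expR_ge0.
by rewrite rician_ker_mgf// -EFinM.
Qed.

(** At th (1 + r) with |th| = (1 + r)^(-1/2), the centred generating function is (1 - th)^-1 exp(r
    th^2/(1 - th) - th), at most 2 e^3 because r th^2 <= 1 and |th| <= 1/2. *)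
Lemma rician_even_moment n e : 4 <= 1 + r -> 0 < e -> (1 + r)^-1 <= e ^+ 2 ->
  (\int[rician_law r0]_x ((posn x - 1) ^+ (2 * n))%:E <=
    ((2 * n)`!%:R * (2 * (2 * expR 3)) * e ^+ (2 * n))%:E)%E.
Proof.
rewrite -/s => s4 e0 se.
have ss : 0 < Num.sqrt s by rewrite sqrtr_gt0.
have ss2 : 2 <= Num.sqrt s.
  by rewrite -(@ler_pXn2r _ 2)// ?nnegrE ?ler0n ?sqrtr_ge0// sqr_sqrtr ?(ltW s0)//; lra.
have H th : `|th| = (Num.sqrt s)^-1 ->
    (\int[rician_law r0]_x (expR (th * s * (posn x - 1)))%:E <= (2 * expR 3)%:E)%E.
  move=> tha.
  have th12 : `|th| <= 2^-1 by rewrite tha lef_pV2 ?posrE.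
  move: th12; rewrite ler_norml => /andP[th1 th2].
  have th2s : th ^+ 2 * s = 1.
    by rewrite -[th ^+ 2]real_normK ?num_real// tha exprVn sqr_sqrtr ?(ltW s0)// mulVf// gt_eqF.
  have u0 : 0 < 1 - th by lra.
  rewrite (_ : integral _ _ _ = \int[rician_law r0]_x ((expR (- (th * s)))%:E * (expR (th * s * posn x))%:E))%E; last first.
    by apply: eq_integral => x _; rewrite -EFinM -expRD; congr ((expR _)%:E); ring.
  have mE : meas R (fun x => (expR (th * s * posn x))%:E).
    apply/measurable_EFinP; apply: (measurableT_comp (@measurable_expR R)); apply: measurable_funM; [exact: measurable_cst|exact: measurable_posn].
  rewrite ge0_integralZl_EFin ?expR_ge0//.
  have sth : s - th * s = s * (1 - th) by ring.
  rewrite rician_law_mgf -/s; last by rewrite -subr_gt0 sth mulr_gt0.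
  rewrite sth -EFinM lee_fin.
  have -> : expR (- (th * s)) * (s * expR (- r) * ((s * (1 - th))^-1 * expR (s * r / (s * (1 - th))))) =
    (1 - th)^-1 * expR (r * th ^+ 2 / (1 - th) - th).
    have -> : r * th ^+ 2 / (1 - th) - th = - (th * s) + (- r + s * r / (s * (1 - th))).
      by rewrite /s; field; rewrite -/s !gt_eqF.
    by rewrite !expRD; field; rewrite !gt_eqF.
  apply: ler_pM; rewrite ?expR_ge0 ?invr_ge0 ?(ltW u0)//.
    by rewrite -[leRHS]invrK lef_pV2 ?posrE ?invr_gt0//; lra.
  rewrite ler_expR.
  have : r * th ^+ 2 / (1 - th) <= 2.
    rewrite ler_pdivrMr//; have : r * th ^+ 2 <= 1.
      by rewrite -th2s mulrC ler_wpM2l ?sqr_ge0// /s lerDr.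
    lra.
  lra.
have B0 : (0 : R) <= 2 * expR 3 by rewrite mulr_ge0 ?expR_ge0.
exact: (even_moment_of_mgf (@measurable_posn R) n s0 B0 e0 se H).
Qed.

Lemma expR_tail j : (\sum_(k <oo) (r ^+ (k + j) / (k + j)`!%:R)%:E <= (expR r)%:E)%E.
Proof.
have p0 k : 0 <= r ^+ k / k`!%:R by rewrite divr_ge0 ?exprn_ge0// ltW.
elim: j => [|j IH].
  by rewrite -expR_series; under eq_eseriesr do rewrite addn0.
apply: le_trans IH; rewrite [leRHS](@nneseries_S _ (fun k => r ^+ (k + j) / (k + j)`!%:R))//.
rewrite (@eq_eseriesr _ _ (fun k => (r ^+ (k.+1 + j) / (k.+1 + j)`!%:R)%:E)); last first.
  by move=> k _; rewrite addnS -addSn.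
by rewrite leeDr ?lee_fin.
Qed.

(** The bound must be free of r. Only the component k = 0 of the mixture feels the singularity, and
    yields Gamma(1 - q); the others contribute at most 1 + 2 (1 + r)/r <= 5. *)
Lemma rician_negative_moment q : 0 < q < 1 -> 1 <= r ->
  (\int[rician_law r0]_y (posn y `^ (- q))%:E <= (Gam (1 - q) + 5)%:E)%E.
Proof.
move=> /andP[q0 q1] r1.
rewrite (@integral_rician_law _ _ r0 (fun y => y `^ (- q))); last 2 first.
- exact: measurable_powR.
- by move=> y _; exact: powR_ge0.
have kE k : (\int[leb]_y (y `^ (- q) * gamma_ker k.+1%:R s y)%:E = gint (k.+1%:R - q) s)%E.
  apply: eq_integral => y _; congr (_%:E); rewrite /gamma_ker; case: ifP => y0; last by rewrite mulr0.
  rewrite mulrA -powRD ?(gt_eqF y0) ?implybT//; congr (_ `^ _ * _); ring.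
rewrite (@integral_rician_ker _ _ r0 _ (fun k => (s `^ (- (k.+1%:R - q)) * Gam (k.+1%:R - q))%:E)); last 3 first.
- exact: measurable_powR.
- by move=> y; exact: powR_ge0.
- move=> k; rewrite kE gintE// subr_gt0 (lt_le_trans q1)//; by rewrite ler1n.
pose cf k : R := ((1 + r) * r) ^+ k / k`!%:R ^+ 2.
have f0 k : (0 : R) < k`!%:R by rewrite ltr0n fact_gt0.
have cf0 k : 0 <= cf k by rewrite divr_ge0 ?exprn_ge0 ?mulr_ge0 ?addr_ge0 ?(ltW r0) ?(ltW (f0 k)).
have g0 k : 0 < Gam (k.+1%:R - q).
  by apply: Gam_gt0; rewrite subr_gt0 (lt_le_trans q1)// ler1n.
pose f k : R := cf k * (s `^ (- (k.+1%:R - q)) * Gam (k.+1%:R - q)).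
have ff0 k : 0 <= f k by rewrite mulr_ge0// mulr_ge0 ?powR_ge0// ltW.
under eq_eseriesr do rewrite -EFinM -/(cf _) -/(f _).
rewrite nneseries_S//.
(* y^-q <= 1 + y^-1 bounds all the terms but the first one *)
have tail k : f k.+1 <= s^-1 * (r ^+ (k + 1) / (k + 1)`!%:R) + 2 / r * (r ^+ (k + 2) / (k + 2)`!%:R).
  have hG : s `^ (- (k.+2%:R - q)) * Gam (k.+2%:R - q) <=
      s^-1 ^+ k.+2 * k.+1`!%:R + s^-1 ^+ k.+1 * k`!%:R.
    have k20 : (0 : R) < k.+2%:R - q by rewrite subr_gt0 (lt_le_trans q1)// ler1n.
    rewrite -lee_fin -gintE// -kE EFinD.
    have -> : (s^-1 ^+ k.+2 * k.+1`!%:R)%:E = gint k.+2%:R s.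
      by rewrite gintE ?ltr0n// Gam_nat powRN powR_mulrn ?(ltW s0)// exprVn.
    have -> : (s^-1 ^+ k.+1 * k`!%:R)%:E = gint k.+1%:R s.
      by rewrite gintE ?ltr0n// Gam_nat powRN powR_mulrn ?(ltW s0)// exprVn.
    rewrite /gint -ge0_integralD//; last 4 first.
    - by move=> x _; rewrite lee_fin gamma_ker_ge0.
    - by apply/measurable_EFinP; exact: measurable_gamma_ker.
    - by move=> x _; rewrite lee_fin gamma_ker_ge0.
    - by apply/measurable_EFinP; exact: measurable_gamma_ker.
    apply: ge0_le_integral => //.
    - by move=> x _; rewrite lee_fin mulr_ge0 ?powR_ge0 ?gamma_ker_ge0.
    - by apply/measurable_EFinP; apply: measurable_funM; [exact: measurable_powR|exact: measurable_gamma_ker].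
    - by apply: emeasurable_funD; apply/measurable_EFinP; exact: measurable_gamma_ker.
    - move=> y _; rewrite -EFinD lee_fin /gamma_ker; case: ifPn => y0; last by rewrite mulr0 addr0.
      rewrite mulrA -mulrDl ler_wpM2r ?expR_ge0//.
      have -> : y `^ (k.+1%:R - 1) = y^-1 * y `^ (k.+2%:R - 1).
        by rewrite -(powR_inv1 (ltW y0)) -powRD ?(gt_eqF y0) ?implybT//; congr (_ `^ _); rewrite -!natr1; ring.
      rewrite -[X in _ <= X + _]mul1r -mulrDl ler_wpM2r ?powR_ge0//.
      have [y1|y1] := leP y 1.
        apply: (@le_trans _ _ y^-1); last by rewrite lerDr.
        by rewrite -(powR_inv1 (ltW y0)); apply: ger_powR; rewrite ?y0// lerN2 ltW.
      apply: (@le_trans _ _ 1); last by rewrite lerDl invr_ge0 ltW.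
      by rewrite -(powRr0 y); apply: ler_powR; rewrite ?(ltW y1)// oppr_le0 ltW.
  apply: (le_trans (ler_wpM2l (cf0 _) hG)).
  have f1 := gt_eqF (f0 k).
  have -> : cf k.+1 * (s^-1 ^+ k.+2 * k.+1`!%:R + s^-1 ^+ k.+1 * k`!%:R) =
     s^-1 * (r ^+ (k + 1) / (k + 1)`!%:R) + r ^+ k.+1 / (k.+1%:R ^+ 2 * k`!%:R).
    rewrite /cf exprMn -/s addn1 !factS !natrM !exprVn [s ^+ k.+2]exprS; field.
    by rewrite nat1r !pnatr_eq0 -lt0n fact_gt0 expf_neq0 ?gt_eqF.
  (* The second term is compared with the exponential series shifted by 2, through k + 2 <= 2 (k +
     1). *)
  rewrite lerD2l addn2 !factS !natrM [r ^+ k.+2]exprS.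
  have -> : 2 / r * (r * r ^+ k.+1 / (k.+2%:R * (k.+1%:R * k`!%:R))) = r ^+ k.+1 * (2 / (k.+2%:R * (k.+1%:R * k`!%:R))).
    by field; rewrite nat1r -natrD !pnatr_eq0 -lt0n fact_gt0 (gt_eqF r0).
  rewrite ler_wpM2l ?exprn_ge0 ?(ltW r0)//.
  have A0 : (0 : R) < k.+2%:R * (k.+1%:R * k`!%:R) by apply: mulr_gt0 => //; exact: mulr_gt0.
  have B0 : (0 : R) < k.+1%:R ^+ 2 * k`!%:R by apply: mulr_gt0 => //; exact: exprn_gt0.
  rewrite ler_pdivlMr// mulrC ler_pdivrMr//.
  have := f0 k; have := ler0n R k; rewrite -!natr1; set x := k%:R; set y := _`!%:R => x0 y0.
  rewrite -subr_ge0 (_ : _ - _ = x * ((x + 1) * y)); last by ring.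
  by rewrite !mulr_ge0 ?addr_ge0// ltW.
have sumtail : (\sum_(k <oo) (f k.+1)%:E <= (s^-1 * expR r + 2 / r * expR r)%:E)%E.
  have pj j k : 0 <= r ^+ (k + j) / (k + j)`!%:R by rewrite divr_ge0 ?exprn_ge0// ltW.
  apply: (@le_trans _ _ (\sum_(k <oo) ((s^-1 * (r ^+ (k + 1) / (k + 1)`!%:R))%:E + (2 / r * (r ^+ (k + 2) / (k + 2)`!%:R))%:E))%E).
    apply: lee_nneseries => [k _ _|k _]; first by rewrite lee_fin.
    by rewrite -EFinD lee_fin.
  rewrite nneseriesD; last 2 first.
  - by move=> k _ _; rewrite lee_fin mulr_ge0 ?invr_ge0 ?(ltW s0).
  - by move=> k _ _; rewrite lee_fin mulr_ge0 ?pj// divr_ge0// ltW.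
  under eq_eseriesr do rewrite EFinM.
  under [X in (_ + X <= _)%E]eq_eseriesr do rewrite EFinM.
  rewrite nneseriesZl; last by move=> k _; rewrite lee_fin.
  rewrite nneseriesZl; last by move=> k _; rewrite lee_fin.
  rewrite EFinD !(EFinM _ (expR r)) leeD// lee_wpmul2l ?lee_fin ?invr_ge0 ?divr_ge0 ?(ltW s0) ?(ltW r0)//; exact: expR_tail.
have nn : (0 <= (s * expR (- r))%:E)%E by rewrite lee_fin mulr_ge0 ?expR_ge0 ?(ltW s0).
apply: (le_trans (lee_wpmul2l nn (leeD (lexx _) sumtail))).
rewrite -EFinD -EFinM lee_fin /f /cf expr0 expr1n divr1 mul1r.
have er : 1 + r <= expR r by exact: expR_ge1Dx.
(* The weight s e^(-r) is at most 1 because 1 + r <= e^r, and s^-(1 - q) <= 1. *)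
have first_ : s * expR (- r) * (s `^ (- (1 - q)) * Gam (1 - q)) <= Gam (1 - q).
  rewrite mulrA ler_piMl ?(ltW (g0 0%N))// expRN.
  rewrite mulrAC ler_pdivrMr ?expR_gt0// mul1r; apply: le_trans er; rewrite -/s ler_piMr ?(ltW s0)//.
  by rewrite -[leRHS](powRr0 s); apply: ler_powR; rewrite ?/s; lra.
rewrite mulrDr; apply: lerD => //.
rewrite (_ : s * expR (- r) * _ = 1 + 2 * (s / r)); last first.
  by rewrite expRN; field; rewrite !gt_eqF ?expR_gt0.
have : s / r <= 2 by rewrite ler_pdivrMr// /s; lra.
lra.
Qed.

(** By scaling, a finite integral of e^(-x)/x would equal that of e^(-2x)/x, although the first
    integrand is strictly larger. *)
Lemma gint01 : (gint 0 1 = +oo :> \bar R)%E.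
Proof.
have g2 : gint 0 2 = gint 0 1 :> \bar R by rewrite gint_scale// oppr0 powRr0 mul1e.
have m (u v : R) : meas R (gamma_ker u v) by exact: measurable_gamma_ker.
apply/eqP; rewrite -leye_eq leNgt; apply/negP => fin.
have fin2 : (gint 0 2 < +oo :> \bar R)%E by rewrite g2.
pose f (x : R) := gamma_ker 0 1 x - gamma_ker 0 2 x.
have fpos x : 0 < x -> 0 < f x.
  move=> x0; rewrite /f /gamma_ker x0 -mulrBr mulr_gt0 ?powR_gt0// subr_gt0 ltr_expR.
  by rewrite ltrN2 ltr_pM2r//; lra.
have f0 x : 0 <= f x.
  by have [/fpos/ltW//|x0] := ltP 0 x; rewrite /f /gamma_ker ltNge x0 subrr.
have mf : meas R f by exact: measurable_funB.
have := integral_pos_gt0 mf f0 fpos.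
have : (\int[leb]_x (f x)%:E + gint 0 2 = gint 0 1)%E.
  rewrite /gint -ge0_integralD//.
  - by apply: eq_integral => x _; rewrite -EFinD /f subrK.
  - by move=> x _; rewrite lee_fin.
  - exact/measurable_EFinP.
  - by move=> x _; rewrite lee_fin gamma_ker_ge0.
  - by apply/measurable_EFinP; exact: m.
have := gint_ge0 (0 : R) 1; rewrite g2; move: fin.
case: (gint 0 1) => [x _ _|//|//].
case: (integral _ _ _) => [y|//|//] [yx]; rewrite lte_fin; lra.
Qed.

Lemma rician_negative_moment1 :
  (\int[rician_law r0]_y (posn y `^ (- 1))%:E = +oo)%E.
Proof.
rewrite (@integral_rician_law _ _ r0 (fun y => y `^ (- 1))); last 2 first.
- exact: measurable_powR.
- by move=> y _; exact: powR_ge0.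
suff -> : (\int[leb]_y (y `^ (- 1) * rician_ker r y)%:E = +oo)%E.
  by rewrite mulry gtr0_sg ?mul1e// mulr_gt0 ?expR_gt0.
apply/eqP; rewrite -leye_eq; have : gint 0 s = +oo%E :> \bar R.
  by rewrite gint_scale// oppr0 powRr0 mul1e gint01.
move=> <-; apply: ge0_le_integral => //.
- by move=> x _; rewrite lee_fin gamma_ker_ge0.
- by apply/measurable_EFinP; exact: measurable_gamma_ker.
- by apply/measurable_EFinP; apply: measurable_funM; [exact: measurable_powR|exact: measurable_rician_ker].
- move=> y _; rewrite lee_fin /gamma_ker; case: ifPn => y0.
    by rewrite sub0r ler_wpM2l ?powR_ge0// rician_ker_gt0.
  by rewrite /rician_ker (negbTE y0) mulr0.
Qed.

End rician_bounds.

(** * The lognormal factor *)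

Section ln_substitution.
Context {R : realType}.

Lemma measurable_ln_comp (H : R -> R) : meas R H ->
  meas R (fun x => if 0 < x then x^-1 * H (ln x) else 0).
Proof.
move=> mH; apply: measurable_cutpos; apply: measurable_funM; first exact: measurable_invr.
by apply: (measurableT_comp mH); exact: measurable_ln.
Qed.

(** The substitution x = e^u is made for u in [-n, n], and both sides are exhausted as n grows. *)
Lemma ln_substitution (H : R -> R) : continuous H -> (forall u, 0 <= H u) ->
  (\int[leb]_x (if 0 < x then x^-1 * H (ln x) else 0)%:E = \int[leb]_u (H u)%:E)%E.
Proof.
move=> cH H0.
have mH : meas R H by exact: continuous_measurable_fun.
pose f x : R := if 0 < x then x^-1 * H (ln x) else 0.
have f0 x : 0 <= f x by rewrite /f; case: ifP => // x0; rewrite mulr_ge0// invr_ge0 ltW.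
have mf : meas R f by exact: measurable_ln_comp.
have step (n : nat) : (\int[leb]_(x in `[expR (- n%:R), expR n%:R]) (f x)%:E =
    \int[leb]_(u in `[(- n%:R)%R, n%:R]) (H u)%:E)%E.
  have dE : ((@expR R)^`())%classic = expR by apply/funext => x; rewrite derive1E; apply: derive_val; exact: is_derive_expR.
  rewrite (@integration_by_substitution_increasing _ expR f (- n%:R) n%:R).
  - apply: eq_integral => u _; congr (_%:E); rewrite dE.
    transitivity (f (expR u) * expR u) => //; rewrite /f expR_gt0 expRK.
    by rewrite mulrAC mulVf ?mul1r// gt_eqF// expR_gt0.
  - by rewrite -subr_ge0 opprK addr_ge0.
  - by move=> x y _ _; rewrite ltr_expR.
  - by rewrite dE => x _; exact: continuous_expR.
  - by rewrite dE; apply/cvg_ex; exists (expR (- n%:R)); apply: cvg_at_right_filter; exact: continuous_expR.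
  - by rewrite dE; apply/cvg_ex; exists (expR n%:R); apply: cvg_at_left_filter; exact: continuous_expR.
  - split.
    + by move=> x _; exact: derivable_expR.
    + by apply: cvg_at_right_filter; exact: continuous_expR.
    + by apply: cvg_at_left_filter; exact: continuous_expR.
  - have : {within `[expR (- n%:R), expR n%:R], continuous (fun x : R => x^-1 * H (ln x))}.
      apply: continuous_in_subspaceT => x /set_mem /=; rewrite in_itv/= => /andP[x1 _].
      have x0 : 0 < x by apply: lt_le_trans x1; exact: expR_gt0.
      apply: continuousM; first by apply: inv_continuous; rewrite gt_eqF.
      by apply: continuous_comp; [exact: continuous_ln|exact: cH].
    apply: subspace_eq_continuous => x /set_mem /=; rewrite in_itv/= => /andP[x1 _].
    by rewrite /from_subspace/= /f (lt_le_trans _ x1)// expR_gt0.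
have nd1 : nondecreasing_seq (fun n => `[(- n%:R)%R, n%:R]%classic : set R).
  apply/nondecreasing_seqP => n; rewrite subsetEset => x /=; rewrite !in_itv/= -!ler_norml => /le_trans; apply.
  by rewrite ler_nat.
have nd2 : nondecreasing_seq (fun n => `[expR (- n%:R), expR n%:R]%classic : set R).
  apply/nondecreasing_seqP => n; rewrite subsetEset => x /=; rewrite !in_itv/= => /andP[x1 x2].
  by rewrite (le_trans _ x1) ?(le_trans x2)// ler_expR ?lerN2 ler_nat.
have C1 : (\int[leb]_(u in `[(- n%:R)%R, n%:R]) (H u)%:E @[n --> \oo] -->
    \int[leb]_(u in \bigcup_n `[(- n%:R)%R, n%:R]%classic) (H u)%:E)%E.
  apply: ge0_nondecreasing_set_cvg_integral => //.
  - by move=> n; apply: measurable_funTS; exact/measurable_EFinP.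
  - by move=> n x _; rewrite lee_fin.
have C2 : (\int[leb]_(x in `[expR (- n%:R), expR n%:R]) (f x)%:E @[n --> \oo] -->
    \int[leb]_(x in \bigcup_n `[expR (- n%:R), expR n%:R]%classic) (f x)%:E)%E.
  apply: ge0_nondecreasing_set_cvg_integral => //.
  - by move=> n; apply: measurable_funTS; exact/measurable_EFinP.
  - by move=> n x _; rewrite lee_fin.
move: C1 C2.
have -> : \bigcup_i `[(- i%:R)%R, i%:R]%classic = [set: R].
  rewrite -subTset => x _; exists (Num.truncn `|x|).+1 => //=.
  by rewrite in_itv/= -ler_norml; apply/ltW/truncnS_gt.
have -> : \bigcup_i `[expR (- i%:R), expR i%:R]%classic = `]0, +oo[%classic :> set R.
  apply/seteqP; split => x /=; rewrite in_itv/= ?andbT.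
    by move=> [n _] /=; rewrite in_itv/= => /andP[x1 _]; apply: lt_le_trans x1; exact: expR_gt0.
  move=> x0; exists (Num.truncn `|ln x|).+1 => //=.
  have := ltW (truncnS_gt `|ln x|); rewrite ler_norml => /andP[l1 l2].
  by rewrite in_itv/=; apply/andP; split; [rewrite -[leRHS](lnK x0)|rewrite -[leLHS](lnK x0)]; rewrite ler_expR.
move=> C1 C2.
have -> : (\int[leb]_x (f x)%:E = \int[leb]_(x in `]0%R, +oo[) (f x)%:E)%E.
  rewrite (@integral_if _ `]0, +oo[%classic (fun x => 0 < x)); last by move=> x; rewrite /= in_itv/= andbT.
  by apply: eq_integral => x _; congr (_%:E); rewrite /f; case: ifP.
have E : (fun n : nat => \int[leb]_(x in `[expR (- n%:R), expR n%:R]) (f x)%:E)%E =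
  (fun n : nat => \int[leb]_(u in `[(- n%:R)%R, n%:R]) (H u)%:E)%E by apply/funext => n; exact: step.
rewrite E in C2; exact: (cvg_unique _ C2 C1).
Qed.

Lemma ge0_integral_reflect (m : R) (f : R -> \bar R) :
  meas R f -> (forall x, (0 <= f x)%E) ->
  (\int[leb]_x f (m - x)%R = \int[leb]_x f x)%E.
Proof.
move=> mf f0.
have mm : meas R (fun x : R => m - x) by exact: measurable_funB.
have mE (A : set R) : measurable A ->
    leb A = pushforward leb (fun x : measurableTypeR R => m - x : measurableTypeR R) A.
  move=> mA; apply: lebesgue_measure_unique => // _ [[a b]] _ <-.
  rewrite /= /pushforward.
  rewrite (_ : (fun x : R => m - x) @^-1` `]a, b] = `[m - b, m - a[%classic); last first.
    by apply/seteqP; split => x /=; rewrite !in_itv/= => /andP[x1 x2]; apply/andP; split; lra.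
  rewrite !lebesgue_measure_itv/= !lte_fin ltrD2l ltrN2.
  by case: ifP => // _; rewrite -!EFinB; congr (_%:E); ring.
rewrite [in RHS](eq_measure_integral (pushforward leb (fun x : measurableTypeR R => m - x : measurableTypeR R))); last first.
  by move=> A mA _; exact: mE.
by rewrite ge0_integral_pushforward.
Qed.

End ln_substitution.

Section lognormal.
Context {R : realType} (s2 : R) (s20 : 0 < s2).
Let sg : R := Num.sqrt s2.
Let sg0 : 0 < sg. Proof. by rewrite sqrtr_gt0. Qed.
Let sg2 : sg ^+ 2 = s2. Proof. by rewrite sqr_sqrtr// ltW. Qed.

Definition gauss_ln (u : R) : R := expR (- ((2 * s2)^-1 * (u + s2 / 2) ^+ 2)).

(** The factor 1/z is the Jacobian of the logarithm; the other 1/z in [lognormal_rician_pdf] belongs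
    to the multiplicative convolution. *)
Definition lognormal_ker (z : R) : R := if 0 < z then z^-1 * gauss_ln (ln z) else 0.

Lemma gauss_lnE u : gauss_ln u = normal_fun (- (s2 / 2)) sg u.
Proof.
rewrite /gauss_ln /normal_fun sg2 opprK; congr expR; field.
by rewrite gt_eqF.
Qed.

Lemma continuous_gauss_ln : continuous gauss_ln.
Proof.
move=> u; apply: continuous_comp; last exact: continuous_expR.
apply: cvgN; apply: cvgM; first exact: cvg_cst.
apply: (@continuous_comp _ _ _ (fun u : R => u + s2 / 2) (fun v => v ^+ 2)); last exact: exprn_continuous.
by apply: cvgD; [exact: cvg_id|exact: cvg_cst].
Qed.

Lemma measurable_gauss_ln : meas R gauss_ln.
Proof. by apply: continuous_measurable_fun; exact: continuous_gauss_ln. Qed.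

Lemma lognormal_ker_ge0 z : 0 <= lognormal_ker z.
Proof. by rewrite /lognormal_ker; case: ifP => // z0; rewrite mulr_ge0 ?expR_ge0// invr_ge0 ltW. Qed.

Lemma measurable_lognormal_ker : meas R lognormal_ker.
Proof. exact: (measurable_ln_comp measurable_gauss_ln). Qed.

Let nrm : R := normal_peak sg.
Let nrm0 : 0 < nrm. Proof. by apply: normal_peak_gt0; rewrite gt_eqF. Qed.

Lemma integral_normal_fun_sg m : (\int[leb]_u (normal_fun m sg u)%:E = (nrm^-1)%:E)%E.
Proof.
have := integral_normal_pdf m sg; rewrite /normal_pdf gt_eqF//.
under eq_integral do rewrite EFinM.
rewrite ge0_integralZl_EFin//; last 3 first.
- by move=> u _; rewrite lee_fin normal_fun_ge0.
- by apply/measurable_EFinP; exact: measurable_normal_fun.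
- exact: ltW.
move=> H; rewrite -[LHS]mul1e -(@mulVf _ nrm) ?gt_eqF// EFinM -muleA H mule1.
by [].
Qed.

Definition lognormal_law_pdf (z : R) : R := nrm * lognormal_ker z.

Lemma lognormal_pdf_ge0 z : 0 <= lognormal_law_pdf z.
Proof. by rewrite mulr_ge0 ?lognormal_ker_ge0// ltW. Qed.

Lemma measurable_lognormal_pdf : meas R lognormal_law_pdf.
Proof. by apply: measurable_funM => //; exact: measurable_lognormal_ker. Qed.

Lemma lognormal_pdf_le0 z : z <= 0 -> lognormal_law_pdf z = 0.
Proof. by move=> z0; rewrite /lognormal_law_pdf /lognormal_ker ltNge z0 mulr0. Qed.

Lemma integral_lognormal_ker (w : R -> R) : continuous w -> (forall u, 0 <= w u) ->
  (\int[leb]_z (w (ln z) * lognormal_ker z)%:E = \int[leb]_u (w u * gauss_ln u)%:E)%E.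
Proof.
move=> cw w0; rewrite -[RHS]ln_substitution.
- apply: eq_integral => z _; congr (_%:E); rewrite /lognormal_ker; case: ifP => _; last by rewrite mulr0.
  by rewrite mulrCA.
- by move=> u; apply: cvgM; [exact: cw|exact: continuous_gauss_ln].
- by move=> u; rewrite mulr_ge0 ?expR_ge0.
Qed.

Lemma integral_lognormal_pdf : (\int[leb]_x (lognormal_law_pdf x)%:E = 1)%E.
Proof.
under eq_integral do rewrite EFinM.
rewrite ge0_integralZl_EFin ?(ltW nrm0)//; last 2 first.
- by move=> x _; rewrite lee_fin lognormal_ker_ge0.
- by apply/measurable_EFinP; exact: measurable_lognormal_ker.
have -> : (\int[leb]_z (lognormal_ker z)%:E = (nrm^-1)%:E)%E.
  rewrite -(integral_normal_fun_sg (- (s2 / 2))).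
  transitivity (\int[leb]_z ((fun=> 1) (ln z) * lognormal_ker z)%:E)%E.
    by apply: eq_integral => z _; rewrite mul1r.
  rewrite (@integral_lognormal_ker (fun=> 1)); [|by move=> u; exact: cvg_cst|by []].
  by apply: eq_integral => u _; rewrite mul1r gauss_lnE.
by rewrite -EFinM divff// gt_eqF.
Qed.

Definition lognormal_law := density_prob measurable_lognormal_pdf lognormal_pdf_ge0 integral_lognormal_pdf.

Lemma integral_lognormal_law (w : R -> R) : continuous w -> (forall u, 0 <= w u) ->
  (\int[lognormal_law]_z (w (ln (posn z)))%:E = nrm%:E * \int[leb]_u (w u * gauss_ln u)%:E)%E.
Proof.
move=> cw w0.
have mw : meas R w by exact: continuous_measurable_fun.
have mwl : meas R (fun z => w (ln z)).
  by apply: (measurableT_comp mw); exact: measurable_ln.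
have mwp : meas R (fun z => w (ln (posn z))).
  by apply: (measurableT_comp mwl); exact: measurable_posn.
have wk z : w (ln (posn z)) * lognormal_ker z = w (ln z) * lognormal_ker z.
  by rewrite /lognormal_ker; case: ifPn => z0; rewrite ?mulr0// posnE.
rewrite -integral_lognormal_ker// ge0_integral_density; last 2 first.
- exact/measurable_EFinP.
- by move=> x; rewrite lee_fin.
rewrite -ge0_integralZl_EFin ?(ltW nrm0)//.
- by apply: eq_integral => z _; rewrite -!EFinM -wk /lognormal_law_pdf; congr (_%:E); ring.
- by move=> z _; rewrite lee_fin mulr_ge0 ?lognormal_ker_ge0.
- by apply/measurable_EFinP; apply: measurable_funM => //; exact: measurable_lognormal_ker.
Qed.

(** The tilt e^(q u) shifts the Gaussian mean by q s2; completing the square leaves the constant. *)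
Lemma lognormal_law_powR q :
  (\int[lognormal_law]_z (posn z `^ q)%:E = (expR (s2 * q * (q - 1) / 2))%:E)%E.
Proof.
have -> : (\int[lognormal_law]_z (posn z `^ q)%:E = \int[lognormal_law]_z (expR (q * ln (posn z)))%:E)%E.
  by apply: eq_integral => z _; congr (_%:E); rewrite /powR gt_eqF// posn_gt0.
rewrite (@integral_lognormal_law (fun u => expR (q * u))); last 2 first.
- move=> u; apply: (@continuous_comp _ _ _ (fun u : R => q * u) expR); last exact: continuous_expR.
  by apply: cvgM; [exact: cvg_cst|exact: cvg_id].
- by move=> u; exact: expR_ge0.
transitivity (nrm%:E * \int[leb]_u ((expR (s2 * q * (q - 1) / 2))%:E * (normal_fun (- (s2 / 2) + q * s2) sg u)%:E))%E.
  congr (_ * _)%E; apply: eq_integral => u _; rewrite -EFinM; congr (_%:E).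
  rewrite /gauss_ln /normal_fun sg2 -!expRD; congr expR; field.
  by rewrite gt_eqF.
rewrite ge0_integralZl_EFin ?expR_ge0//; last 2 first.
- by move=> u _; rewrite lee_fin normal_fun_ge0.
- by apply/measurable_EFinP; exact: measurable_normal_fun.
rewrite integral_normal_fun_sg -!EFinM; congr (_%:E); field.
by rewrite gt_eqF.
Qed.

Lemma lognormal_law_expr k :
  (\int[lognormal_law]_z (posn z ^+ k)%:E = (expR (s2 * k%:R * (k%:R - 1) / 2))%:E)%E.
Proof.
rewrite -lognormal_law_powR; apply: eq_integral => z _.
by rewrite powR_mulrn// ltW// posn_gt0.
Qed.

(* The reflection of the Gaussian about its mean exchanges |v|^k + v^k and |v|^k - v^k for odd k. *)
Lemma lognormal_odd_moment k : odd k ->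
  (\int[lognormal_law]_z (`|ln (posn z) + s2 / 2| ^+ k + (ln (posn z) + s2 / 2) ^+ k)%:E =
   \int[lognormal_law]_z (`|ln (posn z) + s2 / 2| ^+ k - (ln (posn z) + s2 / 2) ^+ k)%:E)%E.
Proof.
move=> ok.
have ca : continuous (fun u : R => u + s2 / 2) by move=> u; apply: cvgD; [exact: cvg_id|exact: cvg_cst].
have c1 : continuous (fun u : R => `|u + s2 / 2| ^+ k).
  move=> u; apply: (@continuous_comp _ _ _ (fun u : R => `|u + s2 / 2|) (fun v => v ^+ k)); last exact: exprn_continuous.
  by apply: cvg_norm; exact: ca.
have c2 : continuous (fun u : R => (u + s2 / 2) ^+ k).
  by move=> u; apply: (@continuous_comp _ _ _ (fun u : R => u + s2 / 2) (fun v => v ^+ k)); [exact: ca|exact: exprn_continuous].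
have le_ u : - `|u + s2 / 2| ^+ k <= (u + s2 / 2) ^+ k <= `|u + s2 / 2| ^+ k by rewrite -ler_norml normrX.
rewrite (@integral_lognormal_law (fun u => `|u + s2 / 2| ^+ k + (u + s2 / 2) ^+ k)); last 2 first.
- by move=> u; apply: cvgD; [exact: c1|exact: c2].
- by move=> u; have /andP[] := le_ u; rewrite -subr_ge0 opprK addrC.
rewrite (@integral_lognormal_law (fun u => `|u + s2 / 2| ^+ k - (u + s2 / 2) ^+ k)); last 2 first.
- by move=> u; apply: cvgB; [exact: c1|exact: c2].
- by move=> u; have /andP[_] := le_ u; rewrite -subr_ge0.
congr (_ * _)%E.
rewrite -(@ge0_integral_reflect _ (- s2) (fun u => ((`|u + s2 / 2| ^+ k + (u + s2 / 2) ^+ k) * gauss_ln u)%:E)).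
- apply: eq_integral => u _; congr (_%:E); rewrite /gauss_ln.
  have -> : - s2 - u + s2 / 2 = - (u + s2 / 2) by field.
  by rewrite normrN sqrrN exprNn -signr_odd ok expr1 mulN1r.
- apply/measurable_EFinP; apply: measurable_funM; last exact: measurable_gauss_ln.
  by apply: measurable_funD; apply: continuous_measurable_fun.
- move=> u; rewrite lee_fin mulr_ge0 ?expR_ge0//; have /andP[] := le_ u.
  by rewrite -subr_ge0 opprK addrC.
Qed.

(** A lognormal variable has no exponential moment of positive order, so powers take their place.
    With u = ln Z, |e^u - 1| <= |u| (1 + e^u) and |u| <= sg e^(|u|/sg) extract the factor sg^(2n)
    and leave powers of Z with exponents of size at most t + 2n, t = 2n/sg. *)
Lemma lognormal_even_moment n e : s2 <= 1 -> 0 < e -> s2 <= e ^+ 2 ->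
  (\int[lognormal_law]_z ((posn z - 1) ^+ (2 * n))%:E <=
    (4 * 2 ^+ (2 * n) * expR (8 * n%:R ^+ 2 + 2 * n%:R) * e ^+ (2 * n))%:E)%E.
Proof.
move=> s21 e0 se.
have sg1 : sg <= 1.
  by rewrite -(@ler_pXn2r _ 2)// ?nnegrE ?(ltW sg0)// sg2 expr1n.
pose t : R := 2 * n%:R / sg.
have t0 : 0 <= t by apply: divr_ge0; [exact: mulr_ge0|exact: ltW].
have mp q : meas R (fun z => (posn z `^ q)%:E).
  by apply/measurable_EFinP; apply: (measurableT_comp (measurable_powR q)); exact: measurable_posn.
have p0 q z : (0 <= (posn z `^ q)%:E :> \bar R)%E by rewrite lee_fin powR_ge0.
pose E4 z : \bar R := ((posn z `^ t)%:E + ((posn z `^ (- t))%:E + ((posn z `^ (t + 2 * n%:R))%:E + (posn z `^ (- t + 2 * n%:R))%:E)))%E.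
have mE4 : meas R E4 by do 3 (apply: emeasurable_funD => //).
have E40 z : (0 <= E4 z)%E by rewrite !adde_ge0.
apply: (@le_trans _ _ (\int[lognormal_law]_z ((sg ^+ (2 * n) * 2 ^+ (2 * n))%:E * E4 z))%E).
  apply: ge0_le_integral => //.
  - by move=> z _; rewrite lee_fin exprM exprn_ge0// sqr_ge0.
  - by apply/measurable_EFinP; apply: measurable_funX; apply: measurable_funB => //; exact: measurable_posn.
  - exact: measurable_funeM.
  - move=> z _; rewrite /E4 -!EFinD -EFinM lee_fin.
    have zE q : posn z `^ q = expR (q * ln (posn z)) by rewrite /powR gt_eqF// posn_gt0.
    rewrite !zE; set u := ln (posn z).
    have -> : posn z = expR u by rewrite lnK// posrE posn_gt0.
    have h1 : `|expR u - 1| <= `|u| * (1 + expR u).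
      have := expR_gt0 u; have := expR_ge1Dx u; have := expR_ge1Dx (- u); rewrite expRN => a1 a2 a3.
      have [u0|u0] := leP 0 u.
        have e1 : 1 <= expR u by rewrite -[leLHS]expR0 ler_expR.
        rewrite !ger0_norm ?subr_ge0//.
        have : (1 - u) * expR u <= 1 by rewrite -ler_pdivlMr// mul1r.
        by rewrite mulrDr mulr1; nra.
      have e1 : expR u <= 1 by rewrite -[leRHS]expR0 ler_expR ltW.
      rewrite ler0_norm ?subr_le0// ltr0_norm//.
      have : 0 <= - u * expR u by rewrite mulr_ge0 ?oppr_ge0 ?ltW.
      lra.
    have h2 : `|u| <= sg * expR (`|u| / sg).
      rewrite -ler_pdivrMl// mulrC; apply: le_trans (expR_ge1Dx _); by rewrite lerDr.
    have ev (y : R) : y ^+ (2 * n) = `|y| ^+ (2 * n) by rewrite !exprM real_normK ?num_real.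
    rewrite (ev (expR u - 1)).
    apply: (@le_trans _ _ ((sg * expR (`|u| / sg) * (1 + expR u)) ^+ (2 * n))).
      apply: lerXn2r; rewrite ?nnegrE//; first by rewrite !mulr_ge0 ?addr_ge0 ?expR_ge0 ?ltW.
      by apply: (le_trans h1); rewrite ler_wpM2r// addr_ge0// expR_ge0.
    rewrite !exprMn -mulrA -[leRHS]mulrA ler_wpM2l ?exprn_ge0 ?(ltW sg0)//.
    have h3 : expR (`|u| / sg) ^+ (2 * n) <= expR (t * u) + expR (- t * u).
      rewrite -expRM_natl natrM (_ : _ * _ = t * `|u|); last by rewrite /t; field; rewrite gt_eqF.
      have [u0|u0] := leP 0 u; [rewrite (ger0_norm u0) lerDl|rewrite (ltr0_norm u0) mulrN -mulNr lerDr]; exact: expR_ge0.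
    have h4 : (1 + expR u) ^+ (2 * n) <= 2 ^+ (2 * n) * (1 + expR (2 * n%:R * u)).
      have eu := expR_ge0 u.
      rewrite -natrM expRM_natl; have [e1|e1] := leP (expR u) 1.
        apply: (@le_trans _ _ (2 ^+ (2 * n))); last by rewrite ler_peMr ?exprn_ge0// lerDl exprn_ge0.
        by apply: lerXn2r; rewrite ?nnegrE ?addr_ge0//; lra.
      apply: (@le_trans _ _ ((2 * expR u) ^+ (2 * n))); last by rewrite exprMn ler_wpM2l ?exprn_ge0// lerDr.
      by apply: lerXn2r; rewrite ?nnegrE ?addr_ge0 ?mulr_ge0//; lra.
    apply: (le_trans (ler_pM _ _ h3 h4)); rewrite ?exprn_ge0 ?addr_ge0 ?expR_ge0//.
    rewrite !mulrDl !expRD; set a := expR (t * u); set b := expR (- t * u); set d := expR (2 * n%:R * u).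
    by rewrite le_eqVlt; apply/orP; left; apply/eqP; ring.
rewrite ge0_integralZl_EFin ?mulr_ge0 ?exprn_ge0 ?(ltW sg0)//.
rewrite /E4 ge0_integralD//; [|by move=> z _; rewrite !adde_ge0|by do 2 (apply: emeasurable_funD => //)].
rewrite ge0_integralD//; [|by move=> z _; rewrite !adde_ge0|by do 1 (apply: emeasurable_funD => //)].
rewrite ge0_integralD//.
rewrite !lognormal_law_powR -!EFinD -EFinM lee_fin.
(* For these exponents sg |q| <= 4n, and s2 <= sg, so s2 q (q - 1)/2 is at most (16 n^2 + 4 n)/2. *)
pose B := expR (8 * n%:R ^+ 2 + 2 * n%:R) : R.
have n0 : (0 : R) <= n%:R by [].
have bound q : `|q| <= t + 2 * n%:R -> expR (s2 * q * (q - 1) / 2) <= B.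
  move=> qt; rewrite ler_expR.
  have q1 : sg * `|q| <= 4 * n%:R.
    apply: (@le_trans _ _ (sg * (t + 2 * n%:R))); first by rewrite ler_wpM2l// ltW.
    rewrite mulrDr /t mulrCA divff ?gt_eqF// mulr1.
    have : sg * (2 * n%:R) <= 2 * n%:R by rewrite ler_piMl// mulr_ge0.
    lra.
  have sq0 : 0 <= sg * `|q| by rewrite mulr_ge0// ltW.
  have q2 : s2 * q ^+ 2 <= 16 * n%:R ^+ 2.
    rewrite -sg2 -[q ^+ 2]real_normK ?num_real// -exprMn.
    by rewrite (_ : 16 * _ = (4 * n%:R) ^+ 2); [rewrite lerXn2r ?nnegrE// mulr_ge0|ring].
  have q3 : - (s2 * q) <= 4 * n%:R.
    apply: (le_trans (ler_norm _)); rewrite normrN normrM (gtr0_norm s20).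
    by apply: le_trans q1; rewrite ler_wpM2r// -sg2 expr2 ler_piMl// ltW.
  rewrite [leLHS](_ : _ = (s2 * q ^+ 2 + - (s2 * q)) / 2); last by field.
  lra.
have B1 : 0 <= 2 * n%:R :> R by rewrite mulr_ge0.
have b1 : expR (s2 * t * (t - 1) / 2) <= B by apply: bound; rewrite ger0_norm// lerDl.
have b2 : expR (s2 * - t * (- t - 1) / 2) <= B by apply: bound; rewrite normrN ger0_norm// lerDl.
have b3 : expR (s2 * (t + 2 * n%:R) * (t + 2 * n%:R - 1) / 2) <= B by apply: bound; rewrite ger0_norm// addr_ge0.
have b4 : expR (s2 * (- t + 2 * n%:R) * (- t + 2 * n%:R - 1) / 2) <= B.
  by apply: bound; apply: (le_trans (ler_normD _ _)); rewrite normrN !ger0_norm.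
rewrite -/B.
apply: (@le_trans _ _ (sg ^+ (2 * n) * 2 ^+ (2 * n) * (4 * B))).
  by rewrite ler_wpM2l ?mulr_ge0 ?exprn_ge0 ?(ltW sg0)//; lra.
rewrite (_ : _ * (4 * B) = 4 * 2 ^+ (2 * n) * B * sg ^+ (2 * n)); last by ring.
rewrite ler_wpM2l ?mulr_ge0 ?exprn_ge0 ?expR_ge0//.
rewrite !exprM sg2; apply: lerXn2r; rewrite ?nnegrE ?exprn_ge0 ?(ltW e0)//.
exact: ltW.
Qed.

End lognormal.

(** * The two laws as products *)

Section laws.
Context {R : realType}.

(** No finiteness is asked: when the integral of [H] is infinite, [fine] makes both sides 0. *)
Lemma Rintegral_pos_scale (F H : R -> R) (c : R) : 0 <= c ->
  meas R H -> (forall z, 0 <= H z) ->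
  (forall z, (if 0 < z then F z else 0) = c * H z) ->
  \int[leb]_(z in `]0, +oo[) F z = c * fine (\int[leb]_z (H z)%:E)%E.
Proof.
move=> c0 mH H0 FH; rewrite /Rintegral.
rewrite (@integral_if _ `]0, +oo[%classic (fun z => 0 < z)); last by move=> z; rewrite /= in_itv/= andbT.
under eq_integral do rewrite FH EFinM.
rewrite ge0_integralZl_EFin//; [|by move=> z _; rewrite lee_fin|exact/measurable_EFinP].
case: (integral _ _ _) => [x| |]; rewrite ?mulr0//=.
- by rewrite mulry; case: sgrP => _; rewrite ?mul0e ?mul1e ?mulN1e/= ?mulr0.
- by rewrite mulrNy; case: sgrP => _; rewrite ?mul0e ?mul1e ?mulN1e/= ?mulr0.
Qed.

Lemma measurable_mellin (k g : R -> R) (x : R) :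
  meas R k -> meas R g ->
  meas R (fun z => k z * g (x / z) / z).
Proof.
move=> mk mg; have mi := @measurable_invr R.
apply: measurable_funM => //; apply: measurable_funM => //.
by apply: (measurableT_comp mg); exact: measurable_funM.
Qed.

Lemma mellin_ge0 (k g : R -> R) (x z : R) : (forall z, 0 <= k z) -> (forall z, 0 <= g z) ->
  (forall z, z <= 0 -> k z = 0) -> 0 <= k z * g (x / z) / z.
Proof.
move=> k0 g0 kN; have [z0|z0] := leP z 0; first by rewrite kN// !mul0r.
by rewrite mulr_ge0 ?invr_ge0 ?(ltW z0)// mulr_ge0.
Qed.

Section gamma_gamma.
Context (a b : R) (a0 : 0 < a) (b0 : 0 < b).
Let ab0 : 0 < a * b. Proof. by rewrite mulr_gt0. Qed.

(** The rates 1 and a b make the exponential in the convolution exp(-z - a b x/z), that of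
    [bessel_K] at 2 sqrt(a b x), without change of variable. The means are b and 1/b, so the product
    has mean 1. *)
Definition gg_law : probability (R * R)%type R := (gamma_law b0 (@ltr01 R) \x gamma_law a0 ab0)%E.

Lemma gamma_gamma_law d (T : measurableType d) (P : probability T R) (X : {RV P >-> R}) :
  is_gamma_gamma P X a b ->
  forall A, measurable A -> P (X @^-1` A) = gg_law (@prod_posn R @^-1` A).
Proof.
move=> HX.
pose k := gamma_pdf b (1 : R); pose g := gamma_pdf a (a * b).
pose c1 : R := 1 `^ b / Gam b; pose c2 : R := (a * b) `^ a / Gam a.
have c10 : 0 < c1 by rewrite divr_gt0 ?powR_gt0 ?Gam_gt0.
have c20 : 0 < c2 by rewrite divr_gt0 ?powR_gt0 ?Gam_gt0.
pose A0 : R := 2 * (a * b) `^ ((a + b) / 2) / (Gamma a * Gamma b).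
have G0 (y : R) : 0 <= Gamma y by apply: Rintegral_ge0 => t _; rewrite mulr_ge0 ?powR_ge0 ?expR_ge0.
have A00 : 0 <= A0 by rewrite divr_ge0 ?mulr_ge0 ?powR_ge0.
(* What is left when the normalisations of the two factors are divided out. Only its sign matters,
   hence of [Gamma] only that it is nonnegative. *)
have K0 : 0 <= A0 * (2^-1 * (a * b) `^ ((a - b) / 2)) / (c1 * c2).
  have h : (0 : R) <= 2^-1 by rewrite invr_ge0.
  exact: (divr_ge0 (mulr_ge0 A00 (mulr_ge0 h (powR_ge0 _ _))) (mulr_ge0 (ltW c10) (ltW c20))).
have pN (y z : R) : 0 < y -> y `^ z != 0 by move=> y0; rewrite gt_eqF// powR_gt0.
rewrite /gg_law; apply: (@law_product R k g _ _ _ _ _ _ _ _ d T P X _ _ K0 _ HX).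
- by move=> x x0; exact: gamma_pdf_le0.
- by move=> x x0; exact: gamma_pdf_le0.
move=> x x0; rewrite /gamma_gamma_pdf -/A0 /bessel_K; clear HX.
have abx0 : 0 <= a * b * x by rewrite ltW// mulr_gt0.
have cc0 : 0 <= (c1 * c2 * x `^ (a - 1))^-1.
  by rewrite invr_ge0; exact: (mulr_ge0 (mulr_ge0 (ltW c10) (ltW c20)) (powR_ge0 _ _)).
rewrite (@Rintegral_pos_scale _ (fun z => k z * g (x / z) / z) (c1 * c2 * x `^ (a - 1))^-1)//; last 3 first.
- by apply: measurable_mellin; exact: measurable_gamma_pdf.
- move=> z; apply: mellin_ge0; [exact: gamma_pdf_ge0|exact: gamma_pdf_ge0|].
  by move=> y y0; exact: gamma_pdf_le0.
- move=> z; rewrite /k /g /gamma_pdf -/c1 -/c2 /gamma_ker; case: ifPn => z0; last by rewrite !(mulr0, mul0r).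
  rewrite divr_gt0// powRM ?invr_ge0 ?(ltW x0) ?(ltW z0)// -[z^-1]powR_inv1 ?(ltW z0)// -powRrM.
  have -> : (2 * Num.sqrt (a * b * x)) ^+ 2 / (4 * z) = a * b * (x / z).
    by rewrite exprMn sqr_sqrtr//; field; rewrite gt_eqF.
  have -> : - z - a * b * (x / z) = - (1 * z) + - (a * b * (x * z `^ (- 1))).
    by rewrite mul1r powR_inv1 ?(ltW z0).
  rewrite expRD.
  have -> : z `^ (- (a - b) - 1) = z `^ (b - 1) * z `^ (- 1 * (a - 1)) * z `^ (- 1).
    by rewrite -!powRD ?(gt_eqF z0) ?implybT//; congr (_ `^ _); ring.
  field.
  by apply/and3P; split; [exact: pN|exact: lt0r_neq0|exact: lt0r_neq0].
rewrite mulrC -/(fine _) [2 * _]mulrC mulfK//.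
rewrite -powR12_sqrt// -powRrM powRM ?(ltW x0) ?(ltW ab0)//.
rewrite (_ : x `^ (a - 1) = x `^ ((a + b) / 2 - 1) * x `^ (2^-1 * (a - b))); last first.
  by rewrite -powRD ?(gt_eqF x0) ?implybT//; congr (_ `^ _); field.
rewrite [(a - b) / 2]mulrC; field.
by apply/and4P; split; [exact: lt0r_neq0|exact: lt0r_neq0|exact: pN|exact: pN].
Qed.

End gamma_gamma.

Section lognormal_rician.
Context (r s2 : R) (r0 : 0 < r) (s20 : 0 < s2).

Definition lr_law : probability (R * R)%type R := (lognormal_law s20 \x rician_law r0)%E.

Lemma lognormal_rician_law d (T : measurableType d) (P : probability T R) (X : {RV P >-> R}) :
  is_lognormal_rician P X r s2 ->
  forall A, measurable A -> P (X @^-1` A) = lr_law (@prod_posn R @^-1` A).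
Proof.
move=> HX.
pose k := lognormal_law_pdf s2; pose g := rician_pdf r.
pose n : R := normal_peak (Num.sqrt s2).
have n0 : 0 < n by apply: normal_peak_gt0; rewrite gt_eqF// sqrtr_gt0.
have r10 : 0 < 1 + r by rewrite addr_gt0.
have c0 : 0 < n * ((1 + r) * expR (- r)) by rewrite !mulr_gt0 ?expR_gt0.
pose A0 : R := (1 + r) * expR (- r) / (Num.sqrt (2 * pi) * Num.sqrt s2).
have A00 : 0 <= A0 by rewrite divr_ge0 ?mulr_ge0 ?sqrtr_ge0 ?expR_ge0 ?(ltW r10).
have C0 : 0 <= A0 * (n * ((1 + r) * expR (- r)))^-1 by rewrite mulr_ge0// invr_ge0 ltW.
rewrite /lr_law; apply: (@law_product R k g _ _ _ _ _ _ _ _ d T P X _ _ C0 _ HX).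
- by move=> x x0; exact: lognormal_pdf_le0.
- by move=> x x0; exact: rician_pdf_le0.
move=> x x0; rewrite /lognormal_rician_pdf -/A0 -mulrA; congr (_ * _); clear HX.
apply: Rintegral_pos_scale.
- by rewrite invr_ge0 ltW.
- by apply: measurable_mellin; [exact: measurable_lognormal_pdf|exact: measurable_rician_pdf].
- move=> z; apply: mellin_ge0; [exact: lognormal_pdf_ge0|exact: rician_pdf_ge0|].
  by move=> y y0; exact: lognormal_pdf_le0.
- move=> z; rewrite /k /g /lognormal_law_pdf /rician_pdf -/n /lognormal_ker /rician_ker.
  case: ifPn => z0; last by rewrite !(mulr0, mul0r).
  rewrite divr_gt0// /gauss_ln.
  have -> : (1 + r) * r / z * x = (1 + r) * r * (x / z) by field; rewrite gt_eqF.
  rewrite expRD (_ : (1 + r) / z * x = (1 + r) * (x / z)); last by field; rewrite gt_eqF.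
  set I := bessel_I0 _; set E1 := expR (- ((2 * s2)^-1 * _)); set E2 := expR (- ((1 + r) * _)); set E3 := expR (- r).
  field.
  by rewrite !gt_eqF// /E3 expR_gt0.
Qed.

End lognormal_rician.
End laws.

(** * Gamma-Gamma *)

Section limit.
Context {R : realType}.

Lemma expansion_gt0 (K e v V : R) : 0 < e -> K * e < 1 -> e ^+ 2 <= v ->
  `|V - v| <= K * e ^+ 3 -> 0 < V.
Proof.
move=> e0 Ke ev; rewrite ler_norml => /andP[HV _].
have : 0 < e ^+ 2 * (1 - K * e) by rewrite mulr_gt0 ?exprn_gt0// subr_gt0.
rewrite (_ : _ * _ = e ^+ 2 - K * e ^+ 3); last by ring.
lra.
Qed.

(** V = v e^2 + O(e^3) and W = L e^4 + O(e^5) give W/V^(3/2)/e -> L/v^(3/2), so the limit is 0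
    exactly when the leading coefficient vanishes. *)
Lemma skewness_cvg_iff (F : set_system R) {FF : ProperFilter F} (S e : R -> R) (v L K : R) :
  0 < v -> e b @[b --> F] --> (0 : R) ->
  (\forall b \near F, 0 < e b /\ exists V W : R, [/\ S b = W / V `^ (3 / 2) / e b,
     `|V - v * e b ^+ 2| <= K * e b ^+ 3 & `|W - L * e b ^+ 4| <= K * e b ^+ 5]) ->
  (S b @[b --> F] --> (0 : R) <-> L = 0).
Proof.
move=> v0 ce H0.
pose good b := [set VW : R * R | [/\ S b = VW.2 / VW.1 `^ (3 / 2) / e b,
     `|VW.1 - v * e b ^+ 2| <= K * e b ^+ 3 & `|VW.2 - L * e b ^+ 4| <= K * e b ^+ 5]].
(* The two moments are given for each b separately; a choice turns them into functions, to which
   limits apply. *)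
pose V b := (xget (0, 0) (good b)).1; pose W b := (xget (0, 0) (good b)).2.
have {H0}H : \forall b \near F, [/\ 0 < e b, S b = W b / V b `^ (3 / 2) / e b,
     `|V b - v * e b ^+ 2| <= K * e b ^+ 3 & `|W b - L * e b ^+ 4| <= K * e b ^+ 5].
  apply: filterS H0 => b [e0 [V0 [W0 VW]]].
  have /xgetPex : exists VW, good b VW by exists (V0, W0).
  by move=> /(_ (0, 0)) [].
pose x b := V b / e b ^+ 2; pose y b := W b / e b ^+ 4.
have cKe : (K * e b) @[b --> F] --> (0 : R).
  by rewrite -(mulr0 K); apply: cvgM => //; exact: cvg_cst.
have cx : x b @[b --> F] --> v.
  apply/cvgrPdist_le => eps eps0.
  have C1 : \forall b \near F, `|K * e b| <= eps.
    by move/cvgr0_norm_le : cKe => /(_ _ eps0).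
  near=> b; have [|e0 _ HV _] := near H b; first by [].
  have -> : v - x b = - ((V b - v * e b ^+ 2) / e b ^+ 2) by rewrite /x; field; rewrite gt_eqF.
  rewrite normrN normrM normfV [X in _ / X]gtr0_norm ?exprn_gt0// ler_pdivrMr ?exprn_gt0//.
  apply: (le_trans HV); have -> : K * e b ^+ 3 = K * e b * e b ^+ 2 by ring.
  rewrite ler_wpM2r ?exprn_ge0 ?(ltW e0)//; apply: (le_trans (ler_norm _)).
  by near: b.
have cy : y b @[b --> F] --> L.
  apply/cvgrPdist_le => eps eps0.
  have C1 : \forall b \near F, `|K * e b| <= eps.
    by move/cvgr0_norm_le : cKe => /(_ _ eps0).
  near=> b; have [|e0 _ _ HW] := near H b; first by [].
  have -> : L - y b = - ((W b - L * e b ^+ 4) / e b ^+ 4) by rewrite /y; field; rewrite gt_eqF.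
  rewrite normrN normrM normfV [X in _ / X]gtr0_norm ?exprn_gt0// ler_pdivrMr ?exprn_gt0//.
  apply: (le_trans HW); have -> : K * e b ^+ 5 = K * e b * e b ^+ 4 by ring.
  rewrite ler_wpM2r ?exprn_ge0 ?(ltW e0)//; apply: (le_trans (ler_norm _)).
  by near: b.
have cpow : x b `^ (3 / 2) @[b --> F] --> v `^ (3 / 2).
  apply: (@cvg_comp _ _ _ x (fun z => z `^ (3 / 2)) F (nbhs v)) => //.
  have dl := is_derive1_powR (3 / 2) v0.
  have : {for v, continuous (fun z : R => z `^ (3 / 2))}.
    by apply: differentiable_continuous; apply/derivable1_diffP; have [] := dl.
  exact.
have vp : 0 < v `^ (3 / 2) by exact: powR_gt0.
have cS : S b @[b --> F] --> L / v `^ (3 / 2).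
  have cyx : (y b / x b `^ (3 / 2)) @[b --> F] --> L / v `^ (3 / 2).
    by apply: cvgM => //; apply: cvgV => //; rewrite gt_eqF.
  apply: cvg_trans cyx; apply: near_eq_cvg.
  near=> b; have [|e0 -> _ _] := near H b; first by [].
  have x0 : 0 < x b.
    near: b; move/cvgr_gt : cx => /(_ 0 v0); exact.
  have VE : V b = x b * e b ^+ 2 by rewrite /x divfK// expf_neq0// gt_eqF.
  rewrite [in RHS]VE powRM ?(ltW x0) ?exprn_ge0 ?(ltW e0)//.
  rewrite -[e b ^+ 2]powR_mulrn ?(ltW e0)// -powRrM (_ : 2%:R * (3 / 2) = 3%:R); last by field.
  rewrite powR_mulrn ?(ltW e0)// /y; field.
  by rewrite !gt_eqF// powR_gt0.
split=> [c0|L0]; last by move: cS; rewrite L0 mul0r.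
have : L / v `^ (3 / 2) = 0 by exact: (cvg_unique (@norm_hausdorff _ _) cS c0).
by move/eqP; rewrite mulf_eq0 invr_eq0 (gt_eqF vp) orbF => /eqP.
Unshelve. all: by end_near. Qed.

End limit.

Section gamma_gamma_expansion.
Context {R : realType}.

(** The polynomial gathers the terms of degree at least 3 in 1/a and 1/b of the third-moment
    expansion, written in s = 1/a + 1/b and p = 1/(a b), which have degrees 1 and 2. *)
Lemma gg_remainder (c : R) : exists2 B : R, 0 <= B & forall be s p : R, 0 <= be <= 1 ->
  0 <= s <= 2 * be -> 0 <= p <= be ^+ 2 ->
  `|6 * (s * p) + 4 * p ^+ 2 + 3 / 2 * c * (22 * (s * p) + 6 * s ^+ 3 + 32 * p ^+ 2 +
    36 * (s ^+ 2 * p) + 66 * (s * p ^+ 2) + 36 * p ^+ 3)| <= B * be ^+ 3.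
Proof.
have c0 := normr_ge0 c.
exists (16 + 654 * `|c|); first by lra.
move=> be s p /andP[be0 be1] /andP[s0 sb] /andP[p0 pb].

have q1 : s * p <= 2 * be ^+ 3.
  by rewrite (_ : 2 * _ = 2 * be * be ^+ 2); [exact: ler_pM|ring].
have p2 : p ^+ 2 <= be ^+ 3.
  apply: (@le_trans _ _ ((be ^+ 2) ^+ 2)); first by rewrite lerXn2r ?nnegrE ?exprn_ge0.
  by rewrite -exprM ler_wiXn2l.
have s3 : s ^+ 3 <= 8 * be ^+ 3.
  rewrite (_ : 8 * _ = (2 * be) ^+ 3); last by ring.
  by rewrite lerXn2r ?nnegrE ?mulr_ge0.
have s2p : s ^+ 2 * p <= 4 * be ^+ 3.
  apply: (@le_trans _ _ ((2 * be) ^+ 2 * be ^+ 2)).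
    by rewrite ler_pM ?exprn_ge0// lerXn2r ?nnegrE ?mulr_ge0.
  rewrite (_ : _ * _ = 4 * be ^+ 4); last by ring.
  by rewrite ler_wpM2l// ler_wiXn2l.
have sp2 : s * p ^+ 2 <= 2 * be ^+ 3.
  apply: (@le_trans _ _ (2 * be * be ^+ 3)); first by rewrite ler_pM ?exprn_ge0.
  by rewrite -mulrA ler_wpM2l// ler_piMl// exprn_ge0.
have p3 : p ^+ 3 <= be ^+ 3.
  apply: (@le_trans _ _ ((be ^+ 2) ^+ 3)); first by rewrite lerXn2r ?nnegrE ?exprn_ge0.
  by rewrite -exprM ler_wiXn2l.
have q10 : 0 <= s * p by rewrite mulr_ge0.
have q20 : 0 <= p ^+ 2 by rewrite exprn_ge0.
have q30 : 0 <= s ^+ 3 by rewrite exprn_ge0.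
have q40 : 0 <= s ^+ 2 * p by rewrite mulr_ge0 ?exprn_ge0.
have q50 : 0 <= s * p ^+ 2 by rewrite mulr_ge0 ?exprn_ge0.
have q60 : 0 <= p ^+ 3 by rewrite exprn_ge0.
set A := 6 * _ + 4 * _; set E := 22 * _ + _ + _ + _ + _ + _.
  have A1 : `|A| <= 16 * be ^+ 3 by rewrite ger0_norm /A; lra.
  have E1 : `|E| <= 436 * be ^+ 3 by rewrite ger0_norm /E; lra.
  apply: (le_trans (ler_normD _ _)); rewrite -[3 / 2 * c * E]mulrA normrM [`|c * E|]normrM (ger0_norm (_ : 0 <= 3 / 2)); last by lra.
  have := ler_wpM2l c0 E1; lra.
Qed.

(** The scale e = b^(-1/2) is that of the less concentrated factor, b <= a, so that the bounds are
    uniform in the ratio a/b. *)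
Lemma gg_expansion (l : R) : exists K M : R, [/\ 0 <= K, 4 <= M &
  forall a b : R, M <= b -> b <= a ->
  forall d (T : measurableType d) (P : probability T R) (X : {RV P >-> R}),
  is_gamma_gamma P X a b ->
  let e := (Num.sqrt b)^-1 in
  exists V W : R,
  [/\ `|V - (a^-1 + b^-1)| <= K * e ^+ 3,
    `|W - ((2 + 3 * (l - 1)) * (a^-1 + b^-1) ^+ 2 + 2 * (a^-1 * b^-1))| <= K * e ^+ 5,
    0 < V -> has_skewness P (fun w => boxcox l (X w)) &
    skewness P (fun w => boxcox l (X w)) = W / V `^ (3 / 2)]].
Proof.
(* An integer order beyond |3 l| serves both signs of l. *)
pose n := (Num.truncn `|3 * l|).+1.
have nl : `|3 * l| < n%:R by exact: truncnS_gt.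
have n0 : (0 : R) < n%:R by rewrite ltr0n.
pose D k : R := (2 * k)`!%:R * (2 * expR 2).
have D0 k : 0 <= D k by rewrite !mulr_ge0 ?expR_ge0.
have ln' : - (3 * l) < n%:R by apply: le_lt_trans nl; rewrite -normrN ler_norm.
have [K K0 HK] := @boxcox_delta R l n%:R (fun k => 3 ^+ (2 * k) * (D k + D k + D k * D k)) (2 ^+ n * 2 ^+ n) n0 ln'.
pose c := l - 1.
have [B B0 HB] := gg_remainder c.
(* In the threshold, 4 is for the generating functions and 2 n for the negative moment of order n.
   In the error, 1 pays for the term 1/(a b) of the variance and B for [gg_remainder]. *)
exists (K + 1 + B), (4 + 2 * n%:R); split.
- by rewrite !addr_ge0.
- by rewrite lerDl mulr_ge0 ?(ltW n0).
move=> a b Mb ba d T P X HX e.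
have b4 : 4 <= b by apply: le_trans Mb; rewrite lerDl mulr_ge0 ?(ltW n0).
have b2n : 2 * n%:R <= b by apply: le_trans Mb; rewrite lerDr.
have b0 : 0 < b by apply: lt_le_trans b4.
have a0 : 0 < a by apply: lt_le_trans ba.
have a4 : 4 <= a by exact: le_trans ba.
have ab0 : 0 < a * b by rewrite mulr_gt0.
have sb0 : 0 < Num.sqrt b by rewrite sqrtr_gt0.
have e0 : 0 < e by rewrite invr_gt0.
have e2 : e ^+ 2 = b^-1 by rewrite exprVn sqr_sqrtr// ltW.
have b1 : b^-1 <= 1 by rewrite invf_le1//; lra.
have e1 : e <= 1 by rewrite -(@ler_pXn2r _ 2)// ?nnegrE ?(ltW e0)// e2 expr1n.
have ab : a^-1 <= b^-1 by rewrite lef_pV2.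
pose al := a^-1; pose be := b^-1.
have al0 : 0 <= al by rewrite invr_ge0 ltW.
have be0 : 0 <= be by rewrite invr_ge0 ltW.
have be1 : be <= 1 by [].
have albe : al <= be by [].
pose s := al + be; pose p := al * be.
have s0 : 0 <= s by rewrite addr_ge0.
have p0 : 0 <= p by rewrite mulr_ge0.
have sb : s <= 2 * be by rewrite /s; lra.
have pb : p <= be ^+ 2 by rewrite expr2 ler_wpM2r.
pose U1 := unit_gamma b (1 : R); pose U2 := unit_gamma a (a * b).
have mU1 : meas R U1 by exact: measurable_unit_gamma.
have mU2 : meas R U2 by exact: measurable_unit_gamma.
have U10 x : 0 < U1 x by exact: unit_gamma_gt0.
have U20 x : 0 < U2 x by exact: unit_gamma_gt0.
pose Q := gg_law a0 b0.
pose Y : R * R -> R := @prod_posn R.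
have YE q : Y q = U1 q.1 * U2 q.2.
  by rewrite /Y /prod_posn /U1 /U2 /unit_gamma; field; rewrite !gt_eqF.
have mY : meas (R * R) Y by exact: measurable_prod_posn.
have Y0 q : 0 < Y q by rewrite YE mulr_gt0.
have mW : meas (R * R) (fun w => boxcox l (Y w)).
  exact: (measurableT_comp (measurable_boxcox l) mY).
have law := gamma_gamma_law a0 b0 HX.
have raw k : (\int[Q]_p (Y p ^+ k)%:E = (\prod_(i < k) (1 + i%:R / b) * \prod_(i < k) (1 + i%:R / a))%:E)%E.
  under eq_integral do rewrite YE.
  by rewrite (product_expr _ _ mU1 mU2 U10 U20) !gamma_law_expr -EFinM.
have raw1 : (\int[Q]_p (Y p)%:E = 1%:E)%E.
  have := raw 1%N; under eq_integral do rewrite expr1.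
  by move=> ->; rewrite !big_ord1 !mul0r !addr0 mulr1.
have [E1 E2 E3 E4] := central_from_raw mY Y0 raw1 (raw 2%N) (raw 3%N) (raw 4%N).
have e01 : 0 < e <= 1 by rewrite e0.
have even k : (\int[Q]_p ((Y p - 1) ^+ (2 * k))%:E <= (3 ^+ (2 * k) * (D k + D k + D k * D k) * e ^+ (2 * k))%:E)%E.
  under eq_integral do rewrite YE.
  apply: (product_even_moment mU1 mU2 e01 (D0 k) (D0 k)).
  - by apply: gamma_even_moment => //; rewrite e2.
  - by apply: gamma_even_moment => //; rewrite e2.
have neg : (\int[Q]_p (Y p `^ (- n%:R))%:E <= (2 ^+ n * 2 ^+ n)%:E)%E.
  under eq_integral do rewrite YE.
  rewrite (product_powR _ _ mU1 mU2 U10 U20) EFinM; apply: lee_pmul.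
  - by apply: integral_ge0 => x _; rewrite lee_fin powR_ge0.
  - by apply: integral_ge0 => x _; rewrite lee_fin powR_ge0.
  - by apply: gamma_negative_moment => //; rewrite subr_gt0; lra.
  - by apply: gamma_negative_moment; [exact: le_trans ba|rewrite subr_gt0; lra].
have EY : \int[Q]_p (Y p - 1) = 0 by rewrite E1 subrr.
have [I3 _ HV HW] := HK _ _ Q Y e mY Y0 e01 even neg EY.
rewrite E2 in HV; rewrite E2 E3 E4 in HW.
rewrite !big_ord_recr !big_ord0/= in HV, HW.
set V := Rintegral _ _ _ in HV; set W := Rintegral _ _ _ in HW.
exists V, W; split.
- rewrite (_ : _ - (_ + _) = (V - (s + p)) + p); last by rewrite /s /p /al /be; ring.
  apply: (le_trans (ler_normD _ _)); rewrite [X in _ <= X](_ : _ = K * e ^+ 3 + (1 + B) * e ^+ 3); last by ring.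
  apply: lerD; first by move: HV; congr (`|_| <= _); rewrite /s /p /al /be; ring.
  rewrite ger0_norm//; apply: (le_trans pb).
  have -> : be ^+ 2 = e ^+ 4 by rewrite /be -e2; ring.
  apply: (@le_trans _ _ (e ^+ 3)); first by rewrite ler_wiXn2l// ltW.
  by rewrite ler_peMl ?exprn_ge0 ?(ltW e0)// lerDl.
- pose rem := 6 * (s * p) + 4 * p ^+ 2 + 3 / 2 * c * (22 * (s * p) + 6 * s ^+ 3 + 32 * p ^+ 2 +
    36 * (s ^+ 2 * p) + 66 * (s * p ^+ 2) + 36 * p ^+ 3).
  rewrite (_ : W - _ = (W - ((2 + 3 * c) * s ^+ 2 + 2 * p + rem)) + rem); last by rewrite /s /p /al /be /c; ring.
  apply: (le_trans (ler_normD _ _)); rewrite [X in _ <= X](_ : _ = K * e ^+ 5 + (1 + B) * e ^+ 5); last by ring.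
  apply: lerD.
    move: HW; congr (`|W - _| <= _); rewrite /rem /s /p /al /be /c; field.
    by rewrite !gt_eqF.
  have remb : `|rem| <= B * be ^+ 3 by apply: HB; apply/andP; split.
  apply: (le_trans remb).
  have -> : be ^+ 3 = e ^+ 6 by rewrite /be -e2; ring.
  have e65 : e ^+ 6 <= e ^+ 5 by rewrite ler_wiXn2l// ltW.
  apply: ler_pM => //; rewrite ?exprn_ge0 ?(ltW e0)//.
  by rewrite lerDr.
- move=> V0.
  apply/(has_skewness_law (Y := (@prod_posn R : {RV Q >-> R})) law (measurable_boxcox l)).
  exact: (has_skewness_int (W := fun w => boxcox l (Y w)) mW I3 V0).
- rewrite (skewness_law (Y := (@prod_posn R : {RV Q >-> R})) law (measurable_boxcox l)).
  exact: (skewnessE Q (fun w => boxcox l (Y w))).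
Qed.

End gamma_gamma_expansion.

Section gamma_gamma_skewness.
Context {R : realType}.

Lemma boxcox0 : boxcox 0 = @ln R.
Proof. by apply/funext => x; rewrite /boxcox eqxx. Qed.

(** At l = 0 the leading third moment is -(1/a^2 + 1/b^2) <= -e^4, whatever the ratio a/b; b > (K +
    1)^2 makes the error K e^5 smaller than e^4. *)
Lemma gg_log_skewness : exists M : R, forall a b : R, 0 < b -> b <= a -> M < a -> M < b ->
  forall d (T : measurableType d) (P : probability T R) (X : {RV P >-> R}),
  is_gamma_gamma P X a b ->
  has_skewness P (fun w => ln (X w)) /\ skewness P (fun w => ln (X w)) < 0.
Proof.
have [K [M [K0 M4 H]]] := @gg_expansion R 0.
exists (M + (K + 1) ^+ 2) => a b b0 ba _ Mb d T P X HX.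
have M0 : 0 <= M by apply: le_trans M4.
have K10 : 0 < K + 1 by lra.
have Mb' : M <= b.
  by apply/ltW; apply: le_lt_trans Mb; rewrite lerDl exprn_ge0// ltW.
have Kb : (K + 1) ^+ 2 < b by apply: le_lt_trans Mb; rewrite lerDr.
have [V [W [HV HW hs sE]]] := H a b Mb' ba d T P X HX.
rewrite boxcox0 in hs sE.
move: HV HW; set e := (Num.sqrt b)^-1 => HV HW.
have sb0 : 0 < Num.sqrt b by rewrite sqrtr_gt0.
have e0 : 0 < e by rewrite invr_gt0.
have e2 : b^-1 = e ^+ 2 by rewrite exprVn sqr_sqrtr// ltW.
have Ke : K * e < 1.
  rewrite /e ltr_pdivrMr// mul1r (@lt_trans _ _ (K + 1)) ?ltrDl//.
  by rewrite -(@ltr_pXn2r _ 2)// ?nnegrE ?(ltW sb0) ?(ltW K10)// sqr_sqrtr// ltW.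
have al0 : 0 < a^-1 by rewrite invr_gt0 (lt_le_trans b0).
have V0 : 0 < V by apply: expansion_gt0 e0 Ke _ HV; rewrite e2 lerDr ltW.
split; first exact: hs.
rewrite sE pmulr_llt0 ?invr_gt0 ?powR_gt0//.
have : 0 < e ^+ 4 * (1 - K * e) by rewrite mulr_gt0 ?exprn_gt0// subr_gt0.
rewrite (_ : _ * _ = e ^+ 4 - K * e ^+ 5); last by ring.
move: HW; rewrite e2 ler_norml => /andP[_].
rewrite (_ : (2 + 3 * (0 - 1)) * _ + _ = - (a^-1 ^+ 2 + e ^+ 4)); last by ring.
have : 0 <= a^-1 ^+ 2 by rewrite exprn_ge0// ltW.
by clear; lra.
Qed.

Lemma gg_lstar_bounds (tau : R) : 1 <= tau ->
  6^-1 <= (tau ^+ 2 + 1) / (3 * (tau + 1) ^+ 2) < 3^-1.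
Proof.
move=> t1; have D0 : 0 < 3 * (tau + 1) ^+ 2 by rewrite mulr_gt0// exprn_gt0//; lra.
rewrite ler_pdivlMr// ltr_pdivrMr//; apply/andP; split.
  have : 0 <= (tau - 1) ^+ 2 by rewrite sqr_ge0.
  nra.
nra.
Qed.

(** Along a = tau b one has 1/a + 1/b = v e^2 with v = 1 + 1/tau, and the coefficient of e^4 in the
    third moment is 3 v^2 (l - lstar): its slope in l is not 0, whence uniqueness. *)
Lemma gg_boxcox_limit (tau : R) (d : R -> measure_display)
    (T : forall b : R, measurableType (d b)) (P : forall b : R, probability (T b) R)
    (X : forall b : R, {RV (P b) >-> R}) :
  1 <= tau ->
  (\forall b \near +oo, is_gamma_gamma (P b) (X b) (tau * b) b) ->
  forall l : R,
    (\forall b \near +oo, has_skewness (P b) (fun w => boxcox l (X b w))) /\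
    (Num.sqrt b * skewness (P b) (fun w => boxcox l (X b w)) @[b --> +oo] --> (0 : R) <->
     l = (tau ^+ 2 + 1) / (3 * (tau + 1) ^+ 2)).
Proof.
move=> t1 HX l.
have [K [M [K0 M4 H]]] := @gg_expansion R l.
pose v : R := tau^-1 + 1; pose L : R := (2 + 3 * (l - 1)) * v ^+ 2 + 2 / tau.
have t0 : 0 < tau by lra.
have v0 : 0 < v by rewrite /v addr_gt0// invr_gt0.
pose e b : R := (Num.sqrt b)^-1.
have ce : e b @[b --> +oo] --> (0 : R).
  apply/cvgrPdist_le => eps eps0; near=> b.
  have b0 : 0 < b by near: b; apply: nbhs_pinfty_gt; rewrite num_real.
  rewrite sub0r normrN ger0_norm ?invr_ge0 ?sqrtr_ge0// /e.
  rewrite -[leRHS]invrK lef_pV2 ?posrE ?sqrtr_gt0 ?invr_gt0//.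
  rewrite -(@ler_pXn2r _ 2)// ?nnegrE ?sqrtr_ge0 ?invr_ge0 ?(ltW eps0)// sqr_sqrtr ?(ltW b0)//.
have cKe : \forall b \near +oo, K * e b < 1.
  have : (K * e b) @[b --> +oo] --> (0 : R) by rewrite -(mulr0 K); apply: cvgM => //; exact: cvg_cst.
  by move/cvgr_lt; apply.
have HN : \forall b \near +oo%R, has_skewness (P b) (fun w => boxcox l (X b w)) /\
   (0 < e b /\ exists V W : R,
   [/\ Num.sqrt b * skewness (P b) (fun w => boxcox l (X b w)) = W / V `^ (3 / 2) / e b,
     `|V - v * e b ^+ 2| <= K * e b ^+ 3 & `|W - L * e b ^+ 4| <= K * e b ^+ 5]).
  near=> b.
  have Mb : M <= b by near: b; apply: nbhs_pinfty_ge; rewrite num_real.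
  have b0 : 0 < b by apply: lt_le_trans Mb; apply: lt_le_trans M4.
  have tb : b <= tau * b by rewrite ler_peMl// ltW.
  have HXb : is_gamma_gamma (P b) (X b) (tau * b) b by near: b.
  have [V [W [HV HW hs sE]]] := H _ b Mb tb _ _ _ _ HXb.
  have e2 : b^-1 = e b ^+ 2 by rewrite exprVn sqr_sqrtr// ltW.
  have e0 : 0 < e b by rewrite invr_gt0 sqrtr_gt0.
  rewrite -/(e b) invfM e2 in HV HW.
  have HV' : `|V - v * e b ^+ 2| <= K * e b ^+ 3 by rewrite [v * _]mulrDl mul1r.
  split; last first.
    split=> //; exists V, W; split=> //; first by rewrite sE /e invrK mulrC.
    by move: HW; congr (`|W - _| <= _); rewrite /L /v; ring.
  apply: hs; apply: expansion_gt0 e0 _ _ HV'; last first.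
    have v1 : 1 <= v by rewrite /v lerDr invr_ge0 ltW.
    by rewrite ler_peMl// sqr_ge0.
  by near: b.
split.
  by apply: filterS HN => b [].
rewrite (@skewness_cvg_iff R (+oo%R) _ _ e v L K v0 ce); last by apply: filterS HN => b [].
have -> : L = 3 * v ^+ 2 * (l - (tau ^+ 2 + 1) / (3 * (tau + 1) ^+ 2)).
  by rewrite /L /v; field; apply/andP; split; rewrite gt_eqF//; lra.
split=> [|->]; last by rewrite subrr mulr0.
move/eqP; rewrite mulf_eq0 mulf_eq0 expf_eq0 (gt_eqF v0) andbF pnatr_eq0/= subr_eq0.
by move/eqP.
Unshelve. all: by end_near. Qed.

End gamma_gamma_skewness.

(** * Lognormal-Rician *)

Section lognormal_rician_central_moments.
Context {R : realType}.

(* A bivariate polynomial is given by the list of its [(coefficient, (i, j))]. *)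
Definition eval2 (s : seq (R * (nat * nat))) (x y : R) : R :=
  foldr (fun t acc => t.1 * (x ^+ t.2.1 * y ^+ t.2.2) + acc) 0 s.

(** For 0 <= x, y <= D <= 1 a monomial of total degree at least k is at most D^k. On a concrete list
    the degree condition is decided by computation. *)
Lemma eval2_bound (s : seq (R * (nat * nat))) k : all (fun t => k <= t.2.1 + t.2.2)%N s ->
  exists2 C : R, 0 <= C & forall x y D : R, 0 <= x <= D -> 0 <= y <= D -> D <= 1 ->
    `|eval2 s x y| <= C * D ^+ k.
Proof.
elim: s => [_|[a [i j]] s IH /=].
  by exists 0 => // x y D *; rewrite /eval2 normr0 mul0r.
move=> /andP[kij /IH[C C0 HC]]; exists (`|a| + C); first by rewrite addr_ge0.
move=> x y D hx hy D1; apply: (le_trans (ler_normD _ _)); rewrite mulrDl lerD//; last exact: HC.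
move: hx hy => /andP[x0 xD] /andP[y0 yD].
have D0 : 0 <= D by exact: le_trans xD.
rewrite normrM ler_wpM2l// ger0_norm ?mulr_ge0 ?exprn_ge0//.
apply: (@le_trans _ _ (D ^+ i * D ^+ j)).
  by rewrite ler_pM ?exprn_ge0// lerXn2r ?nnegrE.
by rewrite -exprD ler_wiXn2l.
Qed.

(** With h = Z R - 1, these three lists hold what E h^2, E h^3 and E h^4 - (E h^2)^2 contain beyond
    their leading parts, as polynomials in x = e^(s2) - 1 and u = 1/(1 + r). All degrees are at
    least 2 in the first list and 3 in the others. *)
Definition lr_second_tail : seq (R * (nat * nat)) := [:: (- 1, (0, 2)%N); (2, (1, 1)%N); (- 1, (1, 2)%N)].

Definition lr_third_tail : seq (R * (nat * nat)) :=
  [:: (- 4, (0, 3)%N); (12, (1, 2)%N); (- 12, (1, 3)%N); (18, (2, 1)%N); (9, (2, 2)%N); (- 12, (2, 3)%N);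
      (1, (3, 0)%N); (6, (3, 1)%N); (3, (3, 2)%N); (- 4, (3, 3)%N)].

Definition lr_fourth_tail : seq (R * (nat * nat)) :=
  [:: (16, (0, 3)%N); (- 16, (0, 4)%N); (132, (1, 2)%N); (32, (1, 3)%N); (- 92, (1, 4)%N); (104, (2, 1)%N);
      (412, (2, 2)%N); (- 8, (2, 3)%N); (- 226, (2, 4)%N); (16, (3, 0)%N); (216, (3, 1)%N); (588, (3, 2)%N);
      (- 64, (3, 3)%N); (- 300, (3, 4)%N); (15, (4, 0)%N); (180, (4, 1)%N); (450, (4, 2)%N); (- 60, (4, 3)%N);
      (- 225, (4, 4)%N); (6, (5, 0)%N); (72, (5, 1)%N); (180, (5, 2)%N); (- 24, (5, 3)%N); (- 90, (5, 4)%N);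
      (1, (6, 0)%N); (12, (6, 1)%N); (30, (6, 2)%N); (- 4, (6, 3)%N); (- 15, (6, 4)%N)].

Section moments.
Variables (x u : R).
(** E Z^k = w^(k(k-1)/2), whence the powers 1, 3 and 6; the polynomials in u are the moments of the
    Rician factor. *)
Let w := 1 + x.
Let M2 := w * (1 + 2 * u - u ^+ 2).
Let M3 := w ^+ 3 * (1 + 6 * u + 3 * u ^+ 2 - 4 * u ^+ 3).
Let M4 := w ^+ 6 * (1 + 12 * u + 30 * u ^+ 2 - 4 * u ^+ 3 - 15 * u ^+ 4).
Let m2 := M2 - 2 * 1 + 1.
Let m3 := M3 - 3 * M2 + 3 * 1 - 1.
Let m4 := M4 - 4 * M3 + 6 * M2 - 4 * 1 + 1.

Lemma lr_second_momentE : m2 = 2 * u + x + eval2 lr_second_tail x u.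
Proof. rewrite /m2 /M2 /w /eval2 /lr_second_tail /=; ring. Qed.

Lemma lr_third_momentE : m3 = 3 * (2 * u + x) ^+ 2 - 6 * u ^+ 2 + eval2 lr_third_tail x u.
Proof. rewrite /m3 /M2 /M3 /w /eval2 /lr_third_tail /=; ring. Qed.

Lemma lr_fourth_momentE : m4 - m2 ^+ 2 = 2 * (2 * u + x) ^+ 2 + eval2 lr_fourth_tail x u.
Proof. rewrite /m4 /m2 /M2 /M3 /M4 /w /eval2 /lr_fourth_tail /=; ring. Qed.
End moments.

Lemma expR_sub1_bounds (s : R) : 0 <= s <= 4^-1 -> s <= expR s - 1 <= s + 2 * s ^+ 2.
Proof.
move=> /andP[s0 s1]; rewrite lerBrDl expR_ge1Dx/=.
have h : 1 - s <= expR (- s) by exact: expR_ge1Dx.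
have h1 : 0 < 1 - s by lra.
have : expR s <= (1 - s)^-1 by rewrite -[expR s]invrK -expRN lef_pV2 ?posrE ?expR_gt0.
have : (1 - s)^-1 <= 1 + s + 2 * s ^+ 2.
  rewrite -[leLHS]mul1r ler_pdivrMr//.
  rewrite [leRHS](_ : _ = 1 + s ^+ 2 * (1 - 2 * s)); last by ring.
  by rewrite lerDl mulr_ge0 ?sqr_ge0//; lra.
clear; lra.
Qed.

End lognormal_rician_central_moments.

Section lognormal_rician_raw.
Context {R : realType} (r s2 : R) (r0 : 0 < r) (s20 : 0 < s2).
Let Q := lr_law r0 s20.
Let u := (1 + r)^-1.
Let w := expR s2.
Let r1 : 1 + r != 0. Proof. by rewrite gt_eqF// addr_gt0. Qed.
Let rE : r = u^-1 - 1. Proof. by rewrite /u invrK addrAC subrr add0r. Qed.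
Let u0 : u != 0. Proof. by rewrite invr_neq0. Qed.

Lemma rician_law_raw :
  [/\ (\int[rician_law r0]_y (posn y)%:E = 1%:E)%E,
      (\int[rician_law r0]_y (posn y ^+ 2)%:E = (1 + 2 * u - u ^+ 2)%:E)%E,
      (\int[rician_law r0]_y (posn y ^+ 3)%:E = (1 + 6 * u + 3 * u ^+ 2 - 4 * u ^+ 3)%:E)%E &
      (\int[rician_law r0]_y (posn y ^+ 4)%:E =
         (1 + 12 * u + 30 * u ^+ 2 - 4 * u ^+ 3 - 15 * u ^+ 4)%:E)%E].
Proof.
have [E1 E2 E3 E4] := rician_law_expr r0.
by split=> //; rewrite ?(E2, E3, E4) /u; congr (_%:E); field.
Qed.

Lemma lr_law_expr k : (\int[Q]_p (prod_posn p ^+ k)%:E =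
  (expR (s2 * k%:R * (k%:R - 1) / 2))%:E * \int[rician_law r0]_y (posn y ^+ k)%:E)%E.
Proof.
rewrite -(@lognormal_law_expr _ _ s20).
exact: (product_expr (lognormal_law s20) (rician_law r0) (@measurable_posn R) (@measurable_posn R)
  (@posn_gt0 R) (@posn_gt0 R)).
Qed.

Lemma lr_law_powR q : (\int[Q]_p (prod_posn p `^ q)%:E =
  (expR (s2 * q * (q - 1) / 2))%:E * \int[rician_law r0]_y (posn y `^ q)%:E)%E.
Proof.
rewrite -(@lognormal_law_powR _ _ s20).
exact: (product_powR (lognormal_law s20) (rician_law r0) (@measurable_posn R) (@measurable_posn R)
  (@posn_gt0 R) (@posn_gt0 R)).
Qed.

Lemma prod_posn_gt0 (p : R * R) : 0 < prod_posn p.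
Proof. by rewrite mulr_gt0// posn_gt0. Qed.

Lemma lr_law_central : let x := w - 1 in
  [/\ \int[Q]_p (prod_posn p - 1) = 0,
    \int[Q]_p (prod_posn p - 1) ^+ 2 = 2 * u + x + eval2 lr_second_tail x u,
    \int[Q]_p (prod_posn p - 1) ^+ 3 = 3 * (2 * u + x) ^+ 2 - 6 * u ^+ 2 + eval2 lr_third_tail x u &
    \int[Q]_p (prod_posn p - 1) ^+ 4 - (\int[Q]_p (prod_posn p - 1) ^+ 2) ^+ 2 =
      2 * (2 * u + x) ^+ 2 + eval2 lr_fourth_tail x u].
Proof.
move=> x; have [A1 A2 A3 A4] := rician_law_raw.
have wE k m : s2 * k%:R * (k%:R - 1) / 2 = m%:R * s2 -> expR (s2 * k%:R * (k%:R - 1) / 2) = (1 + x) ^+ m.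
  by move=> ->; rewrite expRM_natl /x addrC subrK.
have E1 : (\int[Q]_p (prod_posn p)%:E = 1%:E)%E.
  have := lr_law_expr 1; under eq_integral do rewrite expr1.
  move=> ->; under eq_integral do rewrite expr1.
  by rewrite A1 (wE 1%N 0%N) ?mule1//; field.
have E2 := lr_law_expr 2; rewrite A2 (wE 2%N 1%N) ?expr1 -?EFinM in E2; last by field.
have E3 := lr_law_expr 3; rewrite A3 (wE 3%N 3%N) -?EFinM in E3; last by field.
have E4 := lr_law_expr 4; rewrite A4 (wE 4%N 6%N) -?EFinM in E4; last by field.
have [H1 H2 H3 H4] := central_from_raw (@measurable_prod_posn R) prod_posn_gt0 E1 E2 E3 E4.
split; first by rewrite H1 subrr.
- by rewrite H2 lr_second_momentE.
- by rewrite H3 lr_third_momentE.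
- by rewrite H4 H2 lr_fourth_momentE.
Qed.

End lognormal_rician_raw.

Section lognormal_rician_expansion.
Context {R : realType}.

(** Replacing x by s2 costs O(V0^2), so 2 u + x may be read as V0 in the leading terms. The
    lognormal factor satisfies E h^3 = 3 (E h^2)^2 to leading order; -6 u^2 is the deficit of the
    Rician factor against this relation. *)
Lemma lr_moment_expansion (c : R) : exists2 K : R, 0 <= K & forall s2 u V0 : R,
  0 < s2 -> 0 < u -> V0 = s2 + 2 * u -> V0 <= 4^-1 ->
  let x := expR s2 - 1 in
  let m2 := 2 * u + x + eval2 lr_second_tail x u in
  let m3 := 3 * (2 * u + x) ^+ 2 - 6 * u ^+ 2 + eval2 lr_third_tail x u in
  let J := 2 * (2 * u + x) ^+ 2 + eval2 lr_fourth_tail x u in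
  `|m2 - V0| <= K * V0 ^+ 2 /\
  `|m3 + 3 / 2 * c * J - (3 * (c + 1) * V0 ^+ 2 - 6 * u ^+ 2)| <= K * V0 ^+ 3.
Proof.
have [C2 C20 H2] := @eval2_bound R lr_second_tail 2 erefl.
have [C3 C30 H3] := @eval2_bound R lr_third_tail 3 erefl.
have [C4 C40 H4] := @eval2_bound R lr_fourth_tail 3 erefl.
have c1 := normr_ge0 c.
have cC : 0 <= `|c| * C4 by rewrite mulr_ge0.
exists (2 + 4 * C2 + (18 * (`|c| + 1) + 8 * C3 + 12 * (`|c| * C4))); first by lra.
move=> s2 u V0 s20 u0 V0E V0le x m2 m3 J.
have s2V : s2 <= V0 by rewrite V0E; lra.
have uV : u <= V0 by rewrite V0E; lra.
have V00 : 0 < V0 by apply: lt_le_trans s2V.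
have /andP[xl xu] : s2 <= x <= s2 + 2 * s2 ^+ 2 by apply: expR_sub1_bounds; apply/andP; split; lra.
have s22 : s2 ^+ 2 <= V0 ^+ 2 by rewrite lerXn2r ?nnegrE ?(ltW s20) ?(ltW V00).
have V02 : V0 ^+ 2 <= 4^-1 * V0 by rewrite expr2 ler_wpM2r// ltW.
(* The tails are bounded with D = 2 V0, because x <= s2 + 2 s2^2 may exceed V0 but not 2 V0. *)
have xD : 0 <= x <= 2 * V0 by apply/andP; split; lra.
have uD : 0 <= u <= 2 * V0 by apply/andP; split; lra.
have D1 : 2 * V0 <= 1 by lra.
have T2 := H2 x u _ xD uD D1; have T3 := H3 x u _ xD uD D1; have T4 := H4 x u _ xD uD D1.
rewrite exprMn in T2; rewrite !exprMn in T3 T4.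
have V20 : 0 <= V0 ^+ 2 by rewrite exprn_ge0// ltW.
have V30 : 0 <= V0 ^+ 3 by rewrite exprn_ge0// ltW.
have pV20 : 0 <= C2 * V0 ^+ 2 by rewrite mulr_ge0.
have pV30 : 0 <= C3 * V0 ^+ 3 by rewrite mulr_ge0.
have pV40 : 0 <= `|c| * C4 * V0 ^+ 3 by rewrite mulr_ge0.
have pc2 : 0 <= `|c| * V0 ^+ 2 by rewrite mulr_ge0.
have p32 : 0 <= C3 * V0 ^+ 2 by rewrite mulr_ge0.
have p42 : 0 <= `|c| * C4 * V0 ^+ 2 by rewrite mulr_ge0.
have p23 : 0 <= C2 * V0 ^+ 3 by rewrite mulr_ge0.
set y := x - s2; have y0 : 0 <= y by rewrite /y subr_ge0.
have y2 : y <= 2 * V0 ^+ 2 by rewrite /y; lra.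
split.
  rewrite (_ : m2 - V0 = y + eval2 lr_second_tail x u); last by rewrite /m2 V0E /y; ring.
  apply: (le_trans (ler_normD _ _)); rewrite (ger0_norm y0).
  move: T2; set E := `|_|; clear -y2 pV20 pV30 pV40 pc2 p32 p42 V20; lra.
pose z := 2 * V0 * y + y ^+ 2.
have z0 : 0 <= z by rewrite addr_ge0 ?exprn_ge0// !mulr_ge0// ltW.
have zu : z <= 6 * V0 ^+ 3.
  have a1 : 2 * V0 * y <= 4 * V0 ^+ 3.
    by rewrite (_ : 4 * _ = 2 * V0 * (2 * V0 ^+ 2)); [rewrite ler_wpM2l// mulr_ge0// ltW|ring].
  have a2 : y ^+ 2 <= (2 * V0 ^+ 2) ^+ 2 by rewrite lerXn2r ?nnegrE// mulr_ge0.
  have a3 : (2 * V0 ^+ 2) ^+ 2 <= V0 ^+ 3.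
    rewrite (_ : _ ^+ 2 = 4 * V0 * V0 ^+ 3); last by ring.
    by rewrite ler_piMl//; lra.
  rewrite /z; lra.
have -> : m3 + 3 / 2 * c * J - (3 * (c + 1) * V0 ^+ 2 - 6 * u ^+ 2) =
    3 * ((c + 1) * z) + eval2 lr_third_tail x u + (3 / 2) * (c * eval2 lr_fourth_tail x u).
  by rewrite /m3 /J (_ : x = s2 + y) /z ?V0E; [field|rewrite /y; ring].
have b1 : `|(c + 1) * z| <= (`|c| + 1) * (6 * V0 ^+ 3).
  rewrite normrM (ger0_norm z0) ler_pM//.
  by apply: (le_trans (ler_normD _ _)); rewrite normr1.
have b2 : `|c * eval2 lr_fourth_tail x u| <= `|c| * (C4 * (2 ^+ 3 * V0 ^+ 3)).
  by rewrite normrM ler_wpM2l.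
apply: (le_trans (ler_normD _ _)); apply: (le_trans (lerD (ler_normD _ _) (lexx _))).
rewrite normrM [`|3 / 2 * _|]normrM (ger0_norm (_ : 0 <= 3 / 2)) ?(ger0_norm (_ : 0 <= 3)); [|lra|lra].
move: T3 b1 b2; set E1 := `|_|; set E2 := `|_|; set E3 := `|_|.
clear -pV20 pV30 pV40 pc2 p32 p42 V20 V30 p23; lra.
Qed.

(** Since 1/(1 + r) = rho V0, the leading third moment 3 l V0^2 - 6/(1 + r)^2 is (3 l - 6 rho^2)
    V0^2, and e^2 = V0. *)
Lemma lr_expansion (l : R) : - 3^-1 < l -> exists2 K : R, 0 <= K &
  forall r s2 : R, 0 < r -> 0 < s2 -> lr_V0 r s2 <= 4^-1 ->
  forall d (T : measurableType d) (P : probability T R) (X : {RV P >-> R}),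
  is_lognormal_rician P X r s2 ->
  let e := Num.sqrt (lr_V0 r s2) in
  exists V W : R,
  [/\ `|V - e ^+ 2| <= K * e ^+ 3,
    `|W - (3 * l - 6 * lr_rho r s2 ^+ 2) * e ^+ 4| <= K * e ^+ 5,
    0 < V -> has_skewness P (fun w => boxcox l (X w)) &
    skewness P (fun w => boxcox l (X w)) = W / V `^ (3 / 2)].
Proof.
move=> l3.
(* The midpoint between max(0, -3 l) and 1: the delta method needs q > -3 l, the Rician factor q <
   1. The interval is nonempty precisely because l > -1/3. *)
pose q : R := (Num.max 0 (- (3 * l)) + 1) / 2.
have m0 : 0 <= Num.max 0 (- (3 * l)) by rewrite le_max lexx.
have m1 : Num.max 0 (- (3 * l)) < 1 by rewrite gt_max ltr01/=; lra.
have ml : - (3 * l) <= Num.max 0 (- (3 * l)) by rewrite le_max lexx orbT.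
have q0 : 0 < q by rewrite /q; lra.
have q1 : q < 1 by rewrite /q; lra.
have lq : - (3 * l) < q by apply: le_lt_trans ml _; rewrite /q; lra.
pose D1 k : R := 4 * 2 ^+ (2 * k) * expR (8 * k%:R ^+ 2 + 2 * k%:R).
pose D2 k : R := (2 * k)`!%:R * (2 * (2 * expR 3)).
have D10 k : 0 <= D1 k by rewrite !mulr_ge0 ?expR_ge0 ?exprn_ge0.
have D20 k : 0 <= D2 k by rewrite !mulr_ge0 ?expR_ge0.
have [K K0 HK] := @boxcox_delta R l q (fun k => 3 ^+ (2 * k) * (D1 k + D2 k + D1 k * D2 k))
  (expR 1 * (Gam (1 - q) + 5)) q0 lq.
have [B B0 HB] := lr_moment_expansion (l - 1).
exists (K + B); first by rewrite addr_ge0.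
move=> r s2 r0 s20 V4 d T P X HX e.
pose u := (1 + r)^-1.
have s0 : 0 < 1 + r by rewrite addr_gt0.
have u0 : 0 < u by rewrite invr_gt0.
have V0E : lr_V0 r s2 = s2 + 2 * u by [].
have V00 : 0 < lr_V0 r s2 by rewrite V0E; clear -u0 s20; lra.
have e0 : 0 < e by rewrite sqrtr_gt0.
have e2 : e ^+ 2 = lr_V0 r s2 by rewrite sqr_sqrtr// ltW.
have e1 : e <= 1 by rewrite -(@ler_pXn2r _ 2)// ?nnegrE ?(ltW e0)// e2 expr1n; clear -V4; lra.
have e01 : 0 < e <= 1 by rewrite e0.
have s2e : s2 <= e ^+ 2 by rewrite e2 V0E; clear -u0; lra.
have ue : u <= e ^+ 2 by rewrite e2 V0E; clear -u0 s20; lra.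
have s21 : s2 <= 1 by rewrite (le_trans s2e)// expr_le1// ltW.
have r8 : 8 <= 1 + r.
  rewrite -(@invrK _ (1 + r)) -/u -[8]invrK lef_pV2 ?posrE ?invr_gt0//.
  by move: V4; rewrite V0E; clear -u0 s20; lra.
pose Q := lr_law r0 s20; pose Y : R * R -> R := @prod_posn R.
have mY : meas (R * R) Y by exact: measurable_prod_posn.
have Y0 p : 0 < Y p by exact: prod_posn_gt0.
have mW : meas (R * R) (fun w => boxcox l (Y w)).
  exact: (measurableT_comp (measurable_boxcox l) mY).
have law := lognormal_rician_law r0 s20 HX.
have even k : (\int[Q]_p ((Y p - 1) ^+ (2 * k))%:E <=
    (3 ^+ (2 * k) * (D1 k + D2 k + D1 k * D2 k) * e ^+ (2 * k))%:E)%E.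
  apply: (product_even_moment (@measurable_posn R) (@measurable_posn R) e01 (D10 k) (D20 k)).
  - exact: lognormal_even_moment.
  - by apply: rician_even_moment => //; clear -r8; lra.
have neg : (\int[Q]_p (Y p `^ (- q))%:E <= (expR 1 * (Gam (1 - q) + 5))%:E)%E.
  rewrite lr_law_powR EFinM; apply: lee_pmul.
  - by rewrite lee_fin expR_ge0.
  - by apply: integral_ge0 => y _; rewrite lee_fin powR_ge0.
  - rewrite lee_fin ler_expR.
    have s24 : s2 <= 4^-1 by apply: le_trans V4; rewrite V0E; clear -u0; lra.
    rewrite (_ : s2 * - q * (- q - 1) / 2 = s2 * (q * (q + 1) / 2)); last by field.
    apply: mulr_ile1; rewrite ?(ltW s20)//; nra.
  - by apply: rician_negative_moment; rewrite ?q0//; clear -r8; lra.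
have [C1 C2 C3 C4] := lr_law_central r0 s20.
have [I3 _ HV HW] := HK _ _ Q Y e mY Y0 e01 even neg C1.
have [B2 B3] := HB s2 u _ s20 u0 V0E V4.
rewrite C3 C4 in HW; rewrite C2 in HV.
move: HV HW; rewrite -/u; set V := Rintegral _ _ _; set W := Rintegral _ _ _ => HV HW.
exists V, W; split.
- apply: (le_trans (ler_distD (2 * u + (expR s2 - 1) + eval2 lr_second_tail (expR s2 - 1) u) _ _)).
  rewrite [leRHS]mulrDl; apply: lerD; first exact: HV.
  rewrite e2; apply: (le_trans B2); rewrite -e2 -exprM.
  by rewrite ler_wpM2l// ler_wiXn2l// ltW.
- have rhoE : lr_rho r s2 ^+ 2 * e ^+ 4 = u ^+ 2.
    rewrite (_ : e ^+ 4 = (e ^+ 2) ^+ 2); last by ring.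
    rewrite e2 /lr_rho /u; field.
    by rewrite (gt_eqF s0) (gt_eqF V00).
  rewrite mulrBl -mulrA -[6 * _ * _]mulrA rhoE.
  move: HW; set m3 := (X in `|W - X|) => HW.
  apply: (le_trans (ler_distD m3 _ _)).
  rewrite [leRHS]mulrDl; apply: lerD; first exact: HW.
  have : B * lr_V0 r s2 ^+ 3 <= B * e ^+ 5.
    by rewrite -e2 -exprM ler_wpM2l// ler_wiXn2l// ltW.
  apply: le_trans; apply: le_trans B3.
  rewrite /m3 subrK -e2 -exprM mulrA; exact: lexx.
- move=> Vp.
  apply/(has_skewness_law (Y := (@prod_posn R : {RV Q >-> R})) law (measurable_boxcox l)).
  exact: (has_skewness_int (W := fun w => boxcox l (Y w)) mW I3 Vp).
- rewrite (skewness_law (Y := (@prod_posn R : {RV Q >-> R})) law (measurable_boxcox l)).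
  exact: (skewnessE Q (fun w => boxcox l (Y w))).
Qed.

End lognormal_rician_expansion.

Section lognormal_rician_skewness.
Context {R : realType}.

Lemma lr_rhoE (r s2 : R) : 0 < r -> 0 < s2 ->
  lr_rho r s2 = (2 + (1 + r) * s2)^-1 /\ 0 < lr_rho r s2 < 2^-1.
Proof.
move=> r0 s20; have s0 : 0 < 1 + r by rewrite addr_gt0.
have p0 : 0 < (1 + r) * s2 by rewrite mulr_gt0.
have -> : lr_rho r s2 = (2 + (1 + r) * s2)^-1.
  by rewrite /lr_rho /lr_V0; congr (_^-1); field; rewrite gt_eqF.
split=> //; rewrite invr_gt0 ltf_pV2 ?posrE//; last by lra.
by apply/andP; split; lra.
Qed.

(* The density of the Rician factor is positive at [0], so [X^-1] is not integrable. *)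
Lemma lr_not_has_skewness (l r s2 : R) d (T : measurableType d) (P : probability T R)
    (X : {RV P >-> R}) : 0 < r -> 0 < s2 -> is_lognormal_rician P X r s2 ->
  has_skewness P (fun w => boxcox l (X w)) -> - 3^-1 < l.
Proof.
move=> r0 s20 HX; rewrite ltNge; apply: contraPN => l3.
have law := lognormal_rician_law r0 s20 HX.
pose Q := lr_law r0 s20; pose Y : R * R -> R := @prod_posn R.
move/(has_skewness_law (Y := (@prod_posn R : {RV Q >-> R})) law (measurable_boxcox l)) => -[].
rewrite expectation.unlock => + _.
have Y0 p : 0 < Y p by exact: prod_posn_gt0.
have mY : meas (R * R) Y by exact: measurable_prod_posn.
pose W p := boxcox l (Y p).
have mW : meas (R * R) W.
  exact: (measurableT_comp (measurable_boxcox l) mY).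
have l0 : l != 0 by rewrite lt_eqF//; lra.
have : (\int[Q]_p (Y p `^ (- 1))%:E = +oo)%E.
  rewrite lr_law_powR rician_negative_moment1 mulry gtr0_sg ?mul1e//.
  exact: expR_gt0.
(* For Y < 1, Y^-1 <= Y^(3 l) = (1 + l W)^3 because 3 l <= -1; moreover (1 + z)^3 <= 5 + 4 z^3 for z
   >= 0. *)
have bound p : Y p `^ (- 1) <= 5 + 4 * `|l| ^+ 3 * `|W p| ^+ 3.
  have t0 : 0 <= `|l| ^+ 3 * `|W p| ^+ 3 by rewrite mulr_ge0 ?exprn_ge0.
  have [Y1|Y1] := leP 1 (Y p).
    apply: (@le_trans _ _ 1); last by rewrite -mulrA; lra.
    by rewrite powR_inv1 ?(ltW (Y0 p))// invf_le1.
  apply: (@le_trans _ _ (Y p `^ (l * 3))).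
    by apply: ger_powR; [rewrite Y0 ltW|lra].
  have YW : Y p `^ l = 1 + l * W p by rewrite /W /boxcox (negbTE l0); field.
  rewrite powRrM powR_mulrn ?powR_ge0// -mulrA -exprMn -normrM.
  apply: (@le_trans _ _ ((1 + `|l * W p|) ^+ 3)).
    have h : Y p `^ l <= 1 + `|l * W p| by rewrite YW lerD2l ler_norm.
    by apply: lerXn2r h; rewrite nnegrE ?powR_ge0 ?addr_ge0.
  set z := `|_|; have z0 : 0 <= z by exact: normr_ge0.
  rewrite -subr_ge0 (_ : _ - _ = 1 + 3 * (z + 1) * (z - 1) ^+ 2); last by ring.
  by rewrite addr_ge0// mulr_ge0 ?sqr_ge0// mulr_ge0// addr_ge0.
move=> Einf Efin.
suff : (\int[Q]_p (Y p `^ (- 1))%:E < +oo)%E by rewrite Einf ltxx.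
apply: (@le_lt_trans _ _ (\int[Q]_p (5%:E + (4 * `|l| ^+ 3)%:E * (`|W p| ^+ 3)%:E))%E).
  apply: ge0_le_integral => //.
  - by move=> p _; rewrite lee_fin powR_ge0.
  - by apply/measurable_EFinP; exact: (measurableT_comp (measurable_powR _) mY).
  - apply/measurable_EFinP; apply: measurable_funD => //; apply: measurable_funM => //.
    by apply: measurable_funX; exact: measurableT_comp.
  - by move=> p _; rewrite -EFinM -EFinD lee_fin.
have mW3 : meas (R * R) (fun p => (`|W p| ^+ 3)%:E).
  by apply/measurable_EFinP; apply: measurable_funX; exact: measurableT_comp.
rewrite ge0_integralD//; last exact: measurable_funeM.
rewrite integral_cst// ge0_integralZl_EFin//.
rewrite lte_add_pinfty// ?lte_mul_pinfty ?lee_fin ?mulr_ge0 ?exprn_ge0//.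
by apply: (@le_lt_trans _ _ 1%E); [exact: probability_le1|rewrite ltry].
Qed.

(** Existence of the skewness is part of the criterion, since [skewness] is a conventional value
    otherwise. For l <= -1/3 both sides fail: the skewness does not exist, and 2 rho^2 >= 0. Above
    -1/3 the leading coefficient is 3 (l - 2 rho^2). *)
Lemma lr_boxcox_limit (rho : R) (d : R -> measure_display)
    (T : forall v : R, measurableType (d v)) (P : forall v : R, probability (T v) R)
    (X : forall v : R, {RV (P v) >-> R}) (r s2 : R -> R) :
  (\forall v \near 0^'+,
     [/\ 0 < r v, 0 < s2 v, lr_V0 (r v) (s2 v) = v, lr_rho (r v) (s2 v) = rho &
         is_lognormal_rician (P v) (X v) (r v) (s2 v)]) ->
  forall l : R,
    ((\forall v \near 0^'+, has_skewness (P v) (fun w => boxcox l (X v w))) /\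
     skewness (P v) (fun w => boxcox l (X v w)) / Num.sqrt v @[v --> 0^'+] --> (0 : R)) <->
    l = 2 * rho ^+ 2.
Proof.
move=> H l.
have [l3|l3] := leP l (- 3^-1).
  split=> [[Hs _]|lE]; last first.
    by move: l3; rewrite lE; have := sqr_ge0 rho; lra.
  (* The filter of right neighbourhoods of 0 is proper, so some v satisfies both eventual
     properties. *)
  have [v [] [r0 s20 _ _ HX] Hv] := @filter_ex _ ((0 : R)^'+) _ _ (filterI H Hs).
  by have := lr_not_has_skewness r0 s20 HX Hv; rewrite ltNge l3.
have [K K0 HK] := lr_expansion l3.
pose L := 3 * l - 6 * rho ^+ 2; pose e (v : R) : R := Num.sqrt v.
have ce : e v @[v --> 0^'+] --> (0 : R).
  apply/cvgrPdist_le => eps eps0; near=> v.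
  have v0 : 0 < v by near: v; exact: nbhs_right_gt.
  rewrite sub0r normrN ger0_norm ?sqrtr_ge0//.
  rewrite -(@ler_pXn2r _ 2)// ?nnegrE ?sqrtr_ge0 ?(ltW eps0)// sqr_sqrtr ?(ltW v0)//.
  by near: v; apply: nbhs_right_le; rewrite exprn_gt0.
have cKe : \forall v \near (0 : R)^'+, K * e v < 1.
  have : (K * e v) @[v --> 0^'+] --> (0 : R) by rewrite -[X in _ --> X](mulr0 K); apply: cvgM => //; exact: cvg_cst.
  by move/cvgr_lt; apply.
have HN : \forall v \near (0 : R)^'+, has_skewness (P v) (fun w => boxcox l (X v w)) /\
   (0 < e v /\ exists V W : R,
   [/\ skewness (P v) (fun w => boxcox l (X v w)) / Num.sqrt v = W / V `^ (3 / 2) / e v,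
     `|V - 1 * e v ^+ 2| <= K * e v ^+ 3 & `|W - L * e v ^+ 4| <= K * e v ^+ 5]).
  near=> v.
  have v0 : 0 < v by near: v; exact: nbhs_right_gt.
  have v4 : v <= 4^-1 by near: v; exact: nbhs_right_le.
  have [r0 s20 V0E rE HX] : [/\ 0 < r v, 0 < s2 v, lr_V0 (r v) (s2 v) = v, lr_rho (r v) (s2 v) = rho &
         is_lognormal_rician (P v) (X v) (r v) (s2 v)] by near: v.
  have [|V [W [HV HW hs sE]]] := HK _ _ r0 s20 _ _ _ _ _ HX; first by rewrite V0E.
  rewrite V0E rE -/L -/(e v) in HV HW.
  have e0 : 0 < e v by rewrite sqrtr_gt0.
  split; last by split=> //; exists V, W; rewrite mul1r sE.
  by apply: hs; apply: expansion_gt0 e0 _ _ HV => //; near: v.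
have := @skewness_cvg_iff R (0^'+) _ _ e 1 L K ltr01 ce (filterS (fun v h => proj2 h) HN).
have -> : (L = 0) <-> (l = 2 * rho ^+ 2) by rewrite /L; split=> [|->]; lra.
move=> <-; split=> [[]//|h]; split=> //.
by apply: filterS HN => v [].
Unshelve. all: by end_near. Qed.

Lemma lr_lstarE (rho r s2 : R) : 0 < r -> 0 < s2 -> lr_rho r s2 = rho ->
  2 * rho ^+ 2 = 2 / (2 + (1 + r) * s2) ^+ 2.
Proof. by move=> r0 s20 <-; have [-> _] := lr_rhoE r0 s20; rewrite exprVn. Qed.

End lognormal_rician_skewness.

(** * The log-skewness of Lognormal-Rician *)

Section shift.
Context {R : realType} d (T : measurableType d) (P : probability T R).

Lemma int_shift_expr (W : T -> R) (c : R) :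
  (forall k, (k <= 3)%N -> intg P (fun w => W w ^+ k)) ->
  forall k, (k <= 3)%N -> intg P (fun w => (W w + c) ^+ k).
Proof.
move=> iW; have i1 := iW 1%N erefl; have i2 := iW 2%N erefl; have i3 := iW 3%N erefl.
pose f a0 a1 a2 a3 w := a0 + a1 * W w ^+ 1 + a2 * W w ^+ 2 + a3 * W w ^+ 3.
have F a0 a1 a2 a3 : intg P (f a0 a1 a2 a3).
  exact: (intD (intD (intD (int_cst P a0) (intZ a1 i1)) (intZ a2 i2)) (intZ a3 i3)).
case=> [|[|[|[|//]]]] _.
- exact: int_cst.
- by rewrite (_ : (fun w => _) = f c 1 0 0)//; apply/funext => w; rewrite /f; ring.
- by rewrite (_ : (fun w => _) = f (c ^+ 2) (2 * c) 1 0)//; apply/funext => w; rewrite /f; ring.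
- by rewrite (_ : (fun w => _) = f (c ^+ 3) (3 * c ^+ 2) (3 * c) 1)//; apply/funext => w; rewrite /f; ring.
Qed.

End shift.

Section independent_sum.
Context {R : realType} (mu nu : probability R R).

(** Third central moments of independent variables add: the mixed terms of the cube carry a factor E
    V or E D, both 0. *)
Lemma independent_sum_moments (V D : R -> R) :
  (forall k, (k <= 3)%N -> intg mu (fun x => V x ^+ k)) ->
  (forall k, (k <= 3)%N -> intg nu (fun y => D y ^+ k)) ->
  \int[mu]_x V x = 0 -> \int[mu]_x V x ^+ 3 = 0 -> \int[nu]_y D y = 0 ->
  [/\ forall k, (k <= 3)%N -> intg (mu \x nu)%E (fun p => (V p.1 + D p.2) ^+ k),
    \int[(mu \x nu)%E]_p (V p.1 + D p.2) = 0,
    \int[(mu \x nu)%E]_p (V p.1 + D p.2) ^+ 2 = \int[mu]_x V x ^+ 2 + \int[nu]_y D y ^+ 2 &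
    \int[(mu \x nu)%E]_p (V p.1 + D p.2) ^+ 3 = \int[nu]_y D y ^+ 3].
Proof.
move=> iV iD V1 V3 D1.
have V1' : \int[mu]_x V x ^+ 1 = 0 by rewrite -V1.
have D1' : \int[nu]_y D y ^+ 1 = 0 by rewrite -D1.
have one (P : probability R R) (f : R -> R) : \int[P]_x f x ^+ 0 = 1.
  by under eq_Rintegral do rewrite expr0; rewrite Rintegral_cst1.
pose t i j (p : R * R) := V p.1 ^+ i * D p.2 ^+ j.
have T i j : (i <= 3)%N -> (j <= 3)%N -> intg (mu \x nu)%E (t i j) /\
    \int[(mu \x nu)%E]_p t i j p = (\int[mu]_x V x ^+ i) * \int[nu]_y D y ^+ j.
  by move=> i3 j3; exact: (product_integrable (iV i i3) (iD j j3)).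
have [i10 E10] := T 1%N 0%N erefl erefl; have [i01 E01] := T 0%N 1%N erefl erefl.
have [i20 E20] := T 2%N 0%N erefl erefl; have [i11 E11] := T 1%N 1%N erefl erefl.
have [i02 E02] := T 0%N 2%N erefl erefl; have [i30 E30] := T 3%N 0%N erefl erefl.
have [i21 E21] := T 2%N 1%N erefl erefl; have [i12 E12] := T 1%N 2%N erefl erefl.
have [i03 E03] := T 0%N 3%N erefl erefl.
have S1 : (fun p => V p.1 + D p.2) = (fun p => t 1%N 0%N p + t 0%N 1%N p).
  by apply/funext => p; rewrite /t; ring.
have S2 : (fun p => (V p.1 + D p.2) ^+ 2) = (fun p => t 2%N 0%N p + 2 * t 1%N 1%N p + t 0%N 2%N p).
  by apply/funext => p; rewrite /t; ring.
have S3 : (fun p => (V p.1 + D p.2) ^+ 3) =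
    (fun p => t 3%N 0%N p + 3 * t 2%N 1%N p + 3 * t 1%N 2%N p + t 0%N 3%N p).
  by apply/funext => p; rewrite /t; ring.
have j11 := intZ 2 i11; have k11 := intD i20 j11.
have j21 := intZ 3 i21; have j12 := intZ 3 i12.
have k21 := intD i30 j21; have k12 := intD k21 j12.
split.
- case=> [|[|[|[|//]]]] _.
  + exact: int_cst.
  + by rewrite (_ : (fun p => _ ^+ 1) = (fun p => V p.1 + D p.2)) ?S1//; exact: intD.
  + by rewrite S2; exact: intD.
  + by rewrite S3; exact: intD.
- by rewrite S1 RintegralD// E10 E01 V1' D1' mul0r mulr0 addr0.
- by rewrite S2 RintegralD// RintegralD// RintegralZl// E20 E11 E02 !one V1' mul0r mulr0 addr0 mulr1 mul1r.
- rewrite S3 RintegralD// RintegralD// RintegralD// RintegralZl// RintegralZl//.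
  by rewrite E30 E21 E12 E03 !one V1' V3 D1' !mul0r mulr0 !mulr0 !addr0 add0r mul1r.
Qed.

End independent_sum.

Section log_lognormal_rician.
Context {R : realType}.

(** The delta method is called with e = 1, only for the integrability of the powers of ln Z. The odd
    moments vanish because E |V|^k + E V^k = E |V|^k - E V^k by [lognormal_odd_moment]. *)
Lemma lognormal_log_moments (s2 : R) (s20 : 0 < s2) : s2 <= 1 ->
  let V z := ln (posn z) + s2 / 2 in
  [/\ forall k, (k <= 3)%N -> intg (lognormal_law s20) (fun z => V z ^+ k),
    \int[lognormal_law s20]_z V z = 0 & \int[lognormal_law s20]_z V z ^+ 3 = 0].
Proof.
move=> s21 V; pose mu := lognormal_law s20.
have h0 : (0 : R) < 2^-1 by rewrite invr_gt0.
have h1 : - (3 * 0) < (2^-1 : R) by rewrite mulr0 oppr0.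
have [K _ HK] := @boxcox_delta R 0 2^-1 (fun k => 4 * 2 ^+ (2 * k) * expR (8 * k%:R ^+ 2 + 2 * k%:R)) (expR 1) h0 h1.
have e11 : (0 : R) < (1 : R) <= 1 by rewrite ltr01 lexx.
have even n : (\int[mu]_z ((posn z - 1) ^+ (2 * n))%:E <=
    (4 * 2 ^+ (2 * n) * expR (8 * n%:R ^+ 2 + 2 * n%:R) * 1 ^+ (2 * n))%:E)%E.
  by apply: lognormal_even_moment => //; rewrite expr1n.
have neg : (\int[mu]_z (posn z `^ (- 2^-1))%:E <= (expR 1)%:E)%E.
  rewrite lognormal_law_powR lee_fin ler_expR.
  rewrite (_ : _ / 2 = 3 / 8 * s2); last by field.
  lra.
have E1 : (\int[mu]_z (posn z)%:E = 1%:E)%E.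
  have := @lognormal_law_expr _ _ s20 1; under eq_integral do rewrite expr1.
  by rewrite subrr mulr0 mul0r expR0.
have [C1 _ _ _] := central_from_raw (@measurable_posn R) (@posn_gt0 R) E1
  (@lognormal_law_expr _ _ s20 2) (@lognormal_law_expr _ _ s20 3) (@lognormal_law_expr _ _ s20 4).
rewrite subrr in C1.
have [_ iW _ _] := HK _ _ mu (@posn R) 1 (@measurable_posn R) (@posn_gt0 R) e11 even neg C1.
rewrite boxcox0 in iW.
have iV := int_shift_expr (s2 / 2) iW.
have odd0 k : odd k -> (k <= 3)%N -> \int[mu]_z V z ^+ k = 0.
  move=> ok k3; have iVk := iV k k3.
  have iN : intg mu (fun z => `|V z| ^+ k).
    by rewrite (_ : (fun z => _) = (fun z => `|V z ^+ k|)); [exact: (integrable_norm iVk)|apply/funext => z; rewrite normrX].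
  have : \int[mu]_z (`|V z| ^+ k + V z ^+ k) = \int[mu]_z (`|V z| ^+ k - V z ^+ k).
    by rewrite /Rintegral (@lognormal_odd_moment _ _ s20 k ok).
  rewrite RintegralD// RintegralB//; lra.
split=> //; last exact: odd0.
by have := odd0 1%N erefl erefl.
Qed.

(** With e^2 = u = 1/(1 + r) as the only scale, the leading terms 2 u and -6 u^2 dominate the errors
    K e u and K e u^2 once r is large. *)
Lemma rician_log_moments : exists M : R, forall (r : R) (r0 : 0 < r), M < r ->
  [/\ forall k, (k <= 3)%N -> intg (rician_law r0) (fun y => ln (posn y) ^+ k),
    0 < \int[rician_law r0]_y (ln (posn y) - \int[rician_law r0]_y ln (posn y)) ^+ 2 &
    \int[rician_law r0]_y (ln (posn y) - \int[rician_law r0]_y ln (posn y)) ^+ 3 < 0].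
Proof.
have h0 : (0 : R) < 2^-1 by rewrite invr_gt0.
have h1 : - (3 * 0) < (2^-1 : R) by rewrite mulr0 oppr0.
have [K K0 HK] := @boxcox_delta R 0 2^-1 (fun k => (2 * k)`!%:R * (2 * (2 * expR 3))) (Gam (1 - 2^-1) + 5) h0 h1.
(* The summand 3 gives the 1 + r >= 4 of [rician_even_moment], and (K + 1)^2 < 1 + r gives (K + 1) e
   < 1. *)
exists (3 + (K + 1) ^+ 2) => r r0 Mr.
pose nu := rician_law r0; pose u := (1 + r)^-1; pose e := Num.sqrt u.
have K2 : 0 <= (K + 1) ^+ 2 by rewrite exprn_ge0// addr_ge0.
have s0 : 0 < 1 + r by rewrite addr_gt0.
have r4 : 4 <= 1 + r by lra.
have u0 : 0 < u by rewrite invr_gt0.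
have u4 : u <= 4^-1 by rewrite lef_pV2 ?posrE.
have e0 : 0 < e by rewrite sqrtr_gt0.
have e2 : e ^+ 2 = u by rewrite sqr_sqrtr// ltW.
have e1 : e <= 1 by rewrite -(@ler_pXn2r _ 2)// ?nnegrE ?(ltW e0)// e2 expr1n; lra.
have e01 : 0 < e <= 1 by rewrite e0.
have Ke : (K + 1) * e < 1.
  have K1 : 0 < K + 1 by lra.
  rewrite -(@ltr_pXn2r _ 2)// ?nnegrE ?mulr_ge0 ?(ltW e0) ?(ltW K1)//.
  by rewrite expr1n exprMn e2 /u ltr_pdivrMr// mul1r; lra.
have even n : (\int[nu]_y ((posn y - 1) ^+ (2 * n))%:E <=
    ((2 * n)`!%:R * (2 * (2 * expR 3)) * e ^+ (2 * n))%:E)%E.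
  by apply: rician_even_moment => //; rewrite e2.
have neg : (\int[nu]_y (posn y `^ (- 2^-1))%:E <= (Gam (1 - 2^-1) + 5)%:E)%E.
  by apply: rician_negative_moment; [apply/andP; split; lra|lra].
have [A1 A2 A3 A4] := rician_law_raw r0.
have [C1 C2 C3 C4] := central_from_raw (@measurable_posn R) (@posn_gt0 R) A1 A2 A3 A4.
rewrite subrr in C1.
have [_ iW HV HT] := HK _ _ nu (@posn R) e (@measurable_posn R) (@posn_gt0 R) e01 even neg C1.
rewrite boxcox0 C2 in HV; rewrite boxcox0 C2 C3 C4 in HT; rewrite boxcox0 in iW.
split=> //.
  move: HV; rewrite -/u -/nu ler_norml => /andP[HV _].
  move: HV; set v := Rintegral _ _ _.
  have : 0 < u * (1 - K * e) by rewrite mulr_gt0// subr_gt0; lra.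
  have uu : u * u <= 4^-1 * u by rewrite ler_wpM2r// ltW.
  rewrite (_ : K * e ^+ 3 = K * e * u); last by rewrite -e2; ring.
  clear -uu u0; lra.
move: HT; rewrite -/u -/nu ler_norml => /andP[_].
set t := Rintegral _ _ _.
have u3 : 0 < u ^+ 3 by rewrite exprn_gt0.
have u34 : u ^+ 4 <= u ^+ 3 by apply: ler_wiXn2l; rewrite ?(ltW u0)//; lra.
have : 0 < u ^+ 2 * (1 - K * e) by rewrite mulr_gt0 ?exprn_gt0// subr_gt0; lra.
have : 0 < u ^+ 2 by rewrite exprn_gt0.
rewrite (_ : K * e ^+ 5 = K * e * u ^+ 2); last by rewrite -e2; ring.
rewrite (_ : _ + 3 / 2 * _ * _ = - 6 * u ^+ 2 - 28 * u ^+ 3 + 24 * u ^+ 4); last by field.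
clear -u3 u34; lra.
Qed.

(** The expansion of [lr_expansion] cannot decide the sign: at l = 0 its leading term is -6/(1 +
    r)^2, its error of order V0^(5/2), and 1/(1 + r) may be arbitrarily small compared with s2.
    Treated separately, the Rician part is compared only with errors at its own scale, and s2 < 1
    serves the integrability of ln Z. *)
Lemma lr_log_skewness : exists M delta : R, 0 < delta /\ forall r s2 : R,
  0 < r -> M < r -> 0 < s2 -> s2 < delta ->
  forall d (T : measurableType d) (P : probability T R) (X : {RV P >-> R}),
  is_lognormal_rician P X r s2 ->
  has_skewness P (fun w => ln (X w)) /\ skewness P (fun w => ln (X w)) < 0.
Proof.
have [M HM] := rician_log_moments.
exists M, 1; split=> // r s2 r0 Mr s20 s21 d T P X HX.
have law := lognormal_rician_law r0 s20 HX.
have [iD0 D2 D3] := HM r r0 Mr.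
pose mu := lognormal_law s20; pose nu := rician_law r0; pose Q := lr_law r0 s20.
pose c := \int[nu]_y ln (posn y).
pose V z := ln (posn z) + s2 / 2; pose D y := ln (posn y) - c.
have [iV V1 V3] := lognormal_log_moments s20 (ltW s21).
have iD := int_shift_expr (- c) iD0.
have D1 : \int[nu]_y D y = 0.
  have i1 : intg nu (fun y => ln (posn y)) by exact: (iD0 1%N erefl).
  by rewrite RintegralB//; [rewrite Rintegral_cst1 subrr|exact: int_cst].
have [iS S1 S2 S3] := independent_sum_moments iV iD V1 V3 D1.
pose W p := ln (@prod_posn R p).
have WE p : W p = (V p.1 + D p.2) + (c - s2 / 2).
  by rewrite /W /prod_posn lnM ?posrE ?posn_gt0// /V /D; ring.
have iS1 : intg Q (fun p => V p.1 + D p.2) by exact: (iS 1%N erefl).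
have EW : \int[Q]_p W p = c - s2 / 2.
  under eq_Rintegral do rewrite WE.
  by rewrite RintegralD// ?S1 ?Rintegral_cst1 ?add0r//; exact: int_cst.
have WS k : \int[Q]_p (W p - \int[Q]_p W p) ^+ k = \int[Q]_p (V p.1 + D p.2) ^+ k.
  by rewrite EW; apply: eq_Rintegral => p _; rewrite WE addrK.
have iW3 : intg Q (fun p => `|W p| ^+ 3).
  rewrite (_ : (fun p => _) = fun p => `|(V p.1 + D p.2 + (c - s2 / 2)) ^+ 3|); last first.
    by apply/funext => p; rewrite WE normrX.
  exact: (integrable_norm (int_shift_expr (c - s2 / 2) iS (isT : (3 <= 3)%N))).
have mW : meas (R * R) W.
  exact: (measurableT_comp (@measurable_ln R) (@measurable_prod_posn R)).
have V0 : 0 < \int[Q]_p (W p - \int[Q]_p W p) ^+ 2.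
  rewrite WS S2; apply: lt_le_trans D2 _; rewrite lerDr.
  by apply: Rintegral_ge0 => z _; exact: sqr_ge0.
split.
  apply/(has_skewness_law (Y := (@prod_posn R : {RV Q >-> R})) law (@measurable_ln R)).
  exact: (has_skewness_int mW iW3 V0).
rewrite (skewness_law (Y := (@prod_posn R : {RV Q >-> R})) law (@measurable_ln R)).
have -> := skewnessE Q W.
by rewrite WS S3 pmulr_llt0// invr_gt0 powR_gt0.
Qed.

End log_lognormal_rician.

Theorem proposition3 (R : realType) :
  (* Gamma-Gamma *)
  [/\ (exists M : R, forall a b : R,
        0 < b -> b <= a -> M < a -> M < b ->
        forall (d : measure_display) (T : measurableType d)
               (P : probability T R) (X : {RV P >-> R}),
          is_gamma_gamma P X a b ->
          has_skewness P (fun w => ln (X w)) /\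
          skewness P (fun w => ln (X w)) < 0) &
      (forall tau : R, 1 <= tau ->
        let lstar := (tau ^+ 2 + 1) / (3 * (tau + 1) ^+ 2) in
        (6^-1 <= lstar < 3^-1) /\
        (forall (d : R -> measure_display)
                (T : forall b : R, measurableType (d b))
                (P : forall b : R, probability (T b) R)
                (X : forall b : R, {RV (P b) >-> R}),
          (\forall b \near +oo, is_gamma_gamma (P b) (X b) (tau * b) b) ->
          forall l : R,
            (\forall b \near +oo,
               has_skewness (P b) (fun w => boxcox l (X b w))) /\
            (Num.sqrt b * skewness (P b) (fun w => boxcox l (X b w))
               @[b --> +oo] --> (0 : R) <-> l = lstar)))]
  /\
  (* Lognormal-Rician *)
  [/\ (forall r s2 : R, 0 < r -> 0 < s2 ->
        lr_rho r s2 = (2 + (1 + r) * s2)^-1 /\ 0 < lr_rho r s2 < 2^-1),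
      (exists M delta : R, 0 < delta /\ forall r s2 : R,
        0 < r -> M < r -> 0 < s2 -> s2 < delta ->
        forall (d : measure_display) (T : measurableType d)
               (P : probability T R) (X : {RV P >-> R}),
          is_lognormal_rician P X r s2 ->
          has_skewness P (fun w => ln (X w)) /\
          skewness P (fun w => ln (X w)) < 0) &
      (forall rho : R, 0 < rho < 2^-1 ->
        exists lstar : R,
        [/\ (forall r s2 : R, 0 < r -> 0 < s2 -> lr_rho r s2 = rho ->
              lstar = 2 / (2 + (1 + r) * s2) ^+ 2),
            0 < lstar < 2^-1 &
            (forall (d : R -> measure_display)
                    (T : forall v : R, measurableType (d v))
                    (P : forall v : R, probability (T v) R)
                    (X : forall v : R, {RV (P v) >-> R})
                    (r s2 : R -> R),
              (\forall v \near 0^'+,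
                 [/\ 0 < r v, 0 < s2 v,
                     lr_V0 (r v) (s2 v) = v, lr_rho (r v) (s2 v) = rho &
                     is_lognormal_rician (P v) (X v) (r v) (s2 v)]) ->
              forall l : R,
                ((\forall v \near 0^'+,
                    has_skewness (P v) (fun w => boxcox l (X v w))) /\
                 skewness (P v) (fun w => boxcox l (X v w)) / Num.sqrt v
                   @[v --> 0^'+] --> (0 : R)) <-> l = lstar)])].
Proof.
split; split.
- exact: gg_log_skewness.
- move=> tau t1 lstar; split; first exact: gg_lstar_bounds.
  by move=> d T P X HX l; exact: gg_boxcox_limit.
- exact: lr_rhoE.
- exact: lr_log_skewness.
- move=> rho /andP[rho0 rho1]; exists (2 * rho ^+ 2); split.
  + by move=> r s2 r0 s20 rE; exact: lr_lstarE.
  + by apply/andP; split; nra.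
  + by move=> d T P X r s2 H l; exact: lr_boxcox_limit H l.
Qed.
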